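(* Let $N\ge 1$, let $0=\kappa_0<\kappa_1<\cdots<\kappa_N<\kappa_{N+1}=1$, and suppose that for each $1\le i\le N$, $\partial_x m(\kappa_i,t)=0$ for all $t\in[0,T]$. Assume furthermore that $\{i:0\le i\le N\}=\mathbf A\cup\mathbf B$, where $$\mathbf A=\big\{i: 0\le i\le N,\ \partial_x m(x,t)\neq 0 \text{ for all } (x,t)\in(\kappa_i,\kappa_{i+1})\times[0,T]\big\},$$ $$\mathbf B=\big\{i: 0\le i\le N,\ \partial_x m(x,t)=0 \text{ for all } (x,t)\in[\kappa_i,\kappa_{i+1}]\times[0,T]\big\}.$$ Let $\lambda(D)$ be the principal eigenvalue of $$\begin{cases}\partial_t\varphi-D\partial_{xx}\varphi-\partial_x m\,\partial_x\varphi+V\varphi=\lambda(D)\varphi & \text{in }(0,1)\times(0,T),\\ \partial_x\varphi(0,t)=\partial_x\varphi(1,t)=0 & \text{on }[0,T],\\ \varphi(x,0)=\varphi(x,T) & \text{on }(0,1).\end{cases}$$ Then $$\lim_{D\to 0}\lambda(D)=\min\left\{\min_{0\le i\le N+1}\left\{\hat V(\kappa_i)+[\partial_{xx}\hat m]_+(\kappa_i)\right\},\ \min_{i\in\mathbf B}\left\{\min_{x\in[\kappa_i,\kappa_{i+1}]}\hat V(x)\right\}\right\},$$ where $\partial_{xx}\hat m(0)$ and $\partial_{xx}\hat m(1)$ are defined by the boundary convention in the context.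
   Context: $T>0$ and $D>0$. The functions $m\in C^{2,1}([0,1]\times[0,T])$ ($C^2$ in $x$, $C^1$ in $t$) and $V\in C([0,1]\times[0,T])$ are periodic in $t$ with common period $T$. The principal eigenvalue is the simple real eigenvalue of the stated time-periodic problem that has a positive eigenfunction (it exists by the Krein-Rutman theorem, and every other eigenvalue has larger real part). For a $T$-periodic function $p(x,t)$: $\hat p(x)=\frac1T\int_0^T p(x,s)\,ds$; $[q]_+=\max\{q,0\}$, with $[+\infty]_+=+\infty$ and $[-\infty]_+=0$. Boundary convention: $\partial_{xx}\hat m$ at the endpoints is redefined by $$\partial_{xx}\hat m(0)=\begin{cases}-\infty & \text{if }\partial_x\hat m(0^+)<0,\\ +\infty & \text{if }\partial_x\hat m(0^+)>0,\end{cases}\qquad \partial_{xx}\hat m(1)=\begin{cases}+\infty & \text{if }\partial_x\hat m(1^-)<0,\\ -\infty & \text{if }\partial_x\hat m(1^-)>0,\end{cases}$$ and keeps its usual meaning at an endpoint where $\partial_x\hat m$ vanishes. A minimum over an empty index set is $+\infty$ (so the second term is dropped when $\mathbf B=\emptyset$). *)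

(* Defs.v *)
From HB Require Import structures.
From mathcomp Require Import all_boot all_order all_algebra.
From mathcomp Require Import all_classical all_reals all_analysis.
Set Implicit Arguments.
Unset Strict Implicit.
Unset Printing Implicit Defensive.
Import Order.TTheory GRing.Theory Num.Theory.
Import numFieldNormedType.Exports.
Local Open Scope classical_set_scope.
Local Open Scope ring_scope.

(* Functions of (x, t) are curried, space variable first. *)
Section Defs.
Context {R : realType}.

Local Notation leb := (@lebesgue_measure R).
Local Notation leb2 := ((leb \x leb)%E).

(* Derivatives relative to a set: on a closed interval they are one-sided at
   the two endpoints and two-sided inside. *)
Definition diff_quot (f : R -> R) (x y : R) : R := (f y - f x) / (y - x).

Definition derivable_in (A : set R) (f : R -> R) (x : R) : Prop :=
  cvg (diff_quot f x y @[y --> within A x^']).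

Definition deriv_in (A : set R) (f : R -> R) (x : R) : R :=
  lim (diff_quot f x y @[y --> within A x^']).

Definition dx (f : R -> R -> R) (x t : R) : R := deriv_in `[0, 1] (f^~ t) x.

Definition dt (T : R) (f : R -> R -> R) (x t : R) : R :=
  deriv_in `[0, T] (f x) t.

Definition rect (T : R) : set (R * R) := `[0, 1] `*` `[0, T].

Definition continuous_rect (T : R) (f : R -> R -> R) : Prop :=
  {within rect T, continuous (fun z : R * R => f z.1 z.2)}.

Definition dx_exists (T : R) (f : R -> R -> R) : Prop :=
  forall x t, rect T (x, t) -> derivable_in `[0, 1] (f^~ t) x.

Definition dt_exists (T : R) (f : R -> R -> R) : Prop :=
  forall x t, rect T (x, t) -> derivable_in `[0, T] (f x) t.

Definition C10 (T : R) (f : R -> R -> R) : Prop :=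
  [/\ continuous_rect T f, dx_exists T f & continuous_rect T (dx f)].

Definition C21 (T : R) (f : R -> R -> R) : Prop :=
  [/\ C10 T f, C10 T (dx f), dt_exists T f & continuous_rect T (dt T f)].

Definition time_periodic (T : R) (f : R -> R -> R) : Prop :=
  forall x t, x \in `[0, 1] -> f x (t + T) = f x t.

Definition hat (T : R) (p : R -> R -> R) (x : R) : R :=
  T^-1 * \int[leb]_(s in `[0, T]) p x s.

(* ft and fxx are the generalized derivatives of f with respect to t and of
   dx f with respect to x: they are integrable on the rectangle, and f, resp.
   dx f, is a primitive of ft, resp. fxx, on almost every line. *)
Definition generalized_derivatives (T : R) (f ft fxx : R -> R -> R) : Prop :=
  [/\ leb2.-integrable (rect T) (fun z : R * R => (ft z.1 z.2)%:E),
      leb2.-integrable (rect T) (fun z : R * R => (fxx z.1 z.2)%:E),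
      {ae leb, forall x, x \in `[0, 1] -> forall t, t \in `[0, T] ->
         f x t = f x 0 + \int[leb]_(s in `[0, t]) ft x s} &
      {ae leb, forall t, t \in `[0, T] -> forall x, x \in `[0, 1] ->
         dx f x t = dx f 0 t + \int[leb]_(y in `[0, x]) fxx y t}].

(* f is a strong solution of
     f_t - D f_xx - m_x f_x + V f = lam f + g   in (0,1) x (0,T),
     f_x(0,t) = f_x(1,t) = 0,   f(x,0) = f(x,T).
   V is only continuous, so the eigenfunctions need not be C^{2,1}; they lie in
   W^{2,1}_p for every finite p, hence f and f_x are continuous up to the
   boundary while f_t and f_xx are generalized derivatives and the equation
   holds almost everywhere. *)
Definition solves (T D : R) (m V : R -> R -> R) (lam : R)
    (g f : R -> R -> R) : Prop :=
  [/\ C10 T f,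
      exists ft fxx : R -> R -> R,
        generalized_derivatives T f ft fxx /\
        {ae leb2, forall z : R * R, z.1 \in `]0, 1[ -> z.2 \in `]0, T[ ->
           let: (x, t) := z in
           ft x t - D * fxx x t - dx m x t * dx f x t + V x t * f x t
             = lam * f x t + g x t},
      forall t, t \in `[0, T] -> dx f 0 t = 0 /\ dx f 1 t = 0 &
      forall x, x \in `]0, 1[ -> f x 0 = f x T].

Definition eigenfunction (T D : R) (m V : R -> R -> R) (lam : R)
    (phi : R -> R -> R) : Prop :=
  solves T D m V lam (fun _ _ => 0) phi /\
  exists x t, rect T (x, t) /\ phi x t != 0.

(* Algebraic simplicity of lam with eigenfunction phi: the eigenspace is
   spanned by phi, and there is no generalized eigenfunction psi with
   (L - lam) psi = phi. *)
Definition simple_eigenvalue (T D : R) (m V : R -> R -> R) (lam : R)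
    (phi : R -> R -> R) : Prop :=
  [/\ eigenfunction T D m V lam phi,
      forall psi, eigenfunction T D m V lam psi ->
        exists c : R, forall x t, rect T (x, t) -> psi x t = c * phi x t &
      ~ exists psi, solves T D m V lam phi psi].

Definition principal_eigenvalue (T D : R) (m V : R -> R -> R) (lam : R) : Prop :=
  exists2 phi : R -> R -> R,
    simple_eigenvalue T D m V lam phi &
    forall x t, rect T (x, t) -> 0 < phi x t.

(* Second derivative of hat m, with infinite values at an endpoint of [0,1]
   where the first derivative of hat m does not vanish: +oo if the drift dx m
   points into the interval on average, -oo if it points outwards. *)
Definition dxx_hat (T : R) (m : R -> R -> R) (x : R) : \bar R :=
  let d := deriv_in `[0, 1] (hat T m) in
  if (x == 0) && (d x < 0) then -oo%E
  else if (x == 0) && (0 < d x) then +oo%E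
  else if (x == 1) && (d x < 0) then +oo%E
  else if (x == 1) && (0 < d x) then -oo%E
  else (deriv_in `[0, 1] d x)%:E.

Definition pospart (q : \bar R) : \bar R := maxe q 0%E.

Definition setA (T : R) (m : R -> R -> R) (N : nat) (kappa : nat -> R)
    : set nat :=
  [set i | (i <= N)%N /\
    forall x t, x \in `]kappa i, kappa i.+1[ -> t \in `[0, T] ->
      dx m x t != 0].

Definition setB (T : R) (m : R -> R -> R) (N : nat) (kappa : nat -> R)
    : set nat :=
  [set i | (i <= N)%N /\
    forall x t, x \in `[kappa i, kappa i.+1] -> t \in `[0, T] ->
      dx m x t = 0].

(* The minimum of the continuous function hat V over [kappa i, kappa i.+1] is
   written as the infimum of its image. *)
Definition limit_value (T : R) (m V : R -> R -> R) (N : nat)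
    (kappa : nat -> R) : \bar R :=
  mine
    (\big[mine/+oo%E]_(0 <= i < N.+2)
       ((hat T V (kappa i))%:E + pospart (dxx_hat T m (kappa i)))%E)
    (\big[mine/+oo%E]_(0 <= i < N.+1 | i \in setB T m N kappa)
       ereal_inf [set (hat T V x)%:E | x in `[kappa i, kappa i.+1]]).

End Defs.

(* Main.v *)
(* Write b for the drift dx m. A positive strict sub- or supersolution of the
   periodic problem bounds lambda(D), because its quotient with the eigenfunction
   satisfies the weak maximum principle.

   Upper bound. Near a point x0 where b (x - x0) <= (beta + delta) (x - x0)^2 with
   beta(t) >= 0, the truncated Gaussian f(t) exp(- a(t) (x - x0)^2 / (2 D)) is a
   subsolution when a solves the periodic Riccati equation
   a' = 2 (beta + 2 delta) a - 2 a^2. The mean of a equals that of beta + 2 delta,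
   and f absorbs the oscillation in time, so that
   limsup lambda <= \hat V(x0) + \hat beta. This is used with beta the second
   derivative of m at repelling zeros of b, and with beta = 0 at attracting zeros,
   at endpoints towards which the drift points, and on the intervals of B.

   Lower bound. One builds the logarithm v of a supersolution as a sum of wells
   - a_i (x - kappa_i)^2 / (2 D), truncated, at the repelling kappa_i, and of a
   bounded part. In the bounded part, a function of (x, t) removes the oscillation
   in time of the potential, a linear function of x makes the value at an endpoint
   with inward drift as large as needed, and K times a potential h decreasing along
   the flow makes everything large where b h' <> 0. What remains by compactness are
   the zeros of b h', that is the kappa_i and the intervals of B. *)
Require Import Defs.
From HB Require Import structures.
From mathcomp Require Import all_boot all_order all_algebra.
From mathcomp Require Import all_classical all_reals all_analysis.
From mathcomp Require Import measurable_realfun ring lra.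
Set Implicit Arguments.
Unset Strict Implicit.
Unset Printing Implicit Defensive.
Import Order.TTheory GRing.Theory Num.Theory.
Import numFieldNormedType.Exports.
Local Open Scope classical_set_scope.
Local Open Scope ring_scope.

(** The eigenfunction has [ft] and [fxx] only as integrable functions, so its quotients cannot be
    examined pointwise at a maximum: the maximum principle is an integral one, and calculus on
    eigenfunctions goes through absolute continuity on lines. Test functions are classical. The
    scales dictate the constructions. A Gaussian of width sqrt D sees the drift only through its
    slope at x0, and cutting it at a fixed radius introduces a constant exp (- const / D),
    eventually below every margin. In logarithmic form the wells have size 1 / D and the rest size
    1: - D v_xx of a well is of order one and acts as an extra potential, equal to a_i at the
    centre, while the cross term between a well and the bounded part is absorbed, up to order D, by
    the surplus left by a slightly lowered Riccati coefficient. The limit contains the positive part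
    of an average, whereas Riccati equations see b_x at each time. The two agree because the drift
    keeps one sign between consecutive kappa_i, so that b_x (kappa_i, t) keeps one sign in time. *)

Section UnifCont.
Context {R : realType}.

(** Compactness is used in its near-covering form, which replaces a finite subcover and its Lebesgue
    number; halving the local radius puts both points into one good ball. *)
Lemma compact_ucont (M : pseudoMetricType R) (A : set M) (f : M -> R) :
  compact A -> {within A, continuous f} ->
  forall e : R, 0 < e -> exists2 d : R, 0 < d &
    forall x y, A x -> A y -> ball x d y -> `|f x - f y| < e.
Proof.
move=> /compact_near_coveringP/near_covering_withinP cA cf e e0.
have P : \forall d \near (0:R)^'+, A `<=` (fun x => forall y, A y -> ball x d y -> `|f x - f y| < e).
  apply: cA => x Ax.
  have e20 : 0 < e / 2 by rewrite divr_gt0.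
  have : within A (nbhs x) [set y | `|f x - f y| < e / 2].
    have := cf x; rewrite /prop_for /continuous_at.
    move=> /cvgrPdist_lt/(_ _ e20).
    by rewrite {1}/nbhs /= nbhs_subspace_in.
  rewrite /within /= => /nbhs_ballP[r /= r0 hr].
  have r20 : 0 < r / 2 by rewrite divr_gt0.
  near=> z d => /= Az y Ay zdy.
  have xz : ball x (r / 2) z by near: z; exact: nbhsx_ballx.
  have xy : ball x r y.
    rewrite [r]splitr; apply: (ball_triangle xz); apply: (le_ball _ zdy).
    by near: d; apply: nbhs_right_le.
  have xz' : ball x r z by apply: (le_ball _ xz); rewrite ler_pdivrMr// ler_pMr// ler1n.
  have h1 := hr _ xz' Az; have h2 := hr _ xy Ay.
  by rewrite (splitr e) -(subrKA (f x)) (le_lt_trans (ler_normD _ _))// ltrD// distrC.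
near (0:R)^'+ => d.
exists d => //.
suff h : A `<=` (fun x => forall y, A y -> ball x d y -> `|f x - f y| < e).
  by move=> x y /h; exact.
by near: d.
Unshelve. all: by end_near. Qed.
End UnifCont.

(** * One-dimensional integrals and absolute continuity *)

Section Int1.
Context {R : realType}.
Notation leb := (@lebesgue_measure R).
Implicit Types (a b c s t : R) (f g h : R -> R).

Definition itg a b f := leb.-integrable `[a, b] (EFin \o f).
Definition pint f a b := \int[leb]_(s in `[a, b]) f s.

Lemma itgS a b s t f : itg a b f -> a <= s -> t <= b -> itg s t f.
Proof.
move=> fi sa tb; apply: (integrableS _ _ _ fi) => //.
by apply: subset_itv; rewrite bnd_simp.
Qed.

Lemma pint_split a b c f : itg a b f -> a <= c -> c <= b ->
  pint f a b = pint f a c + pint f c b.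
Proof.
move=> fi ac cb; apply/eqP; rewrite addrC -subr_eq; apply/eqP.
rewrite /pint Rintegral_itvB// ?bnd_simp//.
rewrite Rintegral_itv_obnd_cbnd//.
apply: (integrableS _ _ _ fi) => //.
by apply: subset_itv; rewrite bnd_simp.
Qed.

Lemma pint_xx a f : pint f a a = 0.
Proof. by rewrite /pint set_itv1 Rintegral_set1. Qed.

Lemma itgD a b f g : itg a b f -> itg a b g -> itg a b (fun x => f x + g x).
Proof. by move=> fi gi; exact: (integrableD _ fi gi). Qed.

Lemma itgZ a b k f : itg a b f -> itg a b (fun x => k * f x).
Proof. by move=> fi; exact: (integrableZl _ _ fi). Qed.

Lemma itgB a b f g : itg a b f -> itg a b g -> itg a b (fun x => f x - g x).
Proof. by move=> fi gi; exact: (integrableB _ fi gi). Qed.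

Lemma itg_abs a b f : itg a b f -> itg a b (fun x => `|f x|).
Proof. by move=> fi; exact: (integrable_norm fi). Qed.

Lemma pintD a b f g : itg a b f -> itg a b g ->
  pint (fun x => f x + g x) a b = pint f a b + pint g a b.
Proof. by move=> fi gi; exact: RintegralD. Qed.

Lemma pintB a b f g : itg a b f -> itg a b g ->
  pint (fun x => f x - g x) a b = pint f a b - pint g a b.
Proof. by move=> fi gi; exact: RintegralB. Qed.

Lemma pintZ a b k f : itg a b f ->
  pint (fun x => k * f x) a b = k * pint f a b.
Proof. by move=> fi; exact: RintegralZl. Qed.

Lemma le_pint a b f g : itg a b f -> itg a b g ->
  (forall x, a <= x <= b -> f x <= g x) -> pint f a b <= pint g a b.
Proof.
by move=> fi gi fg; apply: le_Rintegral => // x; rewrite /= in_itv /=; exact: fg.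
Qed.

Lemma eq_pint a b f g :
  (forall x, a <= x <= b -> f x = g x) -> pint f a b = pint g a b.
Proof.
move=> fg; apply: eq_Rintegral => x; rewrite inE/= in_itv/=; exact: fg.
Qed.

Lemma pint_norm a b f : itg a b f -> `|pint f a b| <= pint (fun x => `|f x|) a b.
Proof. by move=> fi; exact: le_normr_Rintegral. Qed.

Lemma pint_ge0 a b f : (forall x, a <= x <= b -> 0 <= f x) -> 0 <= pint f a b.
Proof. by move=> f0; apply: Rintegral_ge0 => x; rewrite /= in_itv/=; exact: f0. Qed.

Lemma pint_cst a b k : a <= b -> pint (fun=> k) a b = k * (b - a).
Proof.
move=> ab; rewrite /pint Rintegral_cst//= lebesgue_measure_itv/= lte_fin.
by case: ltgtP ab => // -> _; rewrite ?subrr.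
Qed.

Lemma ccont_itg a b f : {within `[a, b], continuous f} -> itg a b f.
Proof. by move=> cf; apply: continuous_compact_integrable => //; exact: segment_compact. Qed.

Lemma cont_itg a b f : continuous f -> itg a b f.
Proof. by move=> cf; apply: ccont_itg; apply: continuous_subspaceT. Qed.

Lemma itg_cst a b k : itg a b (fun=> k).
Proof. by apply: cont_itg => x; exact: cvg_cst. Qed.

Lemma ccont_bounded a b f : {within `[a, b], continuous f} ->
  exists2 M : R, 0 < M & forall x, a <= x <= b -> `|f x| <= M.
Proof.
move=> cf.
have : compact (f @` `[a, b]) by apply: continuous_compact => //; exact: segment_compact.
move/compact_bounded => [M [_ hM]].
exists (Num.max M 0 + 1); first by rewrite ltr_wpDl// le_max lexx orbT.
move=> x xab; apply: (hM (Num.max M 0 + 1)).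
  by rewrite (@le_lt_trans _ _ (Num.max M 0))// ?le_max ?lexx// ltrDl.
by exists x => //=; rewrite in_itv.
Qed.

Lemma itgM_ccont a b f g : {within `[a, b], continuous g} -> itg a b f ->
  itg a b (fun x => f x * g x).
Proof.
move=> cg fi; have [M M0 hM] := ccont_bounded cg.
have -> : itg a b (fun x => f x * g x) = leb.-integrable `[a, b] ((EFin \o f) \* (EFin \o g))%E.
  by congr (integrable _ _ _).
apply: integrableMl => //.
  by apply: subspace_continuous_measurable_fun.
exists M; split; first by rewrite num_real.
by move=> y My x/=; rewrite in_itv/= => /hM /le_trans; apply; exact: ltW.
Qed.

Lemma itv_ucont a b f : {within `[a, b], continuous f} ->
  forall e : R, 0 < e -> exists2 d : R, 0 < d &
    forall x y, a <= x <= b -> a <= y <= b -> `|x - y| < d -> `|f x - f y| < e.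
Proof.
move=> cf e e0; have [d d0 hd] := compact_ucont (@segment_compact R a b) cf e0.
by exists d => // x y xab yab xy; apply: hd; rewrite /= ?in_itv//=.
Qed.

(* f is absolutely continuous on [a, b] with density f'. *)
Definition ACI a b f f' := itg a b f' /\
  forall t, a <= t <= b -> f t = f a + pint f' a t.

Lemma ACI_sub a b f f' s t : ACI a b f f' -> a <= s -> s <= t -> t <= b ->
  f t - f s = pint f' s t.
Proof.
move=> [fi hf] sa st tb.
rewrite (hf t) ?(le_trans sa)//= (hf s) ?sa ?(le_trans st)//.
rewrite (@pint_split a t s) ?(itgS fi)//. lra.
Qed.

Lemma ACI_cont a b f f' : a < b -> ACI a b f f' -> {within `[a, b], continuous f}.
Proof.
move=> ab [fi hf].
have := parameterized_integral_continuous (ltW ab) fi.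
move=> cF.
have : {within `[a, b], continuous (fun x => f a + pint f' a x)}.
  by move=> x; apply: cvgD; [exact: cvg_cst|exact: cF].
apply: subspace_eq_continuous => x; rewrite inE/= in_itv/= => /hf.
by rewrite /from_subspace /= => ->.
Qed.

(** Cut [[a, t]] into equal pieces shorter than [d] and add the local errors: the total is at most
    [e] times a fixed integral of [h], and [e] is arbitrary. The product and reciprocal rules and
    the fundamental theorem all come from this criterion, without differentiating almost
    everywhere. *)
Lemma ACI_crit a b f g h : itg a b g -> itg a b h ->
  (forall x, a <= x <= b -> 0 <= h x) ->
  (forall e, 0 < e -> exists2 d : R, 0 < d & forall s t, a <= s -> s <= t -> t <= b ->
     t - s < d -> `|f t - f s - pint g s t| <= e * pint h s t) ->
  ACI a b f g.
Proof.
move=> gi hi h0 H; split => // t /andP[at_ tb].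
apply/eqP; rewrite -subr_eq0 -normr_le0; apply/ler_addgt0Pl => e e0; rewrite addr0.
have hh0 : 0 <= pint h a t by apply: pint_ge0 => x /andP[? ?]; rewrite h0//; lra.
(* The added 1 covers an [h] of zero integral. *)
pose e' := e / (pint h a t + 1).
have e'0 : 0 < e' by rewrite divr_gt0// ltr_wpDl.
have [d d0 hd] := H _ e'0.
have [n hn] : exists n : nat, t - a < d * n.+1%:R.
  have := archi_boundP (divr_ge0 (_ : 0 <= t - a) (ltW d0)).
  rewrite subr_ge0 => /(_ at_) ; set n := Num.bound _ => hn; exists n.
  rewrite mulrC -ltr_pdivrMr//; apply: (lt_trans hn); by rewrite ltr_nat.
pose p k := a + k%:R * ((t - a) / n.+1%:R).
have n0 : (0:R) < n.+1%:R by rewrite ltr0n.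
have step0 : 0 <= (t - a) / n.+1%:R by rewrite divr_ge0// ?subr_ge0.
have pS k : p k.+1 = p k + (t - a) / n.+1%:R.
  by rewrite /p -addrA -[X in _ * _ + X]mul1r -mulrDl -natr1.
have p0 : p 0%N = a by rewrite /p mul0r addr0.
have pn : p n.+1 = t by rewrite /p mulrC divfK ?gt_eqF//; lra.
have ple k : a <= p k by rewrite /p lerDl mulr_ge0.
have pb k : (k <= n.+1)%N -> p k <= t.
  move=> kn; rewrite -pn /p lerD2l ler_wpM2r// ler_nat//.
have Q k : (k <= n.+1)%N -> `|f (p k) - f a - pint g a (p k)| <= e' * pint h a (p k).
  elim: k => [_|k IH kn].
    by rewrite p0 !pint_xx !subrr normr0 mulr0.
  have kn' : (k <= n.+1)%N by exact: ltnW.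
  have pk : p k <= p k.+1 by rewrite pS lerDl.
  have := hd (p k) (p k.+1) (ple k) pk (le_trans (pb _ kn) tb).
  have -> : p k.+1 - p k < d by rewrite pS addrC addKr ltr_pdivrMr.
  move=> /(_ isT) h1; have h2 := IH kn'.
  rewrite (@pint_split a (p k.+1) (p k) g) ?(@pint_split a (p k.+1) (p k) h)//; last 2 first.
  - by apply: (itgS hi) => //; rewrite (le_trans (pb _ kn)).
  - by apply: (itgS gi) => //; rewrite (le_trans (pb _ kn)).
  rewrite mulrDr.
  have -> : f (p k.+1) - f a - (pint g a (p k) + pint g (p k) (p k.+1)) =
    (f (p k) - f a - pint g a (p k)) + (f (p k.+1) - f (p k) - pint g (p k) (p k.+1)) by lra.
  by rewrite (le_trans (ler_normD _ _))// lerD.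
have := Q _ (leqnn _); rewrite pn => hh.
rewrite opprD addrA (le_trans hh)// /e' -mulrA ler_piMr// ?(ltW e0)//.
by rewrite mulrC ler_pdivrMr ?ltr_wpDl// mul1r lerDl.
Qed.

Lemma ACI_eq a b f g f' : (forall x, a <= x <= b -> f x = g x) -> ACI a b f f' -> ACI a b g f'.
Proof.
move=> fg [fi hf]; split => // t tab; rewrite -fg// hf// fg//.
by move: tab => /andP[? ?]; rewrite lexx /=; lra.
Qed.

(** Writing the increment as [g t * (f t - f s) + f s * (g t - g s)], the error integrand is
    [f' x * (g t - g x) + g' x * (f s - f x)], small relative to [|f'| + |g'|] by uniform
    continuity. *)
Lemma ACI_mul a b f g f' g' : a < b -> ACI a b f f' -> ACI a b g g' ->
  ACI a b (fun x => f x * g x) (fun x => f' x * g x + g' x * f x).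
Proof.
move=> ab Hf Hg; have cf := ACI_cont ab Hf; have cg := ACI_cont ab Hg.
have [f'i _] := Hf; have [g'i _] := Hg.
apply: (@ACI_crit a b _ _ (fun x => `|f' x| + `|g' x|)).
- by apply: itgD; apply: itgM_ccont.
- by apply: itgD; apply: itg_abs.
- by move=> x _; rewrite addr_ge0.
move=> e e0.
have [d1 d10 hd1] := itv_ucont cf e0; have [d2 d20 hd2] := itv_ucont cg e0.
exists (Num.min d1 d2); first by rewrite lt_min d10.
move=> s t sa st tb; rewrite lt_min => /andP[td1 td2].
have sub k : itg a b k -> itg s t k by move=> /itgS; apply.
have -> : f t * g t - f s * g s - pint (fun x => f' x * g x + g' x * f x) s t =
  pint (fun x => f' x * (g t - g x) + g' x * (f s - f x)) s t.
  have -> : f t * g t - f s * g s = g t * (f t - f s) + f s * (g t - g s) by ring.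
  rewrite (ACI_sub Hf)// (ACI_sub Hg)// -!pintZ ?sub//.
  rewrite -pintD -?pintB; try (by apply: sub; repeat (apply: itgD || apply: itgZ || apply: itgM_ccont)).
  by apply: eq_pint => x _; ring.
rewrite -pintZ; last by apply: sub; apply: itgD; apply: itg_abs.
have i1 : itg s t (fun x => f' x * (g t - g x) + g' x * (f s - f x)).
  have -> : (fun x => f' x * (g t - g x) + g' x * (f s - f x)) =
    (fun x => (g t * f' x - f' x * g x) + (f s * g' x - g' x * f x)).
    by apply/funext => x; ring.
  by apply: sub; repeat (apply: itgB || apply: itgD || apply: itgZ || apply: itgM_ccont).
apply: (le_trans (pint_norm i1)); apply: le_pint.
- exact: itg_abs.
- by apply: itgZ; apply: itgD; apply: itg_abs; exact: sub.
move=> x /andP[sx xt]; rewrite (le_trans (ler_normD _ _))// !normrM mulrDr.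
have ax : a <= x <= b by apply/andP; split; lra.
apply: lerD; rewrite mulrC ler_wpM2r// ltW//.
- by apply: hd2 => //; [apply/andP; split; lra|rewrite ger0_norm; lra].
- by apply: hd1 => //; [apply/andP; split; lra|rewrite ler0_norm; lra].
Qed.

(** The error integrand is [f'] times [(f x)^-2 - (f s)^-1 * (f t)^-1], a sum of two products of a
    value of [1 / f], bounded by [M], with an increment of [1 / f]; hence the tolerance
    [e / (2 * M)]. *)
Lemma ACI_inv a b f f' : a < b -> ACI a b f f' -> (forall x, a <= x <= b -> 0 < f x) ->
  ACI a b (fun x => (f x)^-1) (fun x => f' x * - (f x)^-2).
Proof.
move=> ab Hf f0; have cf := ACI_cont ab Hf.
have [f'i _] := Hf.
have ck : {within `[a, b], continuous (fun x => (f x)^-1)}.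
  apply/continuous_within_itvP => //; move/continuous_within_itvP : cf => /(_ ab)[c1 c2 c3].
  split.
  - move=> x xab; apply: cvgV; last exact: c1.
    by rewrite gt_eqF// f0//; move: xab; rewrite in_itv/= => /andP[/ltW-> /ltW->].
  - by apply: cvgV => //; rewrite gt_eqF// f0// lexx ltW.
  - by apply: cvgV => //; rewrite gt_eqF// f0// lexx ltW.
have [M M0 hM] := ccont_bounded ck.
have ck2 : {within `[a, b], continuous (fun x => - (f x)^-2)}.
  have -> : (fun x => - (f x)^-2) = (fun x => - ((f x)^-1 * (f x)^-1)).
    by apply/funext => x; rewrite -exprVn expr2.
  by move=> x; apply: cvgN; apply: cvgM; exact: ck.
apply: (@ACI_crit a b _ _ (fun x => `|f' x|)).
- exact: itgM_ccont.
- exact: itg_abs.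
- by [].
move=> e e0.
have e20 : 0 < e / (2 * M) by rewrite divr_gt0// mulr_gt0.
have [d d0 hd] := itv_ucont ck e20.
exists d => // s t sa st tb tsd.
have sab : a <= s <= b by apply/andP; split; lra.
have tab : a <= t <= b by apply/andP; split; lra.
have sub k : itg a b k -> itg s t k by move=> /itgS; apply.
have fs := f0 s sab; have ft := f0 t tab.
have -> : (f t)^-1 - (f s)^-1 - pint (fun x => f' x * - (f x)^-2) s t =
  pint (fun x => f' x * ((f x)^-2 - (f s)^-1 * (f t)^-1)) s t.
  have -> : (f t)^-1 - (f s)^-1 = (- (f s)^-1 * (f t)^-1) * (f t - f s).
    by field; rewrite !gt_eqF.
  rewrite (ACI_sub Hf)// -pintZ ?sub// -pintB; last 2 first.
  - by apply: itgZ; exact: sub.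
  - by apply: sub; exact: itgM_ccont.
  by apply: eq_pint => x _; ring.
rewrite -pintZ; last by apply: sub; apply: itg_abs.
have i1 : itg s t (fun x => f' x * ((f x)^-2 - (f s)^-1 * (f t)^-1)).
  have -> : (fun x => f' x * ((f x)^-2 - (f s)^-1 * (f t)^-1)) =
    (fun x => (- ((f s)^-1 * (f t)^-1)) * f' x - f' x * - (f x)^-2).
    by apply/funext => x; ring.
  by apply: itgB; [apply: itgZ; exact: sub|apply: sub; exact: itgM_ccont].
apply: (le_trans (pint_norm i1)); apply: le_pint.
- exact: itg_abs.
- by apply: itgZ; apply: itg_abs; exact: sub.
move=> x /andP[sx xt]; rewrite normrM mulrC ler_wpM2r//.
have xab : a <= x <= b by apply/andP; split; lra.
have -> : (f x)^-2 - (f s)^-1 * (f t)^-1 = (f x)^-1 * ((f x)^-1 - (f t)^-1)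
   + (f t)^-1 * ((f x)^-1 - (f s)^-1) by rewrite -exprVn; ring.
have -> : e = M * (e / (2 * M)) + M * (e / (2 * M)).
  by field; rewrite gt_eqF.
rewrite (le_trans (ler_normD _ _))// !normrM lerD// ler_pM ?hM// ltW//; apply: hd => //.
- by rewrite ler0_norm; lra.
- by rewrite ger0_norm; lra.
Qed.

(** The mean value theorem turns a small increment of [f] into [f' c * (t - s)], and uniform
    continuity of [f'] gives the criterion with [h = 1]. *)
Lemma ftc_AC a b f f' : {within `[a, b], continuous f} -> {within `[a, b], continuous f'} ->
  (forall x, a < x < b -> is_derive x 1 f (f' x)) -> ACI a b f f'.
Proof.
move=> cf cf' df.
apply: (@ACI_crit a b _ _ (fun=> 1)).
- exact: ccont_itg.
- exact: itg_cst.
- by [].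
move=> e e0; have [d d0 hd] := itv_ucont cf' e0.
exists d => // s t sa st tb tsd.
have sub : {subset `[s, t]%R <= `[a, b]%R} by apply: subset_itv; rewrite bnd_simp.
have cf1 : {within `[s, t], continuous f}.
  by apply: continuous_subspaceW cf; exact: sub.
have df1 x : x \in `]s, t[ -> is_derive x 1 f (f' x).
  rewrite in_itv/= => /andP[sx xt]; apply: df; apply/andP; split; lra.
have [c cst ->] := MVT_segment st df1 cf1.
move: cst; rewrite in_itv/= => /andP[sc ct].
rewrite -pint_cst// -pintB.
- apply: (le_trans (pint_norm _)).
    apply: itgB; first exact: itg_cst.
    by apply: ccont_itg; apply: continuous_subspaceW cf'; exact: sub.
  rewrite -pintZ; last exact: itg_cst.
  apply: le_pint.
  + apply: itg_abs; apply: itgB; first exact: itg_cst.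
    by apply: ccont_itg; apply: continuous_subspaceW cf'; exact: sub.
  + by apply: itgZ; exact: itg_cst.
  move=> x /andP[sx xt]; rewrite mulr1 ltW//; apply: hd; try (by apply/andP; split; lra).
  by rewrite ltr_norml; apply/andP; split; lra.
- exact: itg_cst.
- by apply: ccont_itg; apply: continuous_subspaceW cf'; exact: sub.
Qed.

(** At [n = 0] the truncated exponent [n.-1] is harmless, because its factor [n%:R] is zero. *)
Lemma ACI_exp a b f f' n : a < b -> ACI a b f f' ->
  ACI a b (fun x => f x ^+ n) (fun x => n%:R * (f' x * f x ^+ n.-1)).
Proof.
move=> ab Hf; elim: n => [|n IH].
  have -> : (fun x : R => 0%:R * (f' x * f x ^+ 0.-1)) = (fun=> 0).
    by apply/funext => x; rewrite mul0r.
  split; first exact: itg_cst.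
  by move=> t /andP[at_ _]; rewrite pint_cst// mul0r addr0 !expr0.
have [_ h] := ACI_mul ab Hf IH; have [h0 _] := ACI_mul ab Hf IH.
have E : (fun x => f' x * f x ^+ n + n%:R * (f' x * f x ^+ n.-1) * f x) =
  (fun x : R => n.+1%:R * (f' x * f x ^+ n.+1.-1)).
  apply/funext => x /=; case: n {IH h h0} => [|n]; first by rewrite mul0r mul0r addr0 mul1r.
  by rewrite /= -(natr1 n.+1) exprS; ring.
rewrite E in h0 h.
split => // t tab; rewrite exprS h//.
by rewrite exprS.
Qed.

End Int1.

(** * Integrals over the rectangle *)

Section Int2.
Context {R : realType}.
Notation leb := (@lebesgue_measure R).
Notation leb2 := ((leb \x leb)%E).
Notation mR2 := (measurableTypeR R * measurableTypeR R)%type.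
Implicit Types (T : R) (F : R * R -> R).

(** An almost everywhere sign kills the positive part, so that minus the integral of the negative
    part is all that remains. *)
Lemma ae_le0_integral d (X : measurableType d) (mu : {measure set X -> \bar R})
    (D : set X) (G : X -> \bar R) : measurable D -> measurable_fun D G ->
  {ae mu, forall x, D x -> (G x <= 0)%E} -> (\int[mu]_(x in D) G x <= 0)%E.
Proof.
move=> mD mG aeG; rewrite integralE.
have -> : (\int[mu]_(x in D) G^\+ x = 0)%E.
  rewrite -(integral0 mu D); apply: ae_eq_integral => //.
    exact: measurable_funepos.
  apply: filterS aeG => x h Dx /=; rewrite funeposE; apply/max_idPr; exact: h.
rewrite sub0e oppe_le0; apply: integral_ge0 => x _; exact: funeneg_ge0.
Qed.

Lemma itg_restr (a b : R) (f : R -> R) :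
  leb.-integrable setT ((EFin \o f) \_ [set` `[a, b]]) -> itg a b f.
Proof.
exact: (@integrable_mkcond _ (measurableTypeR R) R leb [set` `[a, b]] (EFin \o f) (measurable_itv _)).2.
Qed.

Lemma measurable_rect T : measurable (rect T : set mR2).
Proof. exact: measurableX. Qed.

Lemma rectE T x t : rect T (x, t) <-> (0 <= x <= 1) /\ (0 <= t <= T).
Proof. by rewrite /rect /setX /= !in_itv. Qed.

Definition J T F := \int[leb2]_(z in rect T) F z.
Definition itg2 T F := leb2.-integrable (rect T) (EFin \o F).

Lemma ae_le0_J T F : itg2 T F -> {ae leb2, forall z, rect T z -> F z <= 0} -> J T F <= 0.
Proof.
move=> Fi aeF; rewrite /J /Rintegral; apply: fine_le0.
apply: ae_le0_integral => //; first exact: measurable_rect.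
by case/integrableP : Fi.
Qed.

(** Carries a sign known on almost every line of constant [x] to the rectangle. Fubini is applied to
    the extension by zero to the plane, whose sections are restrictions to [[0, T]]. *)
Lemma fubini_le0x T F : itg2 T F ->
  {ae leb, forall x, x \in `[0, 1] -> pint (fun t => F (x, t)) 0 T <= 0} -> J T F <= 0.
Proof.
move=> Fi aeF; rewrite /J /Rintegral; apply: fine_le0.
rewrite integral_mkcond.
have Fi' := (@integrable_mkcond _ mR2 R leb2 (rect T) (EFin \o F) (measurable_rect T)).1 Fi.
rewrite -(integral12_prod_meas1 Fi').
apply: ae_le0_integral => //; first exact: (measurable_fubini_F Fi').
have aei := ae_integrable1 Fi'.
apply: filterS2 aei aeF => x xi xF _.
rewrite /fubini_F.
have [x01|x01] := boolP (x \in `[0, 1]%R); last first.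
  rewrite integral0_eq// => y _; rewrite patchE.
  by case: ifPn => //; rewrite inE => -[/=]; rewrite in_itv/= => h; move: x01; rewrite in_itv /= h.
have E : (fun y => ((EFin \o F) \_ (rect T)) (x, y)) = (EFin \o (fun t => F (x, t))) \_ `[0, T].
  apply/funext => y; rewrite !patchE.
  have -> // : ((x, y) \in rect T) = (y \in ([set` `[0, T]] : set R)).
  by apply/idP/idP; rewrite !inE; [move=> -[]|move=> h; split].
rewrite E -integral_mkcond.
rewrite E in xi; move/itg_restr : xi => xi.
have := xF x01; rewrite /pint /Rintegral.
by rewrite -lee_fin fineK//; exact: integrable_fin_num.
Qed.

Lemma fubini_le0t T F : itg2 T F ->
  {ae leb, forall t, t \in `[0, T] -> pint (fun x => F (x, t)) 0 1 <= 0} -> J T F <= 0.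
Proof.
move=> Fi aeF; rewrite /J /Rintegral; apply: fine_le0.
rewrite integral_mkcond.
have Fi' := (@integrable_mkcond _ mR2 R leb2 (rect T) (EFin \o F) (measurable_rect T)).1 Fi.
rewrite -(integral21_prod_meas1 Fi').
apply: ae_le0_integral => //; first exact: (measurable_fubini_G Fi').
have aei := ae_integrable2 Fi'.
apply: filterS2 aei aeF => t ti tF _.
rewrite /fubini_G.
have [t01|t01] := boolP (t \in `[0, T]%R); last first.
  rewrite integral0_eq// => y _; rewrite patchE.
  by case: ifPn => //; rewrite inE => -[_ /=]; rewrite in_itv/= => h; move: t01; rewrite in_itv /= h.
have E : (fun y => ((EFin \o F) \_ (rect T)) (y, t)) = (EFin \o (fun x => F (x, t))) \_ `[0, 1].
  apply/funext => y; rewrite !patchE.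
  have -> // : ((y, t) \in rect T) = (y \in ([set` `[0, 1]] : set R)).
  by apply/idP/idP; rewrite !inE; [move=> -[]|move=> h; split].
rewrite E -integral_mkcond.
rewrite E in ti; move/itg_restr : ti => ti.
have := tF t01; rewrite /pint /Rintegral.
by rewrite -lee_fin fineK//; exact: integrable_fin_num.
Qed.

Lemma ae_itgx T F : itg2 T F ->
  {ae leb, forall x, x \in `[0, 1] -> itg 0 T (fun t => F (x, t))}.
Proof.
move=> Fi.
have Fi' := (@integrable_mkcond _ mR2 R leb2 (rect T) (EFin \o F) (measurable_rect T)).1 Fi.
have aei := ae_integrable1 Fi'.
apply: filterS aei => x xi x01.
have E : (fun y => ((EFin \o F) \_ (rect T)) (x, y)) = (EFin \o (fun t => F (x, t))) \_ `[0, T].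
  apply/funext => y; rewrite !patchE.
  have -> // : ((x, y) \in rect T) = (y \in ([set` `[0, T]] : set R)).
  by apply/idP/idP; rewrite !inE; [move=> -[]|move=> h; split].
by rewrite E in xi; exact: itg_restr.
Qed.

Lemma ae_itgt T F : itg2 T F ->
  {ae leb, forall t, t \in `[0, T] -> itg 0 1 (fun x => F (x, t))}.
Proof.
move=> Fi.
have Fi' := (@integrable_mkcond _ mR2 R leb2 (rect T) (EFin \o F) (measurable_rect T)).1 Fi.
have aei := ae_integrable2 Fi'.
apply: filterS aei => t ti t01.
have E : (fun y => ((EFin \o F) \_ (rect T)) (y, t)) = (EFin \o (fun x => F (x, t))) \_ `[0, 1].
  apply/funext => y; rewrite !patchE.
  have -> // : ((y, t) \in rect T) = (y \in ([set` `[0, 1]] : set R)).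
  by apply/idP/idP; rewrite !inE; [move=> -[]|move=> h; split].
by rewrite E in ti; exact: itg_restr.
Qed.

Lemma rect_compact T : compact (rect T : set (R * R)).
Proof. by apply: compact_setX; exact: segment_compact. Qed.

Lemma rect_ucont T (f : R -> R -> R) : continuous_rect T f ->
  forall e : R, 0 < e -> exists2 d : R, 0 < d & forall x y s t, 0 <= x <= 1 -> 0 <= y <= 1 ->
    0 <= s <= T -> 0 <= t <= T -> `|x - y| < d -> `|s - t| < d -> `|f x s - f y t| < e.
Proof.
move=> cf e e0; have [d d0 hd] := compact_ucont (@rect_compact T) cf e0.
exists d => // x y s t hx hy hs ht xy st.
by apply: (hd (x, s) (y, t)); rewrite ?rectE//; split.
Qed.

Lemma rect_bounded T (f : R -> R -> R) : continuous_rect T f ->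
  exists2 M : R, 0 < M & forall x t, rect T (x, t) -> `|f x t| <= M.
Proof.
move=> cf.
have : compact ((fun z => f z.1 z.2) @` rect T).
  by apply: continuous_compact => //; exact: rect_compact.
move/compact_bounded => [M [_ hM]].
exists (Num.max M 0 + 1); first by rewrite ltr_wpDl// le_max lexx orbT.
move=> x t xt; apply: (hM (Num.max M 0 + 1)).
  by rewrite (@le_lt_trans _ _ (Num.max M 0))// ?le_max ?lexx// ltrDl.
by exists (x, t).
Qed.

Lemma within_itv_cont (a b : R) (f : R -> R) :
  (forall x, a <= x <= b -> forall e : R, 0 < e -> exists2 d : R, 0 < d &
     forall y, a <= y <= b -> `|x - y| < d -> `|f x - f y| < e) ->
  {within `[a, b], continuous f}.
Proof.
move=> H; apply/subspace_continuousP => x xab.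
apply/cvgrPdist_lt => e e0.
have xab' : a <= x <= b by move: xab; rewrite /= in_itv.
have [d d0 hd] := H x xab' e e0.
apply/nbhs_ballP; exists d => //= y xy yab; apply: hd => //; by move: yab; rewrite /= in_itv.
Qed.

Lemma rect_cont_x T f t : 0 <= t <= T -> continuous_rect T f -> {within `[0, 1], continuous (f^~ t)}.
Proof.
move=> tT cf; apply: within_itv_cont => x x01 e e0.
have [d d0 hd] := rect_ucont cf e0.
by exists d => // y y01 xy; apply: hd => //; rewrite subrr normr0.
Qed.

Lemma rect_cont_t T f x : 0 <= x <= 1 -> continuous_rect T f -> {within `[0, T], continuous (f x)}.
Proof.
move=> x01 cf; apply: within_itv_cont => t tT e e0.
have [d d0 hd] := rect_ucont cf e0.
by exists d => // y y01 xy; apply: hd => //; rewrite subrr normr0.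
Qed.

(** The sides of the rectangle lie on four null lines, so an equation known in the open rectangle
    can be integrated over the closed one. *)
Lemma rect_ae T (P : R * R -> Prop) :
  {ae leb2, forall z : R * R, z.1 \in `]0, 1[ -> z.2 \in `]0, T[ -> P z} ->
  {ae leb2, forall z : R * R, rect T z -> P z}.
Proof.
move=> aeP.
have nul (c : R) : leb2.-negligible (([set c] : set (measurableTypeR R)) `*` setT).
  exists ([set c] `*` setT); split => //; first exact: measurableX.
  by rewrite product_measure1E//; rewrite [X in (X * _)%E](_ : _ = 0%E) ?mul0e//; exact: lebesgue_measure_set1.
have nul' (c : R) : leb2.-negligible (setT `*` ([set c] : set (measurableTypeR R))).
  exists (setT `*` [set c]); split => //; first exact: measurableX.
  by rewrite product_measure1E//; rewrite [X in (_ * X)%E](_ : _ = 0%E) ?mule0//; exact: lebesgue_measure_set1.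
apply: negligibleS (negligibleU aeP (negligibleU (negligibleU (nul 0) (nul 1))
  (negligibleU (nul' 0) (nul' T)))).
move=> [x t] /= nP; apply: contrapT => /not_orP[] /= h /not_orP[]
  /not_orP[/= h1 h2] /not_orP[/= h3 h4].
apply: nP => -[]; rewrite /= !in_itv/= => /andP[a1 a2] /andP[a3 a4].
apply: contrapT => nP; apply: h => h; apply: nP; apply: h; rewrite in_itv/= !lt_neqAle.
  rewrite a1 a2 !andbT; apply/andP; split; apply/eqP => e.
    by apply: h1; split.
  by apply: h2; split.
rewrite a3 a4 !andbT; apply/andP; split; apply/eqP => e.
  by apply: h3; split.
by apply: h4; split.
Qed.

(** Continuity is relative to the rectangle, measurability is for the product structure. Freezing
    [x] at the left end of each strip of width [1 / n.+1] gives sums of products of one-variable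
    measurable functions, which converge pointwise by uniform continuity. *)
Lemma rect_measurable T f : continuous_rect T f -> measurable_fun (rect T : set mR2) (fun z : R * R => f z.1 z.2).
Proof.
move=> cf.
pose I (n k : nat) : set R := [set` `[k%:R / n.+1%:R, k.+1%:R / n.+1%:R[].
(* There are [n.+2] strips because [x = 1] lies in the strip of index [n.+1]; the minimum with 1
   keeps every frozen abscissa in [[0, 1]], whatever [k]. *)
pose g n (z : R * R) : R := \sum_(k <- iota 0 n.+2)
  \1_(I n k) z.1 * ((f (Num.min 1 (k%:R / n.+1%:R))) \_ `[0, T]) z.2.
have mg n : measurable_fun (rect T : set mR2) (g n).
  apply: measurable_sum => k; apply: measurable_funM.
    apply: measurable_funTS; apply: measurableT_comp measurable_fst.
    by apply: measurable_indic; exact: measurable_itv.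
  apply: measurable_funTS; apply: measurableT_comp measurable_snd.
  apply: (measurable_restrictT _ (measurable_itv _)).1.
  apply: subspace_continuous_measurable_fun => //.
  apply: rect_cont_t => //.
  by rewrite le_min ler01 divr_ge0//= ge_min lexx.
apply: (measurable_fun_cvg mg) => -[x t] /rectE[x01 tT] /=.
apply/cvgrPdist_lt => e e0.
have [d d0 hd] := rect_ucont cf e0.
near=> n.
have n0 : (0:R) < n.+1%:R by [].
pose k := Num.truncn (x * n.+1%:R).
have x0 : 0 <= x by case/andP: x01.
have x1 : x <= 1 by case/andP: x01.
have xn0 : 0 <= x * n.+1%:R by rewrite mulr_ge0.
have /andP[k1 k2] := truncn_itv xn0.
have kn : (k < n.+2)%N.
  by rewrite ltnS -(ler_nat R) (le_trans k1)// ler_piMl.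
have xI : x \in I n k.
  by rewrite inE /I /= in_itv/= ler_pdivrMr// k1 ltr_pdivlMr.
have xI' j : j != k -> x \notin I n j.
  apply: contraNN; rewrite inE /I /= in_itv/= ler_pdivrMr// ltr_pdivlMr// => /andP[j1 j2].
  rewrite eqn_leq; apply/andP; split; rewrite -ltnS -(ltr_nat R); first exact: le_lt_trans k2.
  exact: le_lt_trans j2.
have -> : g n (x, t) = f (k%:R / n.+1%:R) t.
  rewrite /g (bigD1_seq k) ?iota_uniq ?mem_iota//= big1 ?addr0//.
  - rewrite indicE xI mul1r patchE mem_set ?in_itv//=.
    congr (f _ t); apply/min_idPr; rewrite (le_trans _ x1)//.
    by rewrite ler_pdivrMr.
  - by move=> j /xI' h; rewrite indicE (negbTE h) mul0r.
apply: hd => //; last by rewrite subrr normr0.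
  by rewrite divr_ge0//= (le_trans _ x1)// ler_pdivrMr.
rewrite ger0_norm ?subr_ge0 ?ler_pdivrMr//.
rewrite ltrBlDr (@lt_le_trans _ _ (k.+1%:R / n.+1%:R))// ?ltr_pdivlMr//.
rewrite -natr1 mulrDl mul1r addrC lerD2r ltW//.
near: n; exact: near_infty_natSinv_lt (PosNum d0).
Unshelve. all: by end_near. Qed.

Lemma rect_bounded_set T f : continuous_rect T f -> [bounded f z.1 z.2 | z in rect T].
Proof.
move=> /rect_bounded[M M0 hM]; exists M; split; first by rewrite num_real.
by move=> y My [x t] /hM /le_trans; apply; exact: ltW.
Qed.

Lemma leb2_rect_fin T : (leb2 (rect T) < +oo)%E.
Proof.
rewrite /rect product_measure1E//= !lebesgue_measure_itv/= !lte_fin ltr01.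
by case: ifP => _; rewrite ?mule0// -EFinD/= oppr0 addr0 mul1e ltry.
Qed.

Lemma rect_itg T f : continuous_rect T f -> itg2 T (fun z => f z.1 z.2).
Proof.
move=> cf; apply: measurable_bounded_integrable.
- exact: measurable_rect.
- exact: leb2_rect_fin.
- exact: rect_measurable.
- exact: rect_bounded_set.
Qed.

Lemma itg2M T F f : continuous_rect T f -> itg2 T F -> itg2 T (fun z => F z * f z.1 z.2).
Proof.
move=> cf Fi.
have -> : itg2 T (fun z => F z * f z.1 z.2) =
  leb2.-integrable (rect T) ((EFin \o F) \* (EFin \o (fun z => f z.1 z.2)))%E by [].
apply: integrableMl => //; first exact: measurable_rect.
  exact: rect_measurable.
exact: rect_bounded_set.
Qed.

Lemma itg2D T F G : itg2 T F -> itg2 T G -> itg2 T (fun z => F z + G z).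
Proof. by move=> fi gi; exact: (integrableD (measurable_rect T) fi gi). Qed.

Lemma itg2B T F G : itg2 T F -> itg2 T G -> itg2 T (fun z => F z - G z).
Proof. by move=> fi gi; exact: (integrableB (measurable_rect T) fi gi). Qed.

Lemma itg2Z T k F : itg2 T F -> itg2 T (fun z => k * F z).
Proof. by move=> fi; exact: (integrableZl (measurable_rect T) _ fi). Qed.

Lemma JD T F G : itg2 T F -> itg2 T G -> J T (fun z => F z + G z) = J T F + J T G.
Proof. by move=> fi gi; apply: RintegralD => //; exact: measurable_rect. Qed.

Lemma JB T F G : itg2 T F -> itg2 T G -> J T (fun z => F z - G z) = J T F - J T G.
Proof. by move=> fi gi; apply: RintegralB => //; exact: measurable_rect. Qed.

Lemma JZ T k F : itg2 T F -> J T (fun z => k * F z) = k * J T F.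
Proof. by move=> fi; apply: RintegralZl => //; exact: measurable_rect. Qed.

Lemma le_J T F G : itg2 T F -> itg2 T G -> (forall z, rect T z -> F z <= G z) -> J T F <= J T G.
Proof. by move=> fi gi; exact: (@le_Rintegral _ mR2 R leb2 (rect T) F G (measurable_rect T) fi gi). Qed.

(** By uniform continuity [f] stays above half its value at [(x0, t0)] on a small rectangle clipped
    to [rect T], which has positive measure. *)
Lemma J_gt0 T f x0 t0 : 0 < T -> continuous_rect T f -> (forall z, rect T z -> 0 <= f z.1 z.2) ->
  rect T (x0, t0) -> 0 < f x0 t0 -> 0 < J T (fun z => f z.1 z.2).
Proof.
move=> T0 cf f0 /rectE[x01 t0T] fx.
have e0 : 0 < f x0 t0 / 2 by rewrite divr_gt0.
have [d d0 hd] := rect_ucont cf e0.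
pose x1 := Num.max 0 (x0 - d / 2); pose x2 := Num.min 1 (x0 + d / 2).
pose t1 := Num.max 0 (t0 - d / 2); pose t2 := Num.min T (t0 + d / 2).
have x12 : x1 < x2 by rewrite /x1 /x2 gt_max !lt_min; apply/andP; split; apply/andP; split; lra.
have t12 : t1 < t2 by rewrite /t1 /t2 gt_max !lt_min; apply/andP; split; apply/andP; split; lra.
pose K : set (R * R) := `[x1, x2] `*` `[t1, t2].
have KR : K `<=` rect T.
  move=> [x t] [] /=; rewrite !in_itv/= /x1 /x2 /t1 /t2 !ge_max !le_min.
  by move=> /andP[/andP[? _] /andP[? _]] /andP[/andP[? _] /andP[? _]]; apply/rectE; split; apply/andP; split.
have mK : measurable (K : set mR2) by exact: measurableX.
have fi := rect_itg cf.
have : ((f x0 t0 / 2)%:E * leb2 K <= \int[leb2]_(z in rect T) (f z.1 z.2)%:E)%E.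
  rewrite -integral_cst//.
  apply: (@le_trans _ _ (\int[leb2]_(z in K) (f z.1 z.2)%:E)%E).
    apply: ge0_le_integral => //.
    - by move=> z _; rewrite lee_fin ltW.
    - by apply: measurable_funS (measurable_rect T) KR (measurable_int leb2 fi).
    move=> [x t] [] /=; rewrite !in_itv/= /x1 /x2 /t1 /t2 !ge_max !le_min.
    move=> /andP[/andP[? ?] /andP[? ?]] /andP[/andP[? ?] /andP[? ?]]; rewrite lee_fin.
    have : `|f x0 t0 - f x t| < f x0 t0 / 2.
      apply: hd => //; try (by apply/andP; split).
      - by rewrite ltr_norml; apply/andP; split; lra.
      - by rewrite ltr_norml; apply/andP; split; lra.
    rewrite ltr_norml => /andP[]; lra.
  apply: ge0_subset_integral => //; first exact: measurable_rect.
    by case/integrableP : fi.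
rewrite /K product_measure1E//= !lebesgue_measure_itv/= !lte_fin x12 t12 -!EFinD -!EFinM.
rewrite /J /Rintegral => h; apply: (@lt_le_trans _ _ (f x0 t0 / 2 * ((x2 - x1) * (t2 - t1)))).
  by rewrite !mulr_gt0// subr_gt0.
rewrite -lee_fin fineK//; apply: integrable_fin_num fi; exact: measurable_rect.
Qed.
Lemma within_for_cont (a b : R) (f : R -> R) t : {within `[a, b], continuous f} -> a < t < b ->
  {for t, continuous f}.
Proof.
move=> cf /andP[at_ tb]; have ab := lt_trans at_ tb.
have /continuous_within_itvP := cf; move=> /(_ ab)[h _ _]; apply: h.
by rewrite in_itv/= at_ tb.
Qed.

Lemma pint_is_derive T (g : R -> R) t : {within `[0, T], continuous g} -> 0 < t < T ->
  is_derive t 1 (pint g 0) (g t).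
Proof.
move=> cg tT; have /andP[t0 tT'] := tT.
have [d1 d2] := @continuous_FTC1_closed _ g 0 t T tT' (ccont_itg cg) t0 (within_for_cont cg tT).
split; [exact: d1|rewrite -derive1E; exact: d2].
Qed.

Lemma pint_cont T (g : R -> R) : 0 < T -> {within `[0, T], continuous g} ->
  {within `[0, T], continuous (pint g 0)}.
Proof. by move=> T0 cg; exact: parameterized_integral_continuous (ltW T0) (ccont_itg cg). Qed.

Lemma hatE T (p : R -> R -> R) x : hat T p x = T^-1 * pint (p x) 0 T.
Proof. by []. Qed.

End Int2.
#[global] Opaque pint.

(** * Rules for derivatives in one variable *)

Section DerivRules.
Context {R : realType}.
Implicit Types (f g : R -> R) (x : R).

Lemma der_eq f x df df' : is_derive x 1 f df -> df = df' -> is_derive x 1 f df'.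
Proof. by move=> h <-. Qed.

Lemma der_cst x (c : R) : is_derive x 1 (fun=> c) 0.
Proof. exact: is_derive_cst. Qed.

Lemma der_id x : is_derive x 1 (fun y : R => y) 1.
Proof. exact: is_derive_id. Qed.

Lemma derD f g x df dg : is_derive x 1 f df -> is_derive x 1 g dg ->
  is_derive x 1 (fun y => f y + g y) (df + dg).
Proof. by move=> hf hg; exact: is_deriveD. Qed.

Lemma derN f x df : is_derive x 1 f df -> is_derive x 1 (fun y => - f y) (- df).
Proof. by move=> hf; exact: is_deriveN. Qed.

Lemma derB f g x df dg : is_derive x 1 f df -> is_derive x 1 g dg ->
  is_derive x 1 (fun y => f y - g y) (df - dg).
Proof. by move=> hf hg; exact: is_deriveB. Qed.

Lemma derM f g x df dg : is_derive x 1 f df -> is_derive x 1 g dg ->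
  is_derive x 1 (fun y => f y * g y) (df * g x + f x * dg).
Proof.
move=> hf hg; apply: der_eq (is_deriveM hf hg) _.
by rewrite /GRing.scale /= addrC mulrC.
Qed.

Lemma derZ k f x df : is_derive x 1 f df -> is_derive x 1 (fun y => k * f y) (k * df).
Proof.
move=> hf; apply: der_eq (derM (der_cst x k) hf) _.
by rewrite mul0r add0r.
Qed.

Lemma der_comp g f x dg df : is_derive (f x) 1 g dg -> is_derive x 1 f df ->
  is_derive x 1 (fun y => g (f y)) (dg * df).
Proof. by move=> hg hf; exact: (is_derive1_comp hg hf). Qed.

Lemma der_sum (I : Type) (r : seq I) (f df : I -> R -> R) x :
  (forall i, is_derive x 1 (f i) (df i x)) ->
  is_derive x 1 (fun y => \sum_(i <- r) f i y) (\sum_(i <- r) df i x).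
Proof.
move=> h; elim: r => [|i r IH].
  by rewrite big_nil; under eq_fun do rewrite big_nil; exact: der_cst.
by rewrite big_cons; under eq_fun do rewrite big_cons; exact: derD.
Qed.

Lemma der_cont f x df : is_derive x 1 f df -> {for x, continuous f}.
Proof. by move=> h; apply/differentiable_continuous/derivable1_diffP; case: h. Qed.

Lemma derV f x df : f x != 0 -> is_derive x 1 f df ->
  is_derive x 1 (fun y => (f y)^-1) (- df / (f x) ^+ 2).
Proof.
move=> fx hf; have hd : derivable f x 1 by case: hf.
have := derivableV fx hd => h; apply: DeriveDef => //.
rewrite deriveV// derive_val /GRing.scale/=; ring.
Qed.

End DerivRules.

(** * Weak maximum principle *)

Section Weak.
Context {R : realType}.
Notation leb := (@lebesgue_measure R).
Notation leb2 := ((leb \x leb)%E).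
Implicit Types (T D : R) (f g w : R -> R -> R).

Lemma ae_imp (P S : R -> Prop) : {ae leb, forall x, P x} ->
  (forall x, P x -> S x) -> {ae leb, forall x, S x}.
Proof.
by move=> aP h; apply: negligibleS aP => x /= nS Px; apply: nS; exact: h.
Qed.

Lemma ae_imp2 (P Q S : R -> Prop) : {ae leb, forall x, P x} -> {ae leb, forall x, Q x} ->
  (forall x, P x -> Q x -> S x) -> {ae leb, forall x, S x}.
Proof.
move=> aP aQ h; apply: negligibleS (negligibleU aP aQ) => x /= nS.
by apply: contrapT => /not_orP[/contrapT Px /contrapT Qx]; apply: nS; exact: h.
Qed.

Lemma crect_cst T (c : R) : continuous_rect T (fun _ _ => c).
Proof. by move=> z; exact: cvg_cst. Qed.

Lemma crectM T f g : continuous_rect T f -> continuous_rect T g ->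
  continuous_rect T (fun x t => f x t * g x t).
Proof. by move=> cf cg z; apply: cvgM; [exact: cf|exact: cg]. Qed.

Lemma crectD T f g : continuous_rect T f -> continuous_rect T g ->
  continuous_rect T (fun x t => f x t + g x t).
Proof. by move=> cf cg z; apply: cvgD; [exact: cf|exact: cg]. Qed.

Lemma crectN T f : continuous_rect T f -> continuous_rect T (fun x t => - f x t).
Proof. by move=> cf z; apply: cvgN; exact: cf. Qed.

Lemma crectB T f g : continuous_rect T f -> continuous_rect T g ->
  continuous_rect T (fun x t => f x t - g x t).
Proof. by move=> cf cg; apply: crectD => //; exact: crectN. Qed.

Lemma crect_norm T f : continuous_rect T f -> continuous_rect T (fun x t => `|f x t|).
Proof. by move=> cf z; apply: cvg_norm; exact: cf. Qed.

Lemma crect_comp T (g : R -> R) f : continuous g -> continuous_rect T f ->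
  continuous_rect T (fun x t => g (f x t)).
Proof. by move=> cg cf z; apply: (cvg_comp _ g (cf z)); exact: cg. Qed.

Lemma crectX T f n : continuous_rect T f -> continuous_rect T (fun x t => f x t ^+ n).
Proof.
move=> cf; elim: n => [|n IH]; first exact: crect_cst.
have -> : (fun x t => f x t ^+ n.+1) = (fun x t => f x t * f x t ^+ n).
  by apply/funext => x; apply/funext => t; rewrite exprS.
exact: crectM.
Qed.

Lemma continuous_rectP T f :
  (forall x t, rect T (x, t) -> forall e : R, 0 < e -> exists2 d : R, 0 < d &
    forall y s, rect T (y, s) -> `|x - y| < d -> `|t - s| < d -> `|f x t - f y s| < e) ->
  continuous_rect T f.
Proof.
move=> H; apply/subspace_continuousP => -[x t] xt.
apply/cvgrPdist_lt => e e0.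
have [d d0 hd] := H x t xt e e0.
apply/nbhs_ballP; exists d => //= -[y s] [/= xy ts] ys.
exact: hd.
Qed.

Lemma crectV T f : continuous_rect T f -> (forall x t, rect T (x, t) -> 0 < f x t) ->
  continuous_rect T (fun x t => (f x t)^-1).
Proof.
move=> cf f0; apply/subspace_continuousP => -[x t] xt.
apply: cvgV; first by rewrite gt_eqF// f0.
by move/subspace_continuousP : cf => /(_ _ xt).
Qed.

(** Common class of eigenfunctions and test functions, closed under products and under reciprocals
    of positive functions. [wt] and [wxx] are only integrable and act on almost every line; [wx] is
    continuous, so [w] is its primitive on every line. *)
Record weak T w wt wx wxx : Prop := Weak {
  weak_c : continuous_rect T w;
  weak_cx : continuous_rect T wx;
  weak_it : itg2 T (fun z => wt z.1 z.2);
  weak_ixx : itg2 T (fun z => wxx z.1 z.2);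
  weak_x : forall t, 0 <= t <= T -> ACI 0 1 (w^~ t) (wx^~ t);
  weak_t : {ae leb, forall x, x \in `[0, 1] -> ACI 0 T (w x) (wt x)};
  weak_xx : {ae leb, forall t, t \in `[0, T] -> ACI 0 1 (wx^~ t) (wxx^~ t)} }.

(* Testing the inequality with w^(n+1) gives, by AM-GM on M |w_x| w^(n+1),
   th \int w^(n+2) <= M^2 / (4 D (n+1)) \int w^(n+2), and n is large. *)
Lemma weak_max_principle T D M th w wt wx wxx : 0 < T -> 0 < D -> 0 < th ->
  weak T w wt wx wxx ->
  (forall x t, rect T (x, t) -> 0 <= w x t) ->
  (forall x, x \in `]0, 1[ -> w x 0 = w x T) ->
  (forall t, 0 <= t <= T -> 0 <= wx 0 t /\ wx 1 t <= 0) ->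
  {ae leb2, forall z : R * R, z.1 \in `]0, 1[ -> z.2 \in `]0, T[ ->
     wt z.1 z.2 - D * wxx z.1 z.2 <= M * `|wx z.1 z.2| - th * w z.1 z.2} ->
  forall x t, rect T (x, t) -> w x t = 0.
Proof.
move=> T0 D0 th0 W w0 wper wbd aew x t xt.
have [cw cwx iwt iwxx wX wT wXX] := W.
have [n hn] : exists n : nat, M ^+ 2 / (4 * D * th) < n.+1%:R.
  have /archi_boundP : 0 <= M ^+ 2 / (4 * D * th).
    by rewrite divr_ge0 ?sqr_ge0// !mulr_ge0// ltW.
  set m := Num.bound _ => hm; exists m; apply: (lt_trans hm); by rewrite ltr_nat.
have n0 : (0 : R) < n.+1%:R by [].
pose c := th - M ^+ 2 / (4 * D * n.+1%:R).
have c0 : 0 < c.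
  rewrite subr_gt0 ltr_pdivrMr ?mulr_gt0//.
  by move: hn; rewrite ltr_pdivrMr ?mulr_gt0//; lra.
(* After multiplication by [w ^+ n.+1] the inequality reads [F1 - D * F2 + F3 <= 0]: [F1] is a time
   derivative up to a factor, [F2] a space derivative, and [F3] collects what integration by parts
   leaves. *)
pose F1 (z : R * R) := wt z.1 z.2 * w z.1 z.2 ^+ n.+1.
pose F2 (z : R * R) := wxx z.1 z.2 * w z.1 z.2 ^+ n.+1 + n.+1%:R * (wx z.1 z.2 ^+ 2 * w z.1 z.2 ^+ n).
pose F3 (z : R * R) := D * n.+1%:R * (wx z.1 z.2 ^+ 2 * w z.1 z.2 ^+ n)
  + (th * w z.1 z.2 ^+ n.+2 - M * (`|wx z.1 z.2| * w z.1 z.2 ^+ n.+1)).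
have i1 : itg2 T F1.
  exact: (itg2M (crectX (n:=n.+1) cw) iwt).
have i2 : itg2 T F2.
  apply: itg2D; first exact: (itg2M (crectX (n:=n.+1) cw) iwxx).
  by apply: itg2Z; apply: (rect_itg (crectM (crectX (n:=2) cwx) (crectX (n:=n) cw))).
have i3 : itg2 T F3.
  apply: itg2D.
    by apply: itg2Z; apply: (rect_itg (crectM (crectX (n:=2) cwx) (crectX (n:=n) cw))).
  apply: itg2B.
    by apply: itg2Z; apply: (rect_itg (crectX (n:=n.+2) cw)).
  by apply: itg2Z; apply: (rect_itg (crectM (crect_norm cwx) (crectX (n:=n.+1) cw))).
have iw : itg2 T (fun z => w z.1 z.2 ^+ n.+2) by exact: (rect_itg (crectX (n:=n.+2) cw)).
(* Periodicity in time is known for interior [x] only. *)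
have ne01 : {ae leb, forall y, y != 0 /\ y != 1}.
  have nul (a : R) : leb.-negligible [set a].
    by exists [set a]; split => //; exact: lebesgue_measure_set1.
  apply: negligibleS (negligibleU (nul 0) (nul 1)) => y /= /not_andP[] /negP.
    by rewrite negbK => /eqP; left.
  by rewrite negbK => /eqP; right.
(* On a line, [n.+2] times the integral of [F1] is the increment of [w ^+ n.+2] over one period,
   hence zero. *)
have J1 : J T (fun z => (-1) * F1 z) <= 0.
  apply: fubini_le0x; first exact: itg2Z.
  apply: ae_imp2 (ae_imp2 wT (ae_itgx i1) (fun _ a b => conj a b)) ne01 _ => y [AT ii] [y0 y1] y01.
  rewrite pintZ; last by apply: ii.
  have y01' : y \in `]0, 1[.
    by move: y01; rewrite !in_itv/= => /andP[a1 a2]; rewrite !lt_neqAle a1 a2 eq_sym y0 y1.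
  have := ACI_sub (ACI_exp n.+2 T0 (AT y01)) (lexx _) (ltW T0) (lexx _).
  rewrite wper// subrr /= pintZ; last exact: ii.
  by rewrite /F1 /= => /esym/eqP; rewrite mulf_eq0 pnatr_eq0/= => /eqP ->; rewrite mulr0.
(* [F2] is the density of [wx * w ^+ n.+1], whose increment from 0 to 1 is nonpositive by the
   boundary signs of [wx]. *)
have J2 : J T F2 <= 0.
  apply: fubini_le0t => //.
  apply: ae_imp wXX _ => s AX s0T.
  have s0T' : 0 <= s <= T by move: s0T; rewrite in_itv.
  have := ACI_mul ltr01 (AX s0T) (ACI_exp n.+1 ltr01 (wX s s0T')).
  move=> /ACI_sub/(_ (lexx _) ler01 (lexx _)) h.
  apply: (@le_trans _ _ (wx 1 s * w 1 s ^+ n.+1 - wx 0 s * w 0 s ^+ n.+1)).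
    rewrite h le_eqVlt; apply/orP; left; apply/eqP; apply: eq_pint => y _ /=.
    by rewrite /F2 /=; ring.
  have [b0 b1] := wbd s s0T'.
  have p1 : 0 <= w 1 s ^+ n.+1 by rewrite exprn_ge0// w0//; apply/rectE; rewrite lexx ler01.
  have p0 : 0 <= w 0 s ^+ n.+1 by rewrite exprn_ge0// w0//; apply/rectE; rewrite lexx ler01.
  rewrite subr_le0 (@le_trans _ _ 0)//; first exact: mulr_le0_ge0.
  exact: mulr_ge0.
have JZ' : J T (fun z => F1 z - D * F2 z + F3 z) <= 0.
  apply: ae_le0_J.
    by apply: itg2D => //; apply: itg2B => //; exact: itg2Z.
  move/rect_ae : aew; apply: negligibleS => -[y s] /= h h'; apply: h => yz; move: h' => /(_ yz) h'.
  have wn : 0 <= w y s ^+ n.+1 by rewrite exprn_ge0// w0.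
  rewrite /F1 /F2 /F3 /=.
  have -> : wt y s * w y s ^+ n.+1 - D * (wxx y s * w y s ^+ n.+1 + n.+1%:R * (wx y s ^+ 2 * w y s ^+ n)) +
    (D * n.+1%:R * (wx y s ^+ 2 * w y s ^+ n) + (th * w y s ^+ n.+2 - M * (`|wx y s| * w y s ^+ n.+1)))
    = (wt y s - D * wxx y s - (M * `|wx y s| - th * w y s)) * w y s ^+ n.+1.
    by rewrite (exprS _ n.+1); ring.
  by apply: mulr_le0_ge0 => //; rewrite subr_le0.
have J3 : J T F3 <= 0.
  have i12 : itg2 T (fun z => F1 z - D * F2 z) by apply: itg2B => //; exact: itg2Z.
  move: JZ'; rewrite JD// JB//; last exact: itg2Z.
  rewrite JZ//; move: J1; rewrite JZ//; move: J2; nra.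
have J4 : c * J T (fun z => w z.1 z.2 ^+ n.+2) <= 0.
  rewrite -JZ//; apply: le_trans J3; apply: le_J => //; first exact: itg2Z.
  move=> [y s] ys /=; rewrite /F3 /=.
  have wn : 0 <= w y s ^+ n by rewrite exprn_ge0// w0.
  have -> : D * n.+1%:R * (wx y s ^+ 2 * w y s ^+ n) + (th * w y s ^+ n.+2 - M * (`|wx y s| * w y s ^+ n.+1))
   = (D * n.+1%:R * `|wx y s| ^+ 2 + th * w y s ^+ 2 - M * `|wx y s| * w y s) * w y s ^+ n.
    rewrite (exprS _ n.+1) (exprS _ n) -(real_normK (num_real (wx y s))); ring.
  have -> : c * w y s ^+ n.+2 = c * w y s ^+ 2 * w y s ^+ n by rewrite (exprS _ n.+1) (exprS _ n); ring.
  apply: ler_wpM2r => //; rewrite /c.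
  rewrite -subr_ge0.
  have -> : D * n.+1%:R * `|wx y s| ^+ 2 + th * w y s ^+ 2 - M * `|wx y s| * w y s
     - (th - M ^+ 2 / (4 * D * n.+1%:R)) * w y s ^+ 2
     = (2 * D * n.+1%:R * `|wx y s| - M * w y s) ^+ 2 / (4 * D * n.+1%:R).
    by field; rewrite !gt_eqF.
  by rewrite divr_ge0 ?sqr_ge0// !mulr_ge0// ltW.
apply/eqP; rewrite eq_le (w0 _ _ xt) andbT leNgt; apply/negP => wpos.
have := J_gt0 T0 (crectX (n:=n.+2) cw) _ xt (exprn_gt0 _ wpos).
rewrite /= => /(_ _)/= h.
have : 0 < J T (fun z => w z.1 z.2 ^+ n.+2).
  by apply: h => -[y s] ys; rewrite /= exprn_ge0// w0.
by move=> h'; move: J4; rewrite leNgt mulr_gt0.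
Qed.

Lemma ACI_add a b (f g f' g' : R -> R) : ACI a b f f' -> ACI a b g g' ->
  ACI a b (fun x => f x + g x) (fun x => f' x + g' x).
Proof.
move=> [fi hf] [gi hg]; split => [|t tab]; first exact: itgD.
move: (tab) => /andP[? ?]; rewrite pintD ?(itgS fi)// ?(itgS gi)// hf// hg//. lra.
Qed.

Lemma ACI_opp a b (f f' : R -> R) : ACI a b f f' -> ACI a b (fun x => - f x) (fun x => - f' x).
Proof.
have E : (fun x => - f' x) = (fun x => -1 * f' x) by apply/funext => x; rewrite mulN1r.
move=> [fi hf]; rewrite E; split => [|t tab]; first exact: itgZ.
move: (tab) => /andP[? ?]; rewrite pintZ ?(itgS fi)// hf//. lra.
Qed.

Lemma weak_mul T f ft fx fxx g gt gx gxx : 0 < T ->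
  weak T f ft fx fxx -> weak T g gt gx gxx ->
  weak T (fun x t => f x t * g x t) (fun x t => ft x t * g x t + gt x t * f x t)
    (fun x t => fx x t * g x t + gx x t * f x t)
    (fun x t => (fxx x t * g x t + gx x t * fx x t) + (gxx x t * f x t + fx x t * gx x t)).
Proof.
move=> T0 F G; split.
- exact: crectM (weak_c F) (weak_c G).
- exact: crectD (crectM (weak_cx F) (weak_c G)) (crectM (weak_cx G) (weak_c F)).
- exact: itg2D (itg2M (weak_c G) (weak_it F)) (itg2M (weak_c F) (weak_it G)).
- apply: itg2D (itg2D (itg2M (weak_c G) (weak_ixx F)) _) (itg2D (itg2M (weak_c F) (weak_ixx G)) _).
    exact: (rect_itg (crectM (weak_cx G) (weak_cx F))).
  exact: (rect_itg (crectM (weak_cx F) (weak_cx G))).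
- by move=> t tT; exact: ACI_mul ltr01 (weak_x F tT) (weak_x G tT).
- apply: ae_imp2 (weak_t F) (weak_t G) _ => x hf hg x01.
  exact: ACI_mul T0 (hf x01) (hg x01).
- apply: ae_imp2 (weak_xx F) (weak_xx G) _ => t hf hg tT.
  have tT' : 0 <= t <= T by move: tT; rewrite in_itv.
  apply: ACI_add.
    exact: ACI_mul ltr01 (hf tT) (weak_x G tT').
  exact: ACI_mul ltr01 (hg tT) (weak_x F tT').
Qed.

(** The second derivative arises from reading [fx * - f^-2] as a product and [f^-2] as the square of
    [1 / f], whence the doubled summand. *)
Lemma weak_inv T f ft fx fxx : 0 < T -> weak T f ft fx fxx ->
  (forall x t, rect T (x, t) -> 0 < f x t) ->
  weak T (fun x t => (f x t)^-1) (fun x t => ft x t * - (f x t)^-2)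
    (fun x t => fx x t * - (f x t)^-2)
    (fun x t => fxx x t * - (f x t)^-2
       + - (fx x t * - (f x t)^-2 * (f x t)^-1 + fx x t * - (f x t)^-2 * (f x t)^-1) * fx x t).
Proof.
move=> T0 F f0.
have ck : continuous_rect T (fun x t => (f x t)^-1) by exact: crectV (weak_c F) f0.
have E : (fun x t => - (f x t)^-2) = (fun x t => - ((f x t)^-1 * (f x t)^-1)).
  by apply/funext => x; apply/funext => t; rewrite -exprVn expr2.
have ck2 : continuous_rect T (fun x t => - (f x t)^-2).
  by rewrite E; apply: crectN; exact: crectM.
have Ax t : 0 <= t <= T -> ACI 0 1 (fun x => (f x t)^-1) (fun x => fx x t * - (f x t)^-2).
  move=> tT; apply: (ACI_inv ltr01 (weak_x F tT)) => x x01; apply: f0; exact/rectE.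
split.
- exact: ck.
- exact: crectM (weak_cx F) ck2.
- exact: itg2M ck2 (weak_it F).
- apply: itg2D; first exact: itg2M ck2 (weak_ixx F).
  apply: (rect_itg (f := (fun x t => - (fx x t * - (f x t)^-2 * (f x t)^-1 + fx x t * - (f x t)^-2 * (f x t)^-1) * fx x t))).
  have h := crectM (crectM (weak_cx F) ck2) ck.
  exact: crectM (crectN (crectD h h)) (weak_cx F).
- exact: Ax.
- apply: ae_imp (weak_t F) _ => x hf x01.
  apply: (ACI_inv T0 (hf x01)) => t tT; apply: f0; apply/rectE; split => //.
- apply: ae_imp (weak_xx F) _ => t hf tT.
  have tT' : 0 <= t <= T by move: tT; rewrite in_itv.
  apply: ACI_mul ltr01 (hf tT) _.
  have h := ACI_opp (ACI_mul ltr01 (Ax t tT') (Ax t tT')).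
  by apply: ACI_eq h => x _ /=; rewrite -exprVn expr2.
Qed.

(** Classical test functions. Each derivative is taken in the interior of the variable
    differentiated, its value at the ends being fixed by continuity. *)
Record smooth T w wt wx wxx : Prop := Smooth {
  smooth_c : continuous_rect T w;
  smooth_ct : continuous_rect T wt;
  smooth_cx : continuous_rect T wx;
  smooth_cxx : continuous_rect T wxx;
  smooth_t : forall x t : R, 0 <= x <= 1 -> 0 < t < T -> is_derive t 1 (w x) (wt x t);
  smooth_x : forall x t : R, 0 < x < 1 -> 0 <= t <= T -> is_derive x 1 (w^~ t) (wx x t);
  smooth_xx : forall x t : R, 0 < x < 1 -> 0 <= t <= T -> is_derive x 1 (wx^~ t) (wxx x t) }.

Lemma smooth_weak T w wt wx wxx : smooth T w wt wx wxx -> weak T w wt wx wxx.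
Proof.
move=> S; split.
- exact: smooth_c S.
- exact: smooth_cx S.
- exact: (rect_itg (smooth_ct S)).
- exact: (rect_itg (smooth_cxx S)).
- move=> t tT; apply: ftc_AC.
  + exact: rect_cont_x tT (smooth_c S).
  + exact: rect_cont_x tT (smooth_cx S).
  + by move=> x x01; exact: smooth_x S _ _ x01 tT.
- apply: aeW => x; rewrite in_itv/= => x01; apply: ftc_AC.
  + exact: rect_cont_t x01 (smooth_c S).
  + exact: rect_cont_t x01 (smooth_ct S).
  + by move=> t tT; exact: smooth_t S _ _ x01 tT.
- apply: aeW => t; rewrite in_itv/= => tT; apply: ftc_AC.
  + exact: rect_cont_x tT (smooth_cx S).
  + exact: rect_cont_x tT (smooth_cxx S).
  + by move=> x x01; exact: smooth_xx S _ _ x01 tT.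
Qed.

(** Inside the interval the relative punctured filter is the full one, and [y = x + h] turns one
    difference quotient into the other. *)
Lemma derivable_in_is_derive (a b : R) (f : R -> R) (x : R) : a < x < b ->
  derivable_in `[a, b] f x -> is_derive x 1 f (deriv_in `[a, b] f x).
Proof.
move=> /andP[ax xb] df.
have W : within `[a, b] x^' = x^'.
  apply/seteqP; split => A.
    rewrite /within /= => -[e /= e0 he].
    exists (Num.min e (Num.min (x - a) (b - x))).
      by rewrite /= !lt_min e0 !subr_gt0 ax xb.
    move=> y /=; rewrite !lt_min => /andP[ye]; rewrite !ltr_norml => /andP[/andP[? ?] /andP[? ?]] yx.
    apply: (he y ye yx); rewrite in_itv/=; apply/andP; split; lra.
  by rewrite /within /=; apply: filterS => y Ay _.
move: df; rewrite /derivable_in /deriv_in W => df.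
have E : (fun h : R => h^-1 *: ((f \o shift x) (h *: (1:R)) - f x)) @ 0^' = diff_quot f x y @[y --> x^'].
  apply/seteqP; split => A /=; rewrite /fmap /= => -[e /= e0 he]; exists e => //= y.
    rewrite /= => xy yx; have := he (y - x); rewrite /= sub0r normrN distrC => /(_ xy).
    rewrite subr_eq0 => /(_ yx); rewrite scaler1 /= subrK /diff_quot mulrC.
    by rewrite /GRing.scale /= mulrC.
  rewrite /= sub0r normrN => xy yx; have := he (y + x).
  rewrite /= opprD addrCA subrr addr0 normrN => /(_ xy).
  rewrite -subr_eq0 addrK => /(_ yx).
  by rewrite scaler1 /= /diff_quot addrK mulrC.
have d : derivable f x 1 by rewrite /derivable E.
apply: DeriveDef => //.
by rewrite /derive E.
Qed.

End Weak.

(** * Sub- and supersolutions *)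

Section Comparison.
Context {R : realType}.
Notation leb := (@lebesgue_measure R).
Notation leb2 := ((leb \x leb)%E).
Variables (T D : R) (m V : R -> R -> R) (lam : R) (phi : R -> R -> R).
Hypotheses (T0 : 0 < T) (D0 : 0 < D).
Hypothesis cb : continuous_rect T (dx m).
Hypothesis Hphi : solves T D m V lam (fun _ _ => 0) phi.
Hypothesis phi0 : forall x t, rect T (x, t) -> 0 < phi x t.

Lemma C10_ACI f t : C10 T f -> 0 <= t <= T -> ACI 0 1 (f^~ t) (dx f ^~ t).
Proof.
move=> [cf df cdf] tT; apply: ftc_AC.
- exact: rect_cont_x tT cf.
- exact: rect_cont_x tT cdf.
- move=> x x01; apply: derivable_in_is_derive => //.
  apply: df; apply/rectE; split => //; case/andP: x01 => *; apply/andP; split; exact: ltW.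
Qed.

Lemma solves_weak : exists ft fxx, weak T phi ft (dx phi) fxx /\
  {ae leb2, forall z : R * R, z.1 \in `]0, 1[ -> z.2 \in `]0, T[ ->
     ft z.1 z.2 - D * fxx z.1 z.2 - dx m z.1 z.2 * dx phi z.1 z.2
       + V z.1 z.2 * phi z.1 z.2 = lam * phi z.1 z.2}.
Proof.
have [C [ft [fxx [[ift ifxx aet aex] ae2]]] _ _] := Hphi.
exists ft, fxx; split.
  have [cphi _ cdphi] := C.
  split => //.
  - by move=> t tT; exact: C10_ACI.
  - apply: ae_imp2 aet (ae_itgx ift) _ => x h1 h2 x01; split; first exact: h2.
    by move=> t tT; apply: h1 => //; rewrite in_itv.
  - apply: ae_imp2 aex (ae_itgt ifxx) _ => t h1 h2 tT; split; first exact: h2.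
    by move=> x x01; apply: h1 => //; rewrite in_itv.
apply: negligibleS ae2 => -[x t] /= h h'; apply: h => x01 t0T.
by have := h' x01 t0T; rewrite addr0.
Qed.

(* psi / phi is a subsolution to which the maximum principle applies. *)
Lemma subsolution_le L psi psit psix psixx (x0 t0 : R) :
  smooth T psi psit psix psixx ->
  (forall x t, rect T (x, t) -> 0 <= psi x t) ->
  rect T (x0, t0) -> 0 < psi x0 t0 ->
  (forall x, 0 <= x <= 1 -> psi x 0 = psi x T) ->
  (forall t, 0 <= t <= T -> 0 <= psix 0 t /\ psix 1 t <= 0) ->
  (forall x t, rect T (x, t) ->
     psit x t - D * psixx x t - dx m x t * psix x t + V x t * psi x t <= L * psi x t) ->
  lam <= L.
Proof.
move=> S psi0 xt0 pos per bd ineq; rewrite leNgt; apply/negP => lamL.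
have [ft [fxx [W eqn]]] := solves_weak.
have [C _ phibd phiper] := Hphi.
have Wi := weak_inv T0 W phi0.
have WW := weak_mul T0 (smooth_weak S) Wi.
have ck := weak_c Wi.
(* First-order coefficient of the equation satisfied by [psi / phi]: twice [D] times the logarithmic
   derivative of [phi] joins the drift. *)
have cB : continuous_rect T (fun x t => dx m x t + 2 * D * (dx phi x t * (phi x t)^-1)).
  apply: crectD cb _; apply: crectM; first exact: crect_cst.
  exact: crectM (weak_cx W) ck.
have [M M0 hM] := rect_bounded cB.
have th0 : 0 < lam - L by rewrite subr_gt0.
have := weak_max_principle (M := M) T0 D0 th0 WW.
have h1 : forall x t, rect T (x, t) -> 0 <= psi x t * (phi x t)^-1.
  by move=> x t xt; rewrite mulr_ge0 ?psi0// invr_ge0 ltW// phi0.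
have h2 : forall x, x \in `]0, 1[ -> psi x 0 * (phi x 0)^-1 = psi x T * (phi x T)^-1.
  move=> x x01; rewrite (phiper x x01) per//.
  by move: x01; rewrite in_itv/= => /andP[a1 a2]; rewrite !ltW.
have h3 : forall t, 0 <= t <= T -> 0 <= psix 0 t * (phi 0 t)^-1 + dx phi 0 t * - phi 0 t ^- 2 * psi 0 t /\
   psix 1 t * (phi 1 t)^-1 + dx phi 1 t * - phi 1 t ^- 2 * psi 1 t <= 0.
  move=> t tT; have tT' : t \in `[0, T] by rewrite in_itv.
  (* The Neumann condition on [phi] leaves only the slope of [psi] at the two ends. *)
  have [-> ->] := phibd t tT'; rewrite !mul0r !addr0.
  have [b0 b1] := bd t tT.
  have p0 : 0 <= (phi 0 t)^-1 by rewrite invr_ge0 ltW// phi0//; apply/rectE; rewrite lexx ler01.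
  have p1 : 0 <= (phi 1 t)^-1 by rewrite invr_ge0 ltW// phi0//; apply/rectE; rewrite lexx ler01.
  by split; [exact: mulr_ge0|exact: mulr_le0_ge0].
move=> /(_ h1 h2 h3) /=.
have h4 : {ae leb2, forall z : R * R, z.1 \in `]0, 1[ -> z.2 \in `]0, T[ ->
     psit z.1 z.2 * (phi z.1 z.2)^-1 + ft z.1 z.2 * - phi z.1 z.2 ^- 2 * psi z.1 z.2 -
     D * (psixx z.1 z.2 * (phi z.1 z.2)^-1 + dx phi z.1 z.2 * - phi z.1 z.2 ^- 2 * psix z.1 z.2 +
         ((fxx z.1 z.2 * - phi z.1 z.2 ^- 2 +
          - (dx phi z.1 z.2 * - phi z.1 z.2 ^- 2 * (phi z.1 z.2)^-1 +
             dx phi z.1 z.2 * - phi z.1 z.2 ^- 2 * (phi z.1 z.2)^-1) * dx phi z.1 z.2) * psi z.1 z.2 +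
          psix z.1 z.2 * (dx phi z.1 z.2 * - phi z.1 z.2 ^- 2))) <=
     M * `|psix z.1 z.2 * (phi z.1 z.2)^-1 + dx phi z.1 z.2 * - phi z.1 z.2 ^- 2 * psi z.1 z.2| -
     (lam - L) * (psi z.1 z.2 * (phi z.1 z.2)^-1)}.
  apply: negligibleS eqn => -[x t] /= h h'; apply: h => x01 tT.
  have {h'} := h' x01 tT.
  have xt : rect T (x, t).
    by apply/rectE; move: x01 tT; rewrite !in_itv/= => /andP[? ?] /andP[? ?]; split; apply/andP; split; exact: ltW.
  have p0 := phi0 xt; have := ineq x t xt; have := hM x t xt.
  have := ineq x t xt; have := hM x t xt; clear h1 h2 h3.
  set p := phi x t in p0 *; set px := dx phi x t; set pxx := fxx x t; set pt := ft x t.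
  set s := psi x t; set sx := psix x t; set st := psit x t; set sxx := psixx x t.
  set b := dx m x t; set v := V x t => hB I1 _ _ E1.
  set wx := sx * p^-1 + px * - p ^- 2 * s.
  have B1 : (b + 2 * D * (px * p^-1)) * wx <= M * `|wx|.
    rewrite (le_trans (ler_norm _))// normrM ler_wpM2r//.
  apply: le_trans (lerB B1 (lexx _)).
  rewrite -subr_ge0.
  (* The remainder is the defect of the subsolution divided by [phi], plus a multiple of the
     equation of [phi], which holds at this point. *)
  have -> : (b + 2 * D * (px / p)) * wx - (lam - L) * (s / p) -
    (st / p + pt * - p ^- 2 * s -
     D * (sxx / p + px * - p ^- 2 * sx +
      ((pxx * - p ^- 2 + - (px * - p ^- 2 / p + px * - p ^- 2 / p) * px) * s + sx * (px * - p ^- 2))))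
    = (L * s - (st - D * sxx - b * sx + v * s)) / p
      + (pt - D * pxx - b * px + v * p - lam * p) * s / p ^+ 2.
    by rewrite /wx; field; rewrite gt_eqF.
  by rewrite E1 subrr !mul0r addr0; apply: divr_ge0; [rewrite subr_ge0|exact: ltW].
move=> /(_ h4 x0 t0 xt0) /eqP.
by rewrite mulf_eq0 invr_eq0 !gt_eqF ?phi0.
Qed.

Lemma smooth_expN v vt vx vxx : smooth T v vt vx vxx ->
  smooth T (fun x t => expR (- v x t)) (fun x t => - vt x t * expR (- v x t))
    (fun x t => - vx x t * expR (- v x t))
    (fun x t => (vx x t ^+ 2 - vxx x t) * expR (- v x t)).
Proof.
move=> S.
have ce : continuous_rect T (fun x t => expR (- v x t)).
  exact: crect_comp (@continuous_expR R) (crectN (smooth_c S)).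
have dexp (f : R -> R) (x df : R) : is_derive x 1 f df ->
    is_derive x 1 (fun y => expR (- f y)) (- df * expR (- f x)).
  move=> hf; have hN : is_derive x 1 (fun y => - f y) (- df) by exact: is_deriveN.
  have := @is_derive1_comp _ expR (fun y => - f y) x _ _ (is_derive_expR _) hN.
  by rewrite mulrC.
split.
- exact: ce.
- exact: crectM (crectN (smooth_ct S)) ce.
- exact: crectM (crectN (smooth_cx S)) ce.
- exact: crectM (crectB (crectX (n:=2) (smooth_cx S)) (smooth_cxx S)) ce.
- by move=> x t x01 tT; apply: dexp; exact: smooth_t S _ _ x01 tT.
- by move=> x t x01 tT; apply: (dexp (v^~ t)); exact: smooth_x S _ _ x01 tT.
- move=> x t x01 tT.
  have h1 := dexp (v^~ t) x _ (smooth_x S x01 tT).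
  have h2 := smooth_xx S x01 tT.
  have h3 : is_derive x 1 (fun y => - vx y t) (- vxx x t) by exact: is_deriveN.
  apply: der_eq (derM h3 h1) _.
  ring.
Qed.

(* The supersolution is exp v, with quotient phi exp(- v). *)
Lemma supersolution_ge L v vt vx vxx :
  smooth T v vt vx vxx ->
  (forall x, 0 <= x <= 1 -> v x 0 = v x T) ->
  (forall t, 0 <= t <= T -> vx 0 t <= 0 /\ 0 <= vx 1 t) ->
  (forall x t, rect T (x, t) ->
     L <= vt x t - D * vxx x t - D * vx x t ^+ 2 - dx m x t * vx x t + V x t) ->
  L <= lam.
Proof.
move=> S per bd ineq; rewrite leNgt; apply/negP => lamL.
have [ft [fxx [W eqn]]] := solves_weak.
have [C _ phibd phiper] := Hphi.
have Wi := smooth_weak (smooth_expN S).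
have WW := weak_mul T0 W Wi.
(* Here the first-order coefficient is explicit, the logarithm of the supersolution being [v]. *)
have cB : continuous_rect T (fun x t => dx m x t + 2 * D * vx x t).
  apply: crectD cb _; apply: crectM; first exact: crect_cst.
  exact: smooth_cx S.
have [M M0 hM] := rect_bounded cB.
have th0 : 0 < L - lam by rewrite subr_gt0.
have := weak_max_principle (M := M) T0 D0 th0 WW.
have h1 : forall x t, rect T (x, t) -> 0 <= phi x t * expR (- v x t).
  by move=> x t xt; rewrite mulr_ge0 ?expR_ge0// ltW// phi0.
have h2 : forall x, x \in `]0, 1[ -> phi x 0 * expR (- v x 0) = phi x T * expR (- v x T).
  move=> x x01; rewrite (phiper x x01) per//.
  by move: x01; rewrite in_itv/= => /andP[a1 a2]; rewrite !ltW.
have h3 : forall t, 0 <= t <= T ->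
   0 <= dx phi 0 t * expR (- v 0 t) + - vx 0 t * expR (- v 0 t) * phi 0 t /\
   dx phi 1 t * expR (- v 1 t) + - vx 1 t * expR (- v 1 t) * phi 1 t <= 0.
  move=> t tT; have tT' : t \in `[0, T] by rewrite in_itv.
  have [-> ->] := phibd t tT'; rewrite !mul0r !add0r.
  have [b0 b1] := bd t tT.
  have p0 : 0 < phi 0 t by rewrite phi0//; apply/rectE; rewrite lexx ler01.
  have p1 : 0 < phi 1 t by rewrite phi0//; apply/rectE; rewrite lexx ler01.
  split; first by rewrite !mulr_ge0 ?expR_ge0 ?oppr_ge0// ltW.
  by rewrite mulr_le0_ge0 ?mulr_le0_ge0 ?expR_ge0 ?oppr_le0// ltW.
move=> /(_ h1 h2 h3) /=.
have h4 : {ae leb2, forall z : R * R, z.1 \in `]0, 1[ -> z.2 \in `]0, T[ ->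
     ft z.1 z.2 * expR (- v z.1 z.2) + - vt z.1 z.2 * expR (- v z.1 z.2) * phi z.1 z.2 -
     D * (fxx z.1 z.2 * expR (- v z.1 z.2) + - vx z.1 z.2 * expR (- v z.1 z.2) * dx phi z.1 z.2 +
      ((vx z.1 z.2 ^+ 2 - vxx z.1 z.2) * expR (- v z.1 z.2) * phi z.1 z.2 +
       dx phi z.1 z.2 * (- vx z.1 z.2 * expR (- v z.1 z.2)))) <=
     M * `|dx phi z.1 z.2 * expR (- v z.1 z.2) + - vx z.1 z.2 * expR (- v z.1 z.2) * phi z.1 z.2| -
     (L - lam) * (phi z.1 z.2 * expR (- v z.1 z.2))}.
  apply: negligibleS eqn => -[x t] /= h h'; apply: h => x01 tT.
  have {h'} := h' x01 tT.
  have xt : rect T (x, t).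
    by apply/rectE; move: x01 tT; rewrite !in_itv/= => /andP[? ?] /andP[? ?]; split; apply/andP; split; exact: ltW.
  have p0 := phi0 xt; have := ineq x t xt; have := hM x t xt; have := expR_gt0 (- v x t).
  clear h1 h2 h3.
  set p := phi x t in p0 *; set px := dx phi x t; set pxx := fxx x t; set pt := ft x t.
  set e := expR _; set sx := vx x t; set st := vt x t; set sxx := vxx x t.
  set b := dx m x t; set v0 := V x t => e0 hB I1 E1.
  set wx := px * e + - sx * e * p.
  have B1 : (b + 2 * D * sx) * wx <= M * `|wx|.
    rewrite (le_trans (ler_norm _))// normrM ler_wpM2r//.
  apply: le_trans (lerB B1 (lexx _)).
  rewrite -subr_ge0.
  have -> : (b + 2 * D * sx) * wx - (L - lam) * (p * e) - (pt * e + - st * e * p -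
    D * (pxx * e + - sx * e * px + ((sx ^+ 2 - sxx) * e * p + px * (- sx * e))))
    = p * e * (st - D * sxx - D * sx ^+ 2 - b * sx + v0 - L)
      - (pt - D * pxx - b * px + v0 * p - lam * p) * e.
    by rewrite /wx; ring.
  by rewrite E1 subrr !mul0r subr0 mulr_ge0// ?subr_ge0// mulr_ge0// ltW.
(* The quotient is positive everywhere, so its vanishing at any one point is a contradiction. *)
have r0 : rect T (0, 0) by apply/rectE; split; rewrite lexx ?ler01 ?ltW.
move=> /(_ h4 0 0 r0) /eqP.
by rewrite mulf_eq0 !gt_eqF ?phi0 ?expR_gt0.
Qed.

End Comparison.

(** * Profiles *)

Section Profiles.
Context {R : realType}.
Notation leb := (@lebesgue_measure R).
Implicit Types (T : R).

Lemma wcontM (A : set R) (f g : R -> R) : {within A, continuous f} -> {within A, continuous g} ->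
  {within A, continuous (fun x => f x * g x)}.
Proof. by move=> cf cg z; apply: cvgM; [exact: cf|exact: cg]. Qed.

Lemma wcontD (A : set R) (f g : R -> R) : {within A, continuous f} -> {within A, continuous g} ->
  {within A, continuous (fun x => f x + g x)}.
Proof. by move=> cf cg z; apply: cvgD; [exact: cf|exact: cg]. Qed.

Lemma wcontN (A : set R) (f : R -> R) : {within A, continuous f} ->
  {within A, continuous (fun x => - f x)}.
Proof. by move=> cf z; apply: cvgN; exact: cf. Qed.

Lemma wcont_cst (A : set R) (c : R) : {within A, continuous (fun=> c)}.
Proof. by move=> z; exact: cvg_cst. Qed.

Lemma wcontZ (A : set R) (c : R) (f : R -> R) : {within A, continuous f} ->
  {within A, continuous (fun x => c * f x)}.
Proof. by move=> cf; apply: wcontM => //; exact: wcont_cst. Qed.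

Lemma wcont_comp (A : set R) (g f : R -> R) : continuous g -> {within A, continuous f} ->
  {within A, continuous (fun x => g (f x))}.
Proof. by move=> cg cf z; apply: (cvg_comp _ g (cf z)); exact: cg. Qed.

Lemma wcontV (a b : R) (f : R -> R) : {within `[a, b], continuous f} ->
  (forall x, a <= x <= b -> 0 < f x) -> {within `[a, b], continuous (fun x => (f x)^-1)}.
Proof.
move=> cf f0; apply/subspace_continuousP => x xab.
apply: cvgV; last by move/subspace_continuousP : cf => /(_ _ xab).
by rewrite gt_eqF// f0//; move: xab; rewrite /= in_itv.
Qed.

(* The equation is linear in 1 / a: with G a primitive of g, the solution is
   exp(2 G) / (c + 2 \int exp(2 G)), and c is fixed by periodicity. *)
Lemma riccati T (g : R -> R) : 0 < T -> {within `[0, T], continuous g} -> 0 < pint g 0 T ->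
  exists a a' : R -> R,
    [/\ {within `[0, T], continuous a} /\ {within `[0, T], continuous a'},
        forall t, 0 <= t <= T -> 0 < a t,
        a 0 = a T,
        forall t, 0 < t < T -> is_derive t 1 a (a' t) &
        (forall t, 0 <= t <= T -> a' t = 2 * g t * a t - 2 * a t ^+ 2) /\
        pint a 0 T = pint g 0 T].
Proof.
move=> T0 cg gT.
pose G := pint g 0.
have cG : {within `[0, T], continuous G} by exact: pint_cont.
have dG t : 0 < t < T -> is_derive t 1 G (g t) by exact: pint_is_derive.
pose E t := expR (2 * G t).
have cE : {within `[0, T], continuous E}.
  by apply: wcont_comp; [exact: continuous_expR|exact: wcontZ].
have dE t : 0 < t < T -> is_derive t 1 E (E t * (2 * g t)).
  by move=> tT; apply: der_comp (is_derive_expR _) _; exact: derZ (dG t tT).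
have E0 t : 0 < E t by exact: expR_gt0.
pose I := pint E 0.
have I0 t : 0 <= t -> 0 <= I t by move=> t0; apply: pint_ge0 => x _; exact: ltW.
have ET : 1 < E T.
  by rewrite -expR0 ltr_expR mulr_gt0.
have IT : 0 < I T.
  have [M M0 hM] : exists2 m : R, 0 < m & forall x, 0 <= x <= T -> m <= E x.
    have [c c0T hc] := EVT_min (ltW T0) cE.
    exists (E c); [exact: E0|move=> x x0T; apply: hc; rewrite in_itv; exact: x0T].
  apply: (@lt_le_trans _ _ (M * (T - 0))); first by rewrite subr0 mulr_gt0.
  rewrite -pint_cst; last exact: ltW.
  apply: le_pint => //; first exact: itg_cst.
  exact: ccont_itg.
pose c0 := 2 * I T / (E T - 1).
have c00 : 0 < c0 by rewrite divr_gt0 ?mulr_gt0// subr_gt0.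
pose q t := c0 + 2 * I t.
have q0 t : 0 <= t <= T -> 0 < q t.
  by move=> /andP[t0 _]; rewrite ltr_wpDr// mulr_ge0// I0.
have cq : {within `[0, T], continuous q}.
  apply: wcontD; first exact: wcont_cst.
  by apply: wcontZ; exact: pint_cont.
have dq t : 0 < t < T -> is_derive t 1 q (2 * E t).
  move=> tT; apply: der_eq (derD (der_cst _ _) (derZ _ (pint_is_derive cE tT))) _.
  by rewrite add0r.
have qT : q T = c0 * E T.
  rewrite /q /c0; field; rewrite gt_eqF//; lra.
have q00 : q 0 = c0 by rewrite /q /I pint_xx mulr0 addr0.
have ioo t : 0 < t < T -> 0 <= t <= T by move=> /andP[? ?]; rewrite !ltW.
pose a t := E t * (q t)^-1.
have ca : {within `[0, T], continuous a} by apply: wcontM => //; exact: wcontV.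
exists a, (fun t => 2 * g t * a t - 2 * (a t * a t)); split.
- split => //; apply: wcontD; first by apply: wcontM => //; exact: wcontZ.
  by apply: wcontN; apply: wcontZ; exact: wcontM.
- by move=> t tT; apply: mulr_gt0; [exact: E0|rewrite invr_gt0; exact: q0].
- rewrite /a qT q00 /E /G pint_xx mulr0 expR0; field.
  by rewrite !gt_eqF ?expR_gt0.
- move=> t tT; have qt0 := q0 t (ioo t tT).
  apply: der_eq (derM (dE t tT) (derV _ (dq t tT))) _; first by rewrite gt_eqF.
  by rewrite /a; field; rewrite gt_eqF.
split; first by move=> t _; rewrite expr2.
(* [a] is half the logarithmic derivative of [q], and [q T = q 0 * E T]; this is why [a] and [g]
   have the same mean. *)
have h : ACI 0 T (fun t => 2^-1 * ln (q t)) a.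
  apply: ftc_AC; [|exact: ca|].
    apply: wcontZ; apply/subspace_continuousP => x xT.
    have h1 : q y @[y --> within `[0, T] (nbhs x)] --> q x.
      by move/subspace_continuousP : cq => /(_ _ xT); exact.
    have h2 : 0 < q x by apply: q0; move: xT; rewrite /= in_itv.
    exact: (cvg_comp _ _ h1 (continuous_ln h2)).
  move=> t tT; have qt0 := q0 t (ioo t tT).
  apply: der_eq (derZ _ (der_comp (is_derive1_ln qt0) (dq t tT))) _.
  by rewrite /a; field; rewrite gt_eqF.
have := ACI_sub h (lexx _) (ltW T0) (lexx _) => <-.
rewrite qT q00 lnM ?posrE// /E expRK /G; lra.
Qed.

(** A global quadratic bound on the remainder gives the derivative at once, also at the kink of
    [pos]. *)
Lemma der_quad (f : R -> R) (x d C : R) :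
  (forall y, `|f y - f x - d * (y - x)| <= C * (y - x) ^+ 2) -> is_derive x 1 f d.
Proof.
move=> H.
have C0 : 0 <= C.
  have := H (x + 1); rewrite [x + 1 - x]addrC addKr expr1n !mulr1 => h; apply: le_trans h; exact: normr_ge0.
have cv : (fun h : R => h^-1 *: ((f \o shift x) (h *: (1:R)) - f x)) @ 0^' --> d.
  apply/cvgrPdist_lt => e e0.
  have C1 : 0 < C + 1 by rewrite ltr_wpDl.
  exists (e / (C + 1)); first by rewrite /= divr_gt0.
  move=> h /=; rewrite sub0r normrN => he h0.
  have hn0 : 0 < `|h| by rewrite normr_gt0.
  have := H (h + x); rewrite addrK => Hh.
  rewrite scaler1 /= -(ltr_pM2r hn0) -normrM.
  have -> : (d - h^-1 *: (f (h + x) - f x)) * h = - (f (h + x) - f x - d * h).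
    by rewrite /GRing.scale /=; field.
  rewrite normrN (le_lt_trans Hh)// -(real_normK (num_real h)) expr2 mulrA ltr_pM2r//.
  have : `|h| * (C + 1) < e by rewrite -ltr_pdivlMr.
  by rewrite mulrDr mulr1 mulrC; apply: le_lt_trans; rewrite lerDl.
apply: DeriveDef; first by apply: cvgP; exact: cv.
by rewrite /derive; apply/cvg_lim.
Qed.

Definition pos (x : R) := Num.max x 0.

Lemma pos_ge0 x : 0 <= pos x. Proof. by rewrite /pos le_max lexx orbT. Qed.
Lemma pos_le0 x : x <= 0 -> pos x = 0. Proof. by move=> h; apply/max_idPr. Qed.
Lemma pos_id x : 0 <= x -> pos x = x. Proof. by move=> h; apply/max_idPl. Qed.

Lemma posP (s : R) : (0 <= s /\ pos s = s) \/ (s <= 0 /\ pos s = 0).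
Proof. by case: (lerP 0 s) => h; [left; rewrite pos_id|right; rewrite ltW// pos_le0// ltW]. Qed.

Lemma continuous_pos : continuous pos.
Proof.
move=> x; apply/cvgrPdist_lt => e e0; near=> y.
have : `|x - y| < e by near: y; apply: (nbhsx_ballx x e).
rewrite /pos; apply: le_lt_trans.
by rewrite /Num.max; case: ifPn; case: ifPn; rewrite -?leNgt => h1 h2;
  rewrite ler_norml; apply/andP; split; case: (lerP 0 (x - y)) => h3;
  rewrite ?(ger0_norm h3) ?(ltr0_norm h3); lra.
Unshelve. all: by end_near. Qed.

Lemma der_pos2 (x : R) : is_derive x 1 (fun y => pos y ^+ 2) (2 * pos x).
Proof.
apply: (@der_quad _ _ _ 1) => y; rewrite mul1r.
have s1 := sqr_ge0 x; have s2 := sqr_ge0 y; have s3 := sqr_ge0 (y - x).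
rewrite ler_norml; case: (posP x) => -[hx ->]; case: (posP y) => -[hy ->].
- by apply/andP; split; lra.
- by have h := mulr_ge0_le0 hx hy; apply/andP; split; lra.
- by have h := mulr_le0_ge0 hx hy; apply/andP; split; lra.
- by apply/andP; split; lra.
Qed.

Lemma pos3E x : pos x ^+ 3 = x * pos x ^+ 2.
Proof.
case: (lerP 0 x) => hx; first by rewrite (pos_id hx) exprS.
by rewrite (pos_le0 (ltW hx)) !expr0n /= mulr0.
Qed.

Lemma der_pos3 (x : R) : is_derive x 1 (fun y => pos y ^+ 3) (3 * pos x ^+ 2).
Proof.
have -> : (fun y => pos y ^+ 3) = (fun y => y * pos y ^+ 2) by apply/funext => y; exact: pos3E.
apply: der_eq (derM (der_id x) (der_pos2 x)) _.
rewrite mul1r; case: (lerP 0 x) => hx; first by rewrite (pos_id hx); ring.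
by rewrite (pos_le0 (ltW hx)); ring.
Qed.

(* step1 is the quadratic B-spline with knots 0, 1, 2, 3. *)
Definition step (s : R) := (pos s ^+ 3 - 3 * pos (s - 1) ^+ 3 + 3 * pos (s - 2) ^+ 3 - pos (s - 3) ^+ 3) / 6.
Definition step1 (s : R) := (pos s ^+ 2 - 3 * pos (s - 1) ^+ 2 + 3 * pos (s - 2) ^+ 2 - pos (s - 3) ^+ 2) / 2.
Definition step2 (s : R) := pos s - 3 * pos (s - 1) + 3 * pos (s - 2) - pos (s - 3).

Lemma der_shiftB (f : R -> R) (c x df : R) : is_derive (x - c) 1 f df -> is_derive x 1 (fun y => f (y - c)) df.
Proof.
move=> h; apply: der_eq (@der_comp _ f (fun y => y - c) x _ _ h (derB (der_id x) (der_cst x c))) _.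
by rewrite subr0 mulr1.
Qed.

Lemma der_step (x : R) : is_derive x 1 step (step1 x).
Proof.
rewrite /step; under eq_fun do rewrite mulrC.
apply: der_eq (derZ _ (derB (derD (derB (der_pos3 x) (derZ 3 (der_shiftB (der_pos3 (x - 1)))))
  (derZ 3 (der_shiftB (der_pos3 (x - 2))))) (der_shiftB (der_pos3 (x - 3))))) _.
by rewrite /step1; field.
Qed.

Lemma der_step1 (x : R) : is_derive x 1 step1 (step2 x).
Proof.
rewrite /step1; under eq_fun do rewrite mulrC.
apply: der_eq (derZ _ (derB (derD (derB (der_pos2 x) (derZ 3 (der_shiftB (der_pos2 (x - 1)))))
  (derZ 3 (der_shiftB (der_pos2 (x - 2))))) (der_shiftB (der_pos2 (x - 3))))) _.
by rewrite /step2; field.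
Qed.

Lemma continuous_step2 : continuous step2.
Proof.
have cs (c : R) : continuous (fun s => pos (s - c)).
  move=> x; apply: (cvg_comp _ pos) (@continuous_pos _).
  by apply: cvgB; [exact: cvg_id|exact: cvg_cst].
have cz (c : R) : continuous (fun s => 3 * pos (s - c)).
  by move=> x; apply: cvgM; [exact: cvg_cst|exact: cs].
move=> x; apply: cvgB; last exact: cs.
apply: cvgD; last exact: cz.
by apply: cvgB; [exact: continuous_pos|exact: cz].
Qed.

Lemma step_le0 s : s <= 0 -> step s = 0.
Proof. by move=> h; rewrite /step !pos_le0; lra. Qed.
Lemma step_ge3 s : 3 <= s -> step s = 1.
Proof. by move=> h; rewrite /step !pos_id; try lra; field. Qed.
Lemma step1_le0 s : s <= 0 -> step1 s = 0.
Proof. by move=> h; rewrite /step1 !pos_le0; lra. Qed.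
Lemma step1_ge3 s : 3 <= s -> step1 s = 0.
Proof. by move=> h; rewrite /step1 !pos_id; try lra; field. Qed.
(** Strictness inside the whole support is what later confines the zeros of the slope of the
    monotone potential to the nodes and the intervals of [B]. *)
Lemma step1_gt0 s : 0 < s < 3 -> 0 < step1 s.
Proof.
move=> /andP[s0 s3]; rewrite /step1; case: (posP s) => -[h0 ->]; case: (posP (s - 1)) => -[h1 ->];
  case: (posP (s - 2)) => -[h2 ->]; case: (posP (s - 3)) => -[h3 ->]; nra.
Qed.
Lemma step1_ge0 s : 0 <= step1 s.
Proof.
case: (lerP s 0) => [h|h1]; first by rewrite step1_le0.
case: (lerP 3 s) => [h|h2]; first by rewrite step1_ge3.
by rewrite ltW// step1_gt0// h1.
Qed.

Lemma step_bounds s : 0 <= step s <= 1.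
Proof.
have mono x y : x <= y -> step x <= step y.
  move=> xy; have cst : {within `[x, y], continuous step}.
    by apply: continuous_subspaceT => z; exact: der_cont (der_step z).
  have [c _ h] := MVT_segment xy (fun z _ => der_step z) cst.
  by rewrite -subr_ge0 h mulr_ge0 ?step1_ge0// subr_ge0.
case: (lerP s 0) => [h|h1]; first by rewrite step_le0// lexx ler01.
case: (lerP 3 s) => [h|h2]; first by rewrite step_ge3// lexx ler01.
apply/andP; split.
  by rewrite -(step_le0 (lexx 0)); apply: mono; exact: ltW.
by rewrite -(step_ge3 (lexx 3)); apply: mono; exact: ltW.
Qed.

End Profiles.

(** * Closure properties of classical test functions *)

Section SmoothAlgebra.
Context {R : realType}.
Implicit Types (T : R).

Lemma crect_time T (k : R -> R) : {within `[0, T], continuous k} ->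
  continuous_rect T (fun _ t => k t).
Proof.
move=> ck; apply: continuous_rectP => x t /rectE[_ tT] e e0.
have [d d0 hd] := itv_ucont ck e0.
by exists d => // y s /rectE[_ sT] _; exact: hd.
Qed.

Lemma crect_space T (k : R -> R) : {within `[0, 1], continuous k} ->
  continuous_rect T (fun x _ => k x).
Proof.
move=> ck; apply: continuous_rectP => x t /rectE[x01 _] e e0.
have [d d0 hd] := itv_ucont ck e0.
by exists d => // y s /rectE[y01 _] xy _; exact: hd.
Qed.

Lemma smooth_time T (f f' : R -> R) :
  {within `[0, T], continuous f} -> {within `[0, T], continuous f'} ->
  (forall t, 0 < t < T -> is_derive t 1 f (f' t)) ->
  smooth T (fun _ t => f t) (fun _ t => f' t) (fun _ _ => 0) (fun _ _ => 0).
Proof.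
move=> cf cf' df; split.
- exact: crect_time.
- exact: crect_time.
- exact: crect_cst.
- exact: crect_cst.
- by move=> x t _ tT; exact: df.
- by move=> x t _ _; exact: der_cst.
- by move=> x t _ _; exact: der_cst.
Qed.

Lemma smooth_space T (h h1 h2 : R -> R) :
  (forall x : R, is_derive x 1 h (h1 x)) -> (forall x : R, is_derive x 1 h1 (h2 x)) -> continuous h2 ->
  smooth T (fun x _ => h x) (fun _ _ => 0) (fun x _ => h1 x) (fun x _ => h2 x).
Proof.
move=> dh dh1 ch2; split.
- by apply: crect_space; apply: continuous_subspaceT => x; exact: der_cont (dh x).
- exact: crect_cst.
- by apply: crect_space; apply: continuous_subspaceT => x; exact: der_cont (dh1 x).
- by apply: crect_space; exact: continuous_subspaceT.
- by move=> x t _ _; exact: der_cst.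
- by move=> x t _ _; exact: dh.
- by move=> x t _ _; exact: dh1.
Qed.

Lemma smooth_add T f ft fx fxx g gt gx gxx :
  smooth T f ft fx fxx -> smooth T g gt gx gxx ->
  smooth T (fun x t => f x t + g x t) (fun x t => ft x t + gt x t)
    (fun x t => fx x t + gx x t) (fun x t => fxx x t + gxx x t).
Proof.
move=> F G; split.
- exact: crectD (smooth_c F) (smooth_c G).
- exact: crectD (smooth_ct F) (smooth_ct G).
- exact: crectD (smooth_cx F) (smooth_cx G).
- exact: crectD (smooth_cxx F) (smooth_cxx G).
- by move=> x t x01 tT; exact: derD (smooth_t F x01 tT) (smooth_t G x01 tT).
- by move=> x t x01 tT; exact: derD (smooth_x F x01 tT) (smooth_x G x01 tT).
- by move=> x t x01 tT; exact: derD (smooth_xx F x01 tT) (smooth_xx G x01 tT).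
Qed.

Lemma smooth_mul T f ft fx fxx g gt gx gxx :
  smooth T f ft fx fxx -> smooth T g gt gx gxx ->
  smooth T (fun x t => f x t * g x t) (fun x t => ft x t * g x t + f x t * gt x t)
    (fun x t => fx x t * g x t + f x t * gx x t)
    (fun x t => (fxx x t * g x t + fx x t * gx x t) + (fx x t * gx x t + f x t * gxx x t)).
Proof.
move=> F G; split.
- exact: crectM (smooth_c F) (smooth_c G).
- exact: crectD (crectM (smooth_ct F) (smooth_c G)) (crectM (smooth_c F) (smooth_ct G)).
- exact: crectD (crectM (smooth_cx F) (smooth_c G)) (crectM (smooth_c F) (smooth_cx G)).
- apply: crectD; apply: crectD; apply: crectM;
    (exact: smooth_cxx F || exact: smooth_cx F || exact: smooth_c F ||
     exact: smooth_cxx G || exact: smooth_cx G || exact: smooth_c G).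
- by move=> x t x01 tT; exact: derM (smooth_t F x01 tT) (smooth_t G x01 tT).
- by move=> x t x01 tT; exact: derM (smooth_x F x01 tT) (smooth_x G x01 tT).
- move=> x t x01 tT; apply: derD.
    exact: derM (smooth_xx F x01 tT) (smooth_x G x01 tT).
  exact: derM (smooth_x F x01 tT) (smooth_xx G x01 tT).
Qed.

Lemma smooth_scale T (k : R) f ft fx fxx : smooth T f ft fx fxx ->
  smooth T (fun x t => k * f x t) (fun x t => k * ft x t)
    (fun x t => k * fx x t) (fun x t => k * fxx x t).
Proof.
move=> F; split.
- by apply: crectM (smooth_c F); exact: crect_cst.
- by apply: crectM (smooth_ct F); exact: crect_cst.
- by apply: crectM (smooth_cx F); exact: crect_cst.
- by apply: crectM (smooth_cxx F); exact: crect_cst.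
- by move=> x t x01 tT; exact: derZ (smooth_t F x01 tT).
- by move=> x t x01 tT; exact: derZ (smooth_x F x01 tT).
- by move=> x t x01 tT; exact: derZ (smooth_xx F x01 tT).
Qed.

Lemma smooth_zero T : smooth T (fun _ _ => 0) (fun _ _ => 0) (fun _ _ => 0) (fun _ _ => 0).
Proof.
by apply: (@smooth_time T (fun=> 0) (fun=> 0)) => *; (exact: wcont_cst || exact: der_cst).
Qed.

Lemma smooth_sum T (I : eqType) (r : seq I) (f ft fx fxx : I -> R -> R -> R) :
  (forall i, i \in r -> smooth T (f i) (ft i) (fx i) (fxx i)) ->
  smooth T (fun x t => \sum_(i <- r) f i x t) (fun x t => \sum_(i <- r) ft i x t)
    (fun x t => \sum_(i <- r) fx i x t) (fun x t => \sum_(i <- r) fxx i x t).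
Proof.
elim: r => [_|i r IH H].
  have -> : (fun x t => \sum_(i <- [::]) f i x t) = (fun _ _ => 0).
    by apply/funext => x; apply/funext => t; rewrite big_nil.
  have -> : (fun x t => \sum_(i <- [::]) ft i x t) = (fun _ _ => 0).
    by apply/funext => x; apply/funext => t; rewrite big_nil.
  have -> : (fun x t => \sum_(i <- [::]) fx i x t) = (fun _ _ => 0).
    by apply/funext => x; apply/funext => t; rewrite big_nil.
  have -> : (fun x t => \sum_(i <- [::]) fxx i x t) = (fun _ _ => 0).
    by apply/funext => x; apply/funext => t; rewrite big_nil.
  exact: smooth_zero.
have E (g : I -> R -> R -> R) : (fun x t => \sum_(j <- i :: r) g j x t) =
   (fun x t => g i x t + \sum_(j <- r) g j x t).
  by apply/funext => x; apply/funext => t; rewrite big_cons.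
rewrite !E; apply: smooth_add; first by apply: H; rewrite mem_head.
by apply: IH => j jr; apply: H; rewrite in_cons jr orbT.
Qed.

(** The shape shared by the truncated Gaussians of the upper bound and the wells of the lower
    bound. *)
Lemma smooth_comp_quad T (x0 : R) (a a' k k1 k2 : R -> R) :
  {within `[0, T], continuous a} -> {within `[0, T], continuous a'} ->
  (forall t, 0 < t < T -> is_derive t 1 a (a' t)) ->
  (forall s : R, is_derive s 1 k (k1 s)) -> (forall s : R, is_derive s 1 k1 (k2 s)) -> continuous k2 ->
  smooth T (fun x t => k (a t * (x - x0) ^+ 2))
    (fun x t => k1 (a t * (x - x0) ^+ 2) * (a' t * (x - x0) ^+ 2))
    (fun x t => k1 (a t * (x - x0) ^+ 2) * (a t * (2 * (x - x0))))
    (fun x t => k2 (a t * (x - x0) ^+ 2) * (a t * (2 * (x - x0))) ^+ 2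
       + k1 (a t * (x - x0) ^+ 2) * (a t * 2)).
Proof.
move=> ca ca' da dk dk1 ck2.
have ck : continuous k by move=> s; exact: der_cont (dk s).
have ck1 : continuous k1 by move=> s; exact: der_cont (dk1 s).
have cy : continuous_rect T (fun x _ => x - x0).
  by apply: crect_space; apply: continuous_subspaceT => z; apply: cvgB; [exact: cvg_id|exact: cvg_cst].
have cat : continuous_rect T (fun _ t => a t) by exact: crect_time.
have ca't : continuous_rect T (fun _ t => a' t) by exact: crect_time.
have cs : continuous_rect T (fun x t => a t * (x - x0) ^+ 2).
  by apply: crectM => //; exact: crectX.
have c2 : continuous_rect T (fun x t => a t * (2 * (x - x0))).
  by apply: crectM => //; apply: crectM => //; exact: crect_cst.
have dy (x : R) : is_derive x 1 (fun x => x - x0) 1.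
  by apply: der_eq (derB (der_id x) (der_cst x x0)) _; rewrite subr0.
have dy2 (x : R) : is_derive x 1 (fun x => (x - x0) ^+ 2) (2 * (x - x0)).
  have -> : (fun x => (x - x0) ^+ 2) = (fun x => (x - x0) * (x - x0)).
    by apply/funext => z; rewrite expr2.
  apply: der_eq (derM (dy x) (dy x)) _; ring.
have ds (x t : R) : is_derive x 1 (fun x => a t * (x - x0) ^+ 2) (a t * (2 * (x - x0))).
  exact: derZ.
split.
- exact: crect_comp ck cs.
- by apply: crectM; [exact: crect_comp ck1 cs|apply: crectM => //; exact: crectX].
- by apply: crectM; [exact: crect_comp ck1 cs|].
- apply: crectD; apply: crectM.
  + exact: crect_comp ck2 cs.
  + exact: crectX.
  + exact: crect_comp ck1 cs.
  + by apply: crectM => //; exact: crect_cst.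
- move=> x t _ tT.
  apply: (@der_comp _ k (fun t => a t * (x - x0) ^+ 2) t _ _ (dk _)).
  apply: der_eq (derM (da t tT) (der_cst t ((x - x0) ^+ 2))) _; ring.
- move=> x t _ _.
  apply: (@der_comp _ k (fun x => a t * (x - x0) ^+ 2) x _ _ (dk _) (ds x t)).
- move=> x t _ _.
  have h1 := @der_comp _ k1 (fun x => a t * (x - x0) ^+ 2) x _ _ (dk1 _) (ds x t).
  have h2 := derZ (a t) (derZ 2 (dy x)).
  apply: der_eq (derM h1 h2) _; ring.
Qed.

End SmoothAlgebra.

(** * The truncated Gaussian profile *)

Section Cutoff.
Context {R : realType}.
Variable c : R.

(* A truncated Gaussian: s stands for a (x - x0)^2 / (2 D), and the cubic
   power makes the truncation C^2. *)
Definition cutfP (s : R) := pos (1 - c * expR s).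
Definition cutf (s : R) := expR (- s) * cutfP s ^+ 3.
Definition cutf1 (s : R) := - (cutf s + 3 * c * cutfP s ^+ 2).
Definition cutf2 (s : R) := cutf s + 3 * c * cutfP s ^+ 2 + 6 * c ^+ 2 * (expR s * cutfP s).

Lemma der_cutf (s : R) : is_derive s 1 cutf (cutf1 s).
Proof.
have dE : is_derive s 1 (fun s => expR (- s)) (- expR (- s)).
  by apply: der_eq (der_comp (is_derive_expR (- s)) (derN (der_id s))) _; rewrite mulrN1.
have dI : is_derive s 1 (fun s => 1 - c * expR s) (- (c * expR s)).
  by apply: der_eq (derB (der_cst s 1) (derZ c (is_derive_expR s))) _; rewrite sub0r.
have dP := @der_comp _ (fun y => pos y ^+ 3) (fun s => 1 - c * expR s) s _ _ (der_pos3 _) dI.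
apply: der_eq (derM dE dP) _.
rewrite /cutf1 /cutf /cutfP.
(* The two exponentials cancel, so the term that comes from differentiating the truncation carries
   none. *)
have -> : expR (- s) * (3 * pos (1 - c * expR s) ^+ 2 * - (c * expR s)) =
  - (3 * c * pos (1 - c * expR s) ^+ 2) * (expR (- s) * expR s) by ring.
by rewrite -expRD addNr expR0; ring.
Qed.

Lemma der_cutf1 (s : R) : is_derive s 1 cutf1 (cutf2 s).
Proof.
have dI : is_derive s 1 (fun s => 1 - c * expR s) (- (c * expR s)).
  by apply: der_eq (derB (der_cst s 1) (derZ c (is_derive_expR s))) _; rewrite sub0r.
have dP := @der_comp _ (fun y => pos y ^+ 2) (fun s => 1 - c * expR s) s _ _ (der_pos2 _) dI.
apply: der_eq (derN (derD (der_cutf s) (derZ (3 * c) dP))) _.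
by rewrite /cutf1 /cutf2 /cutfP; ring.
Qed.

Lemma continuous_cutf2 : continuous cutf2.
Proof.
have cE : continuous (@expR R) by exact: continuous_expR.
have cP : continuous cutfP.
  move=> s; apply: (cvg_comp (fun s => 1 - c * expR s) pos); last exact: continuous_pos.
  apply: cvgB; first exact: cvg_cst.
  by apply: cvgM; [exact: cvg_cst|exact: cE].
have -> : cutf2 = (fun x => - cutf1 x + 6 * c ^+ 2 * (expR x * cutfP x)).
  by apply/funext => x; rewrite /cutf2 /cutf1 opprK.
move=> s; apply: cvgD; first by apply: cvgN; exact: der_cont (der_cutf1 s).
by apply: cvgM; [exact: cvg_cst|apply: cvgM; [exact: cE|exact: cP]].
Qed.

End Cutoff.

(** * Upper bound at a point *)

Section UpperBound.
Context {R : realType}.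
Variables (T : R) (m V : R -> R -> R) (lambda : R -> R).
Hypotheses (T0 : 0 < T) (cb : continuous_rect T (dx m)) (cV : continuous_rect T V).
Hypothesis Hlam : forall D, 0 < D -> principal_eigenvalue T D m V (lambda D).

Lemma wcont_minmax (f : R -> R) : {within `[0, T], continuous f} ->
  (forall t, 0 <= t <= T -> 0 < f t) ->
  exists c C : R, 0 < c /\ forall t, 0 <= t <= T -> c <= f t <= C.
Proof.
move=> cf f0.
have [c c0T hc] := EVT_min (ltW T0) cf.
have [C C0T hC] := EVT_max (ltW T0) cf.
exists (f c), (f C); split; first by apply: f0; move: c0T; rewrite in_itv.
move=> t tT; have t' : t \in `[0, T] by rewrite in_itv.
by apply/andP; split; [exact: hc|exact: hC].
Qed.

Lemma expN_small (K e : R) : 0 < K -> 0 < e ->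
  exists2 D0 : R, 0 < D0 & forall D, 0 < D -> D < D0 -> expR (- (K / D)) <= e.
Proof.
move=> K0 e0; exists (K * e); first exact: mulr_gt0.
move=> D D0 hD; rewrite expRN -[e]invrK lef_pV2 ?posrE ?expR_gt0 ?invr_gt0//.
apply: le_trans (expR_ge1Dx _); rewrite -[_^-1]add0r lerD// ler_pdivlMr//.
by rewrite mulrC ler_pdivrMr// ltW.
Qed.

(** [3 * c * cutfP c s ^+ 2] is the excess of [- cutf1] over [cutf], the price of truncating. Where
    [de * (y2 / D) >= 1] the term with [y2] absorbs it alone. Elsewhere [s <= A / (2 * de)], so that
    [cutfP c s >= 1 / 2] and the Gaussian factor is bounded below; then the smallness of [c]
    suffices. *)
Lemma cutf_slack (c s a A y2 D de : R) : 0 < D -> 0 < de -> 0 < a -> a <= A -> 0 <= y2 ->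
  0 < c -> s = a * y2 / (2 * D) ->
  c <= expR (- (A / (2 * de))) / 2 -> 6 * A * c <= de * expR (- (A / (2 * de))) ->
  3 * a * c * cutfP c s ^+ 2 <= de * a * (y2 / D) * - cutf1 c s + de * cutf c s.
Proof.
move=> D0 de0 a0 aA y20 c0 sE c1 c2.
have A0 : 0 < A by exact: lt_le_trans aA.
have P0 : 0 <= cutfP c s by exact: pos_ge0.
have g0 : 0 <= cutf c s by rewrite /cutf mulr_ge0 ?expR_ge0// exprn_ge0.
have h0 : 3 * c * cutfP c s ^+ 2 <= - cutf1 c s by rewrite /cutf1 opprK lerDr.
have P20 : 0 <= 3 * c * cutfP c s ^+ 2 by rewrite !mulr_ge0 ?sqr_ge0// ltW.
case: (lerP 1 (de * (y2 / D))) => hy.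
  apply: (@le_trans _ _ (de * a * (y2 / D) * - cutf1 c s)); last by rewrite lerDl mulr_ge0// ltW.
  have -> : 3 * a * c * cutfP c s ^+ 2 = a * (3 * c * cutfP c s ^+ 2) by ring.
  have -> : de * a * (y2 / D) * - cutf1 c s = a * (de * (y2 / D) * - cutf1 c s) by ring.
  apply: ler_wpM2l; first exact: ltW.
  apply: (le_trans h0).
  by rewrite ler_peMl//; exact: le_trans P20 h0.
apply: (@le_trans _ _ (de * cutf c s)); last first.
  rewrite lerDr; apply: mulr_ge0; last exact: le_trans P20 h0.
  by rewrite !mulr_ge0 ?invr_ge0 ?(ltW de0) ?(ltW a0) ?(ltW D0).
have y2D : y2 / D <= de^-1 by rewrite -[de^-1]mul1r ler_pdivlMr// mulrC ltW.
have sA : s <= A / (2 * de).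
  have -> : s = a * (y2 / D) / 2 by rewrite sE; field; rewrite gt_eqF.
  have -> : A / (2 * de) = A * de^-1 / 2 by field; rewrite gt_eqF.
  rewrite ler_pM2r ?invr_gt0//; apply: ler_pM => //; first exact: ltW.
  by rewrite mulr_ge0 ?invr_ge0 ?(ltW D0).
have eA : expR (- (A / (2 * de))) <= expR (- s) by rewrite ler_expR lerN2.
have ces : c * expR s <= 1 / 2.
  have : expR (- s) * expR s = 1 by rewrite -expRD addNr expR0.
  have := expR_gt0 s; have : c <= expR (- s) / 2 by apply: (le_trans c1); rewrite ler_pM2r ?invr_gt0.
  move=> h1 h2 h3; have := ler_wpM2r (ltW h2) h1; lra.
have P12 : 1 / 2 <= cutfP c s by rewrite /cutfP pos_id; lra.
rewrite /cutf.
have -> : de * (expR (- s) * cutfP c s ^+ 3) = (de * expR (- s) * cutfP c s) * cutfP c s ^+ 2 by ring.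
apply: ler_wpM2r; first exact: sqr_ge0.
apply: (@le_trans _ _ (de * expR (- (A / (2 * de))) * (1 / 2))).
  have : 3 * a * c <= 3 * A * c by rewrite ler_pM2r// ler_pM2l.
  lra.
rewrite ler_pM//; first by rewrite mulr_ge0 ?expR_ge0// ltW.
by rewrite ler_pM2l.
Qed.

(** The exponential of minus a primitive of [q] is periodic because [q] has mean zero. Taking for
    [q] the deviation of a rate from its mean, the factor replaces the rate by the mean. *)
Lemma time_factor (q : R -> R) : {within `[0, T], continuous q} -> pint q 0 T = 0 ->
  exists f f' : R -> R, [/\ {within `[0, T], continuous f} /\ {within `[0, T], continuous f'},
    forall t, 0 < t < T -> is_derive t 1 f (f' t), forall t, 0 < f t, f 0 = f T &
    forall t, f' t = - q t * f t].
Proof.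
move=> cq pq; pose f t := expR (- pint q 0 t).
have cf : {within `[0, T], continuous f}.
  by apply: wcont_comp; [exact: continuous_expR|apply: wcontN; exact: pint_cont].
exists f, (fun t => - q t * f t); split.
- by split; [exact: cf|apply: wcontM; [exact: wcontN|exact: cf]].
- move=> t tT; apply: der_eq (der_comp (is_derive_expR _) (derN (pint_is_derive cq tT))) _.
  by rewrite mulrC.
- by move=> t; exact: expR_gt0.
- by rewrite /f pq pint_xx.
- by [].
Qed.

Lemma upper_bound (x0 : R) (beta : R -> R) : 0 <= x0 <= 1 ->
  {within `[0, T], continuous beta} -> (forall t, 0 <= t <= T -> 0 <= beta t) ->
  (forall de : R, 0 < de -> exists2 r : R, 0 < r & forall x t, rect T (x, t) -> `|x - x0| <= r ->
     dx m x t * (x - x0) <= (beta t + de) * (x - x0) ^+ 2) ->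
  forall e : R, 0 < e -> exists2 D0 : R, 0 < D0 & forall D, 0 < D -> D < D0 ->
    lambda D <= T^-1 * (pint (V x0) 0 T + pint beta 0 T) + e.
Proof.
move=> x01 cbeta beta0 Hb e e0.
(* Four margins are spent: two raise the mean of [ga] above that of [beta], one bounds the variation
   of [V] near [x0], one pays for the truncation. *)
pose de := e / 4.
have de0 : 0 < de by rewrite divr_gt0.
have [r1 r10 hr1] := Hb de de0.
have [r2 r20 hr2] := rect_ucont cV de0.
pose r := Num.min r1 (r2 / 2).
have r0 : 0 < r by rewrite lt_min r10 divr_gt0.
(* One [de] covers the error on the drift, the other gives the surplus spent in [cutf_slack];
   together they also make the mean positive when [beta] is zero, as the Riccati equation
   demands. *)
pose ga t := beta t + 2 * de.
have cga : {within `[0, T], continuous ga} by apply: wcontD => //; exact: wcont_cst.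
have pga : pint ga 0 T = pint beta 0 T + 2 * de * T.
  by rewrite /ga pintD ?pint_cst ?subr0 ?ltW//; [exact: ccont_itg|exact: itg_cst].
have ga0 : 0 < pint ga 0 T.
  rewrite pga ltr_wpDl//; last by rewrite !mulr_gt0.
  by apply: pint_ge0.
have [a [a' [[ca ca'] a0 aper da [a'E pa]]]] := riccati T0 cga ga0.
have [amin [A [amin0 haA]]] := wcont_minmax ca a0.
have A0 : 0 < A.
  have /andP[h1 h2] := haA 0 (introT andP (conj (lexx _) (ltW T0))).
  exact: lt_le_trans amin0 (le_trans h1 h2).
pose mu := T^-1 * (pint (V x0) 0 T + pint a 0 T).
have cV0 : {within `[0, T], continuous (V x0)} by exact: rect_cont_t.
pose q t := V x0 t + a t - mu.
have cq : {within `[0, T], continuous q}.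
  by apply: wcontD; [exact: wcontD|apply: wcontN; exact: wcont_cst].
have pq : pint q 0 T = 0.
  rewrite /q pintB; [|apply: itgD; exact: ccont_itg|exact: itg_cst].
  rewrite pintD ?pint_cst ?subr0 ?ltW//; try exact: ccont_itg.
  by rewrite /mu; field; rewrite gt_eqF.
have [f [f' [[cf cf'] df f0 fper f'E]]] := time_factor cq pq.
pose es := expR (- (A / (2 * de))).
have es0 : 0 < es by exact: expR_gt0.
pose cs := Num.min (1 / 2) (Num.min (es / 2) (de * es / (6 * A))).
have cs0 : 0 < cs by rewrite !lt_min !divr_gt0 ?mulr_gt0.
have K0 : 0 < amin * r ^+ 2 / 2 by rewrite divr_gt0// mulr_gt0// exprn_gt0.
have [D0 D00 hD0] := expN_small K0 cs0.
exists D0 => // D Dp DD0.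
(* With this [c] the profile vanishes once [a t * y ^+ 2 >= amin * r ^+ 2], hence outside radius [r]
   at every time. *)
pose c := expR (- (amin * r ^+ 2 / 2 / D)).
have c0 : 0 < c by exact: expR_gt0.
have := hD0 D Dp DD0; rewrite -/c !le_min => /andP[c12 /andP[ce cA]].
have [phi [ephi _ _] phi0] := Hlam Dp.
have [sphi _] := ephi.
pose k (z : R) := cutf c ((2 * D)^-1 * z).
pose k1 (z : R) := (2 * D)^-1 * cutf1 c ((2 * D)^-1 * z).
pose k2 (z : R) := (2 * D)^-1 ^+ 2 * cutf2 c ((2 * D)^-1 * z).
have dl (s : R) : is_derive s 1 (fun z => (2 * D)^-1 * z) (2 * D)^-1.
  by apply: der_eq (derZ _ (der_id s)) _; rewrite mulr1.
have dk (s : R) : is_derive s 1 k (k1 s).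
  by apply: der_eq (@der_comp _ (cutf c) (fun z => (2 * D)^-1 * z) s _ _ (der_cutf _ _) (dl s)) _; rewrite mulrC.
have dk1 (s : R) : is_derive s 1 k1 (k2 s).
  apply: der_eq (derZ _ (@der_comp _ (cutf1 c) (fun z => (2 * D)^-1 * z) s _ _ (der_cutf1 _ _) (dl s))) _.
  by rewrite /k2; ring.
have ck2 : continuous k2.
  move=> s; apply: cvgM; first exact: cvg_cst.
  apply: (cvg_comp (fun z => (2 * D)^-1 * z) (cutf2 c)); last exact: continuous_cutf2.
  by apply: cvgM; [exact: cvg_cst|exact: cvg_id].
have S := smooth_mul (smooth_time cf cf' df) (smooth_comp_quad x0 ca ca' da dk dk1 ck2).
apply: (subsolution_le T0 Dp cb sphi phi0 S (x0 := x0) (t0 := 0)).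
- move=> x t xt; apply: mulr_ge0; first exact: ltW.
  rewrite /k /cutf mulr_ge0 ?expR_ge0// exprn_ge0//; exact: pos_ge0.
- by apply/rectE; rewrite x01 lexx ltW.
- rewrite mulr_gt0// /k /cutf /cutfP subrr expr0n /= !mulr0 oppr0 expR0 mul1r mulr1.
  by rewrite exprn_gt0// pos_id; lra.
- by move=> x _; rewrite fper aper.
(* The profile decreases away from [x0], so the slopes at 0 and 1 have the right signs wherever [x0]
   lies in [[0, 1]], ends included. *)
- move=> t tT; have at0 := a0 t tT.
  have k10 z : k1 z <= 0.
    rewrite /k1 pmulr_rle0; last by rewrite invr_gt0 mulr_gt0.
    rewrite /cutf1 oppr_le0; apply: addr_ge0; last first.
      by apply: mulr_ge0; [apply: mulr_ge0 => //; exact: ltW|exact: sqr_ge0].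
    by rewrite /cutf mulr_ge0 ?expR_ge0// exprn_ge0// pos_ge0.
  rewrite !mul0r !add0r; case/andP: x01 => x00 x11; split.
    apply: mulr_ge0; first exact: ltW.
    by apply: mulr_le0; [exact: k10|apply: mulr_ge0_le0; [exact: ltW|lra]].
  apply: mulr_ge0_le0; first exact: ltW.
  by apply: mulr_le0_ge0; [exact: k10|apply: mulr_ge0; [exact: ltW|lra]].
move=> x t xt; have [x01' tT] := (rectE T x t).1 xt.
have at0 := a0 t tT; have /andP[aminat atA] := haA t tT.
set y := x - x0.
rewrite !mul0r !addr0 !add0r.
have -> : T^-1 * (pint (V x0) 0 T + pint beta 0 T) + e = mu + 2 * de.
  by rewrite /mu pa pga /de; field; rewrite gt_eqF.
set s := (2 * D)^-1 * (a t * y ^+ 2).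
have sE : s = a t * y ^+ 2 / (2 * D) by rewrite /s mulrC.
(* The factor [f] trades [V x0 t + a t] for its mean [mu]; the remaining terms are sorted by [cutf],
   [- cutf1] and [cutf2]. *)
have goalE : f' t * k (a t * y ^+ 2) + f t * (k1 (a t * y ^+ 2) * (a' t * y ^+ 2)) -
   D * (f t * (k2 (a t * y ^+ 2) * (a t * (2 * y)) ^+ 2 + k1 (a t * y ^+ 2) * (a t * 2))) -
   dx m x t * (f t * (k1 (a t * y ^+ 2) * (a t * (2 * y)))) + V x t * (f t * k (a t * y ^+ 2))
   = f t * ((V x t - V x0 t - a t + mu) * cutf c s
      + (- cutf1 c s) * (- a' t * y ^+ 2 / (2 * D) + a t + a t * (dx m x t * y) / D)
      - cutf2 c s * (a t ^+ 2 * y ^+ 2 / D)).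
  rewrite f'E /q /k /k1 /k2 -/s; field; by rewrite gt_eqF.
have kE : k (a t * y ^+ 2) = cutf c s by [].
rewrite kE in goalE *.
have P0 : 0 <= cutfP c s by exact: pos_ge0.
have g0 : 0 <= cutf c s by rewrite /cutf mulr_ge0 ?expR_ge0// exprn_ge0.
have Q0 : 0 <= 3 * c * cutfP c s ^+ 2 by rewrite !mulr_ge0 ?sqr_ge0// ltW.
have h0 : 0 <= - cutf1 c s by rewrite /cutf1 opprK addr_ge0.
have g2h : - cutf1 c s <= cutf2 c s.
  by rewrite /cutf1 /cutf2 opprK lerDl !mulr_ge0 ?sqr_ge0 ?expR_ge0.
rewrite goalE [leRHS]mulrCA; apply: ler_wpM2l; first exact: ltW.
clear goalE kE S dk dk1 ck2; clearbody s.
have y20 : 0 <= y ^+ 2 by exact: sqr_ge0.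
case: (lerP `|y| r) => hy; last first.
  have P00 : cutfP c s = 0.
    apply: pos_le0; rewrite subr_le0 /c -expRD -[leLHS]expR0 ler_expR.
    rewrite addrC subr_ge0.
    have -> : amin * r ^+ 2 / 2 / D = amin * r ^+ 2 / (2 * D) by field; rewrite gt_eqF.
    rewrite sE ler_pM2r ?invr_gt0 ?mulr_gt0// -(real_normK (num_real y)).
    apply: ler_pM => //; [exact: ltW|exact: sqr_ge0|].
    by rewrite ler_pXn2r ?nnegrE ?(ltW hy)// ltW.
  by rewrite /cutf1 /cutf2 /cutf P00 !expr0n /= !mulr0 !addr0 !(oppr0, mulr0, mul0r) !(subrr, addr0, mulr0, mul0r, oppr0).
have hyr1 : `|x - x0| <= r1 by apply: le_trans hy _; rewrite ge_min lexx.
have Hby := hr1 x t xt hyr1.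
have HV : V x t - V x0 t <= de.
  apply: le_trans (ler_norm _) _; apply: ltW; apply: hr2 => //; last by rewrite subrr normr0.
  by apply: le_lt_trans hy _; rewrite gt_min; apply/orP; right; rewrite ltr_pdivrMr// ltr_pMr// ltr1n.
(* The Riccati equation cancels [beta] and leaves a surplus in [de]. The term in [a t ^+ 2] is paid
   for by [cutf2], which dominates [- cutf1]. *)
have X1 : - a' t * y ^+ 2 / (2 * D) + a t + a t * (dx m x t * y) / D <=
    a t + (a t ^+ 2 - de * a t) * (y ^+ 2 / D).
  have -> : - a' t * y ^+ 2 / (2 * D) = (a t ^+ 2 - (beta t + 2 * de) * a t) * (y ^+ 2 / D).
    by rewrite a'E// /ga; field; rewrite gt_eqF.
  have : a t * (dx m x t * y) / D <= (beta t + de) * a t * (y ^+ 2 / D).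
    rewrite ler_pdivrMr//; have -> : (beta t + de) * a t * (y ^+ 2 / D) * D = a t * ((beta t + de) * y ^+ 2).
      by field; rewrite gt_eqF.
    by rewrite ler_pM2l.
  lra.
have slack := cutf_slack Dp de0 at0 atA y20 c0 sE ce _.
have {}slack := slack (_ : 6 * A * c <= de * expR (- (A / (2 * de)))).
have {}slack : 3 * a t * c * cutfP c s ^+ 2 <= de * a t * (y ^+ 2 / D) * - cutf1 c s + de * cutf c s.
  apply: slack; move: cA; rewrite ler_pdivlMr ?mulr_gt0// /es; lra.
have Z1 := ler_wpM2l h0 X1.
have Z2 : - cutf1 c s * (a t ^+ 2 * y ^+ 2 / D) <= cutf2 c s * (a t ^+ 2 * y ^+ 2 / D).
  apply: ler_wpM2r => //; apply: divr_ge0; last exact: ltW.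
  exact: mulr_ge0 (sqr_ge0 _) y20.
have Z3 := ler_wpM2r g0 HV.
have hE : - cutf1 c s = cutf c s + 3 * c * cutfP c s ^+ 2 by rewrite /cutf1 opprK.
move: slack Z1 Z2 Z3; rewrite hE.
set P2 := cutfP c s ^+ 2; set g := cutf c s; set g2 := cutf2 c s.
set Y := y ^+ 2 / D; set X := - a' t * y ^+ 2 / (2 * D) + a t + a t * (dx m x t * y) / D.
rewrite -[a t ^+ 2 * y ^+ 2 / D]mulrA -/Y; set W := V x t; set W0 := V x0 t; set aa := a t.
lra.
Qed.

End UpperBound.

(** * Lower bound from the wells *)

Section LowerTools.
Context {R : realType}.
Implicit Types (T : R).

Lemma rect_pos_min T f : continuous_rect T f -> (forall x t, rect T (x, t) -> 0 < f x t) ->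
  exists2 mu : R, 0 < mu & forall x t, rect T (x, t) -> mu <= f x t.
Proof.
move=> cf f0; have [M M0 hM] := rect_bounded (crectV cf f0).
exists M^-1; first by rewrite invr_gt0.
move=> x t xt; have fx := f0 x t xt; rewrite -[f x t]invrK lef_pV2 ?posrE ?invr_gt0//.
by have := hM x t xt; rewrite ger0_norm// invr_ge0 ltW.
Qed.

(** [H] plus the positive part of [F - (L - e)] is continuous and positive, hence at least some
    [mu > 0]. Where [F] is below [L - e] this forces [H >= mu], and a multiple of [H] then outweighs
    the bound on [F]. *)
Lemma penalisation T F H (L e : R) : continuous_rect T F -> continuous_rect T H ->
  (forall x t, rect T (x, t) -> 0 <= H x t) ->
  (forall x t, rect T (x, t) -> H x t = 0 -> L <= F x t) -> 0 < e ->
  exists2 K : R, 0 <= K & forall x t, rect T (x, t) -> L - e <= F x t + K * H x t.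
Proof.
move=> cF cH H0 HF e0.
pose Psi x t := H x t + pos (F x t - (L - e)).
have cPsi : continuous_rect T Psi.
  apply: crectD => //; apply: crect_comp; first exact: continuous_pos.
  by apply: crectB => //; exact: crect_cst.
have Psi0 x t : rect T (x, t) -> 0 < Psi x t.
  move=> xt; have h0 := H0 x t xt; rewrite /Psi.
  have [hz|hp] : H x t = 0 \/ 0 < H x t by move: h0; rewrite le_eqVlt => /orP[/eqP <-|]; [left|right].
    have h1 := HF x t xt hz; have h2 : 0 <= F x t - (L - e) by lra.
    by rewrite hz add0r pos_id//; lra.
  by rewrite ltr_pwDl// pos_ge0.
have [mu mu0 hmu] := rect_pos_min cPsi Psi0.
have [M M0 hM] := rect_bounded cF.
exists ((`|L - e| + M) / mu); first by rewrite divr_ge0 ?addr_ge0// ltW.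
move=> x t xt; have h0 := H0 x t xt.
have [hF|hF] := lerP (L - e) (F x t).
  by apply: le_trans hF _; rewrite lerDl mulr_ge0// divr_ge0 ?addr_ge0// ltW.
have muH : mu <= H x t.
  by have := hmu x t xt; rewrite /Psi pos_le0 ?addr0//; lra.
have KH : `|L - e| + M <= (`|L - e| + M) / mu * H x t.
  rewrite -mulrA ler_peMr ?addr_ge0 ?(ltW M0)//.
  by rewrite mulrC ler_pdivlMr// mul1r.
have := hM x t xt; rewrite ler_norml => /andP[h1 _].
have := ler_norm (L - e); lra.
Qed.

(* w interpolates the primitives in t of U at the nodes j / n by step functions
   of x, so that w_x vanishes at both endpoints. *)
Lemma zero_mean_primitive T U e : 0 < T -> continuous_rect T U ->
  (forall x, 0 <= x <= 1 -> pint (U x) 0 T = 0) -> 0 < e ->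
  exists w wt wx wxx, [/\ smooth T w wt wx wxx,
    forall x, w x 0 = w x T,
    forall t, wx 0 t = 0 /\ wx 1 t = 0 &
    forall x t, rect T (x, t) -> `|wt x t - U x t| <= e].
Proof.
move=> T0 cU pU e0.
have [d d0 hd] := rect_ucont cU e0.
have [n n0 hn] : exists2 n : nat, (0 < n)%N & 1 < d * n%:R.
  have := archi_boundP (_ : 0 <= d^-1); rewrite invr_ge0 ltW// => /(_ isT).
  set k := Num.bound _ => hk; exists k.
    by rewrite -(ltr_nat R); apply: le_lt_trans hk; rewrite invr_ge0 ltW.
  by rewrite mulrC -ltr_pdivrMr// mul1r.
have nR : (0 : R) < n%:R by rewrite ltr0n.
pose node (j : nat) : R := j%:R / n%:R.
have node01 j : (j <= n)%N -> 0 <= node j <= 1.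
  by move=> jn; rewrite /node divr_ge0//= ler_pdivrMr// mul1r ler_nat.
pose nd j := node (minn j n).
have nd01 j : 0 <= nd j <= 1 by apply: node01; exact: geq_minr.
have cnd j : {within `[0, T], continuous (U (nd j))} by exact: rect_cont_t.
pose f j t := pint (U (nd j.+1)) 0 t - pint (U (nd j)) 0 t.
pose f' j t := U (nd j.+1) t - U (nd j) t.
(* [step] rises on [[0, 3]]; the factor [3 * n%:R] makes [s j] rise exactly from node [j] to node
   [j.+1]. *)
pose s j (x : R) := step (3 * n%:R * (x - node j)).
pose s1 j (x : R) := 3 * n%:R * step1 (3 * n%:R * (x - node j)).
pose s2 j (x : R) := 3 * n%:R * (3 * n%:R * step2 (3 * n%:R * (x - node j))).
have dl j (x : R) : is_derive x 1 (fun x => 3 * n%:R * (x - node j)) (3 * n%:R).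
  by apply: der_eq (derZ _ (derB (der_id x) (der_cst x (node j)))) _; rewrite subr0 mulr1.
have ds j (x : R) : is_derive x 1 (s j) (s1 j x).
  apply: der_eq (@der_comp _ step (fun x => 3 * n%:R * (x - node j)) x _ _ (der_step _) (dl j x)) _.
  by rewrite mulrC.
have ds1 j (x : R) : is_derive x 1 (s1 j) (s2 j x).
  apply: der_eq (derZ _ (@der_comp _ step1 (fun x => 3 * n%:R * (x - node j)) x _ _ (der_step1 _) (dl j x))) _.
  by rewrite /s2; ring.
have cs2 j : continuous (s2 j).
  move=> x; apply: cvgM; first exact: cvg_cst.
  apply: cvgM; first exact: cvg_cst.
  apply: (cvg_comp (fun x => 3 * n%:R * (x - node j)) step2); last exact: continuous_step2.
  exact: der_cont (dl j x).
have Sf j : smooth T (fun _ t => f j t) (fun _ t => f' j t) (fun _ _ => 0) (fun _ _ => 0).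
  apply: smooth_time.
  - by apply: wcontD; [|apply: wcontN]; exact: pint_cont.
  - by apply: wcontD; [|apply: wcontN]; exact: cnd.
  - by move=> t tT; apply: derB; exact: pint_is_derive.
have S0 : smooth T (fun _ t => pint (U (nd 0%N)) 0 t) (fun _ t => U (nd 0%N) t) (fun _ _ => 0) (fun _ _ => 0).
  apply: smooth_time; [exact: pint_cont|exact: cnd|by move=> t tT; exact: pint_is_derive].
have S := smooth_add S0 (smooth_sum (r := iota 0 n) (fun j _ => smooth_mul (Sf j) (smooth_space T (ds j) (ds1 j) (cs2 j)))).
have s1E j x : (x <= node j) || (node j.+1 <= x) -> s1 j x = 0.
  rewrite /s1 => /orP[h|h]; first by rewrite step1_le0 ?mulr0// mulr_ge0_le0 ?mulr_ge0 ?ler0n// subr_le0.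
  rewrite step1_ge3 ?mulr0// -mulrA ler_peMr//.
  rewrite mulrC -ler_pdivrMr// mul1r; apply: le_trans (lerB h (lexx _)).
  by rewrite /node -mulrBl -natrB// subSnn mul1r.
eexists; eexists; eexists; eexists; split; first exact: S.
- move=> x /=; rewrite !pint_xx pU//; congr (_ + _); apply: eq_bigr => j _.
  by rewrite /f !pint_xx !pU// !subrr.
- move=> t /=; rewrite !add0r; split; apply: big1_seq => j /andP[_].
    rewrite mem_iota add0n => /andP[_ jn]; rewrite mul0r add0r s1E ?mulr0//.
    by rewrite /node divr_ge0.
  rewrite mem_iota add0n => /andP[_ jn]; rewrite mul0r add0r s1E ?mulr0//.
  by rewrite /node ler_pdivrMr// mul1r ler_nat jn orbT.
move=> x t /rectE[x01 tT] /=.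
have [x0 x1] := andP x01.
have [k kn kx] : exists2 k : nat, (k < n)%N & node k <= x <= node k.+1.
  pose k := Num.truncn (x * n%:R).
  have xn0 : 0 <= x * n%:R by rewrite mulr_ge0 ?ler0n.
  have /andP[k1 k2] := truncn_itv xn0.
  case: (ltnP k n) => kn.
    by exists k => //; rewrite /node ler_pdivrMr// k1 ler_pdivlMr// ltW.
  (* At [x = 1] the truncation returns [n], and the last cell is taken instead. *)
  exists n.-1; first by rewrite prednK.
  rewrite /node prednK// divff ?gt_eqF// x1 andbT.
  have kx' : n%:R <= x * n%:R by apply: le_trans k1; rewrite ler_nat.
  rewrite ler_pdivrMr//; apply: le_trans kx'; by rewrite ler_nat leq_pred.
have nodele i j : (i <= j)%N -> node i <= node j.
  by move=> ij; rewrite /node ler_pM2r ?invr_gt0// ler_nat.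
have ndE j : (j <= n)%N -> nd j = node j by move=> jn; rewrite /nd (minn_idPl jn).
have [kx1 kx2] := andP kx.
have s_1 j : (j < k)%N -> s j x = 1.
  move=> jk; rewrite /s step_ge3// -mulrA ler_peMr//.
  rewrite mulrC -ler_pdivrMr// mul1r.
  apply: le_trans (lerB (le_trans (nodele _ _ jk) kx1) (lexx _)).
  by rewrite /node -mulrBl -natrB// subSnn mul1r.
have s_0 j : (k < j)%N -> s j x = 0.
  move=> kj; rewrite /s step_le0// mulr_ge0_le0 ?mulr_ge0 ?ler0n// subr_le0.
  exact: le_trans kx2 (nodele _ _ kj).
(* Steps before [k] are complete and telescope, later ones have not begun. With the term of node 0,
   [wt] is the convex combination of [U] at nodes [k] and [k.+1] with weight [s k x]. *)
have skE : \sum_(j <- iota 0 n) (f' j t * s j x + f j t * 0) =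
  U (node k) t - U (nd 0%N) t + (U (node k.+1) t - U (node k) t) * s k x.
  have -> : iota 0 n = iota 0 k ++ k :: iota k.+1 (n - k.+1).
    by rewrite -{1}(subnKC kn) addSnnS iotaD add0n -addn1 addnC /= ; congr (_ ++ _); rewrite ?subnSK.
  rewrite big_cat big_cons /=.
  have -> : \sum_(j <- iota 0 k) (f' j t * s j x + f j t * 0) = U (node k) t - U (nd 0%N) t.
    have -> : iota 0 k = index_iota 0 k by rewrite /index_iota subn0.
    rewrite (telescope_sumr_eq (fun j => U (nd j) t))//.
      by rewrite ndE// ltnW.
    by move=> j /andP[_ jk]; rewrite s_1// mulr1 mulr0 addr0.
  rewrite big1_seq ?addr0; first by rewrite mulr0 addr0 /f' !ndE// ltnW.
  move=> j /andP[_]; rewrite mem_iota => /andP[kj _].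
  by rewrite s_0// !mulr0 addr0.
rewrite skE.
have d1 : node k.+1 - node k < d.
  by rewrite /node -mulrBl -natrB// subSnn mul1r -div1r ltr_pdivrMr.
have e1 : `|U (node k) t - U x t| < e.
  apply: hd => //; [exact: node01 (ltnW kn)|by rewrite ltr_norml; apply/andP; split; lra|by rewrite subrr normr0].
have e2 : `|U (node k.+1) t - U x t| < e.
  apply: hd => //; [exact: node01|by rewrite ltr_norml; apply/andP; split; lra|by rewrite subrr normr0].
have /andP[h0 h1] : 0 <= s k x <= 1 by exact: step_bounds.
move: e1 e2; rewrite !ltr_norml ler_norml => /andP[p1 p2] /andP[q1 q2].
apply/andP; split; nra.
Qed.

Lemma crect_pint_cont T f : 0 < T -> continuous_rect T f ->
  {within `[0, 1], continuous (fun x => pint (f x) 0 T)}.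
Proof.
move=> T0 cf; apply: within_itv_cont => x x01 e e0.
have e20 : 0 < e / (2 * T) by rewrite divr_gt0 ?mulr_gt0.
have [d d0 hd] := rect_ucont cf e20.
exists d => // y y01 xy.
have ix : itg 0 T (f x) by apply: ccont_itg; exact: rect_cont_t.
have iy : itg 0 T (f y) by apply: ccont_itg; exact: rect_cont_t.
rewrite -pintB//; apply: le_lt_trans (pint_norm (itgB ix iy)) _.
apply: (@le_lt_trans _ _ (pint (fun=> e / (2 * T)) 0 T)).
  apply: le_pint; [exact: itg_abs (itgB ix iy)|exact: itg_cst|].
  by move=> t tT; apply: ltW; apply: hd => //; rewrite subrr normr0.
rewrite pint_cst ?ltW// subr0.
have -> : e / (2 * T) * T = e / 2 by field; rewrite gt_eqF.
by rewrite ltr_pdivrMr// ltr_pMr// ltr1n.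
Qed.

(** Take [v = - w + K * h] with [w] an approximate primitive in time of [V1] minus its mean. Where
    [b * h1] vanishes so does [b * wx], since [b] is zero or [x] is an end, where [wx] is zero; only
    the mean of [V1] remains there. Elsewhere a large [K] wins. *)
Lemma slow_supersolution T (b V1 : R -> R -> R) (h h1 h2 : R -> R) (L e : R) :
  0 < T -> continuous_rect T b -> continuous_rect T V1 ->
  (forall x : R, is_derive x 1 h (h1 x)) -> (forall x : R, is_derive x 1 h1 (h2 x)) ->
  continuous h2 -> h1 0 <= 0 -> 0 <= h1 1 ->
  (forall x t, rect T (x, t) -> b x t * h1 x <= 0) ->
  (forall x t, rect T (x, t) -> b x t * h1 x = 0 ->
     [\/ b x t = 0, x = 0 | x = 1] /\ L <= T^-1 * pint (V1 x) 0 T) ->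
  0 < e -> exists v vt vx vxx, [/\ smooth T v vt vx vxx,
    forall x, v x 0 = v x T,
    forall t, vx 0 t <= 0 /\ 0 <= vx 1 t &
    forall x t, rect T (x, t) -> L - e <= vt x t - b x t * vx x t + V1 x t].
Proof.
move=> T0 cb cV1 dh dh1 ch2 h10 h11 hsign hz e0.
pose U x t := V1 x t - T^-1 * pint (V1 x) 0 T.
have cU : continuous_rect T U.
  apply: crectB => //; apply: (crect_space (k := fun x => T^-1 * pint (V1 x) 0 T)).
  by apply: wcontZ; exact: crect_pint_cont.
have iV x : 0 <= x <= 1 -> itg 0 T (V1 x) by move=> x01; apply: ccont_itg; exact: rect_cont_t.
have pU x : 0 <= x <= 1 -> pint (U x) 0 T = 0.
  move=> x01; rewrite /U pintB ?pint_cst ?ltW//; [|exact: iV|exact: itg_cst].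
  by rewrite subr0; field; rewrite gt_eqF.
have e20 : 0 < e / 2 by rewrite divr_gt0.
have [w [wt [wx [wxx [Sw wper wbd wU]]]]] := zero_mean_primitive T0 cU pU e20.
pose F x t := - wt x t + b x t * wx x t + V1 x t.
pose H x t := - (b x t * h1 x).
have cF : continuous_rect T F.
  apply: crectD cV1; apply: crectD (crectM cb (smooth_cx Sw)).
  exact: crectN (smooth_ct Sw).
have cH : continuous_rect T H.
  apply: crectN; apply: crectM cb _; apply: (crect_space (k := h1)).
  by apply: continuous_subspaceT => x; exact: der_cont (dh1 x).
have H0 x t : rect T (x, t) -> 0 <= H x t by move=> xt; rewrite oppr_ge0 hsign.
have HF x t : rect T (x, t) -> H x t = 0 -> L - e / 2 <= F x t.
  move=> xt /eqP; rewrite oppr_eq0 => /eqP /(hz x t xt)[hb hL].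
  have bw : b x t * wx x t = 0.
    by case: hb => [->|->|->]; rewrite ?mul0r// ?(wbd t).1 ?(wbd t).2 mulr0.
  have := wU x t xt; rewrite /F bw ler_norml /U => /andP[]; lra.
have [K K0 hK] := penalisation cF cH H0 HF e20.
have S := smooth_add (smooth_scale (-1) Sw) (smooth_scale K (smooth_space T dh dh1 ch2)).
eexists; eexists; eexists; eexists; split; first exact: S.
- by move=> x /=; rewrite wper.
- move=> t /=; have [-> ->] := wbd t; rewrite !mulr0 !add0r; split.
    exact: mulr_ge0_le0.
  exact: mulr_ge0.
move=> x t xt /=; have := hK x t xt; rewrite /F /H; lra.
Qed.

(** For [rho > 0], a C^2 truncation of [s] up to an additive constant: slope 1 at [s = 0], zero from
    [s = rho] on. *)
Definition prof (rho s : R) := - (rho / 3) * pos (1 - rho^-1 * s) ^+ 3.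
Definition prof1 (rho s : R) := pos (1 - rho^-1 * s) ^+ 2.
Definition prof2 (rho s : R) := - (2 / rho) * pos (1 - rho^-1 * s).

Lemma der_prof (rho s : R) : rho != 0 -> is_derive s 1 (prof rho) (prof1 rho s).
Proof.
move=> r0.
have dI : is_derive s 1 (fun s => 1 - rho^-1 * s) (- rho^-1).
  by apply: der_eq (derB (der_cst s 1) (derZ rho^-1 (der_id s))) _; rewrite sub0r mulr1.
have dP := @der_comp _ (fun y => pos y ^+ 3) (fun s => 1 - rho^-1 * s) s _ _ (der_pos3 _) dI.
by apply: der_eq (derZ (- (rho / 3)) dP) _; rewrite /prof1; field.
Qed.

Lemma der_prof1 (rho s : R) : is_derive s 1 (prof1 rho) (prof2 rho s).
Proof.
have dI : is_derive s 1 (fun s => 1 - rho^-1 * s) (- rho^-1).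
  by apply: der_eq (derB (der_cst s 1) (derZ rho^-1 (der_id s))) _; rewrite sub0r mulr1.
have dP := @der_comp _ (fun y => pos y ^+ 2) (fun s => 1 - rho^-1 * s) s _ _ (der_pos2 _) dI.
by apply: der_eq dP _; rewrite /prof2; ring.
Qed.

Lemma continuous_prof2 (rho : R) : continuous (prof2 rho).
Proof.
move=> s; apply: cvgM; first exact: cvg_cst.
apply: (cvg_comp (fun s => 1 - rho^-1 * s) pos); last exact: continuous_pos.
apply: cvgB; first exact: cvg_cst.
by apply: cvgM; [exact: cvg_cst|exact: cvg_id].
Qed.

Lemma prof1_ge (rho s : R) : 0 < rho -> rho <= s -> prof1 rho s = 0 /\ prof2 rho s = 0.
Proof.
move=> r0 rs; rewrite /prof1 /prof2 pos_le0; first by rewrite expr0n /= mulr0.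
by rewrite subr_le0 mulrC ler_pdivlMr// mul1r.
Qed.

Lemma prof1_bounds (rho s : R) : 0 < rho -> 0 <= s -> 0 <= prof1 rho s <= 1.
Proof.
move=> r0 s0; rewrite /prof1 sqr_ge0 /= -[leRHS](expr1n _ 2).
have h : 0 <= rho^-1 * s by rewrite mulr_ge0// invr_ge0 ltW.
rewrite ler_pXn2r ?nnegrE ?pos_ge0//.
by rewrite /pos ge_max ler01 andbT lerBlDr lerDl.
Qed.

(** The surplus [de * a * y ^+ 2] and the cross term with [q] complete to a square, at a cost of
    order [D]. Truncation only helps, because [P1 ^+ 2 <= P1] weakens the negative quadratic
    term. *)
Lemma well_pointwise (D P1 a a' b y q C A de : R) : 0 < D -> 0 < de -> 0 < a -> a <= A ->
  0 <= P1 <= 1 -> `|q| <= C ->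
  (P1 != 0 -> de * a * y ^+ 2 <= - (a' * y ^+ 2) / 2 - a ^+ 2 * y ^+ 2 + a * b * y) ->
  let gt := (- (2 * D)^-1) * (P1 * (a' * y ^+ 2)) in
  let gx := (- (2 * D)^-1) * (P1 * (a * (2 * y))) in
  - (A * C ^+ 2 / de * D) <= gt - D * gx ^+ 2 - b * gx - 2 * D * gx * q.
Proof.
move=> D0 de0 a0 aA /andP[P0 P1le] qC hP /=.
have A0 : 0 < A by exact: lt_le_trans aA.
have [->|Pn] := eqVneq P1 0.
  rewrite !(mul0r, mulr0, expr0n, subr0) /= oppr_le0 mulr_ge0 ?(ltW D0)// divr_ge0 ?(ltW de0)//.
  by rewrite mulr_ge0 ?sqr_ge0// ltW.
have {}hP := hP Pn.
have -> : - (2 * D)^-1 * (P1 * (a' * y ^+ 2)) - D * (- (2 * D)^-1 * (P1 * (a * (2 * y)))) ^+ 2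
    - b * (- (2 * D)^-1 * (P1 * (a * (2 * y)))) - 2 * D * (- (2 * D)^-1 * (P1 * (a * (2 * y)))) * q
  = P1 / D * ((- (a' * y ^+ 2) / 2 - a ^+ 2 * y ^+ 2 + a * b * y - de * a * y ^+ 2)
       + (1 - P1) * (a * y) ^+ 2)
    + P1 * a * (de * y + D * q) ^+ 2 / (de * D) - P1 * a * q ^+ 2 / de * D.
  by field; rewrite !gt_eqF.
have t1 : 0 <= P1 / D * ((- (a' * y ^+ 2) / 2 - a ^+ 2 * y ^+ 2 + a * b * y - de * a * y ^+ 2)
       + (1 - P1) * (a * y) ^+ 2).
  apply: mulr_ge0; first by rewrite divr_ge0// ltW.
  by apply: addr_ge0; [rewrite subr_ge0|rewrite mulr_ge0 ?sqr_ge0// subr_ge0].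
have t2 : 0 <= P1 * a * (de * y + D * q) ^+ 2 / (de * D).
  apply: divr_ge0; last by rewrite mulr_ge0 ?(ltW D0)// ltW.
  by apply: mulr_ge0 (sqr_ge0 _); rewrite mulr_ge0// ltW.
have t3 : P1 * a * q ^+ 2 / de * D <= A * C ^+ 2 / de * D.
  rewrite ler_pM2r// ler_pM2r ?invr_gt0//; apply: ler_pM => //.
  - by rewrite mulr_ge0// ltW.
  - exact: sqr_ge0.
  - by rewrite -[A]mul1r; apply: ler_pM => //; exact: ltW.
  - rewrite -(real_normK (num_real q)) ler_pXn2r ?nnegrE//; exact: le_trans qC.
lra.
Qed.

(** At a given point at most one well is active, so the squared sum of slopes has no cross products;
    if none is, the expression is zero. *)
Lemma disjoint_sum (s : seq nat) (gt gx : nat -> R) (b D q K : R) : uniq s -> 0 <= K ->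
  (forall i j, i \in s -> j \in s -> i != j ->
     (gt i = 0 /\ gx i = 0) \/ (gt j = 0 /\ gx j = 0)) ->
  (forall i, i \in s -> - K <= gt i - D * gx i ^+ 2 - b * gx i - 2 * D * gx i * q) ->
  - K <= \sum_(i <- s) gt i - D * (\sum_(i <- s) gx i) ^+ 2 - b * (\sum_(i <- s) gx i)
     - 2 * D * (\sum_(i <- s) gx i) * q.
Proof.
move=> us K0 dis hK.
have [/hasP[i is_ inz]|/hasPn allz] := boolP (has (fun i => (gt i != 0) || (gx i != 0)) s).
  have oz j : j \in s -> j != i -> gt j = 0 /\ gx j = 0.
    move=> js ji; case: (dis j i js is_ ji) => // -[h1 h2].
    by move: inz; rewrite h1 h2 eqxx.
  have E f : (forall j, j \in s -> j != i -> f j = 0) -> \sum_(j <- s) f j = f i :> R.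
    move=> hf; rewrite (bigD1_seq i)//= big1_seq ?addr0//.
    by move=> j /andP[ji js]; exact: hf.
  rewrite (E gt) ?(E gx)//; last 2 first.
  - by move=> j js ji; have [] := oz j js ji.
  - by move=> j js ji; have [] := oz j js ji.
  exact: hK.
have z1 j : j \in s -> gt j = 0.
  by move=> /allz; rewrite negb_or !negbK => /andP[/eqP].
have z2 j : j \in s -> gx j = 0.
  by move=> /allz; rewrite negb_or !negbK => /andP[_ /eqP].
rewrite !big1_seq; [|by move=> j /andP[_ /z2]|by move=> j /andP[_ /z1]].
by rewrite expr0n /= !(mulr0, mul0r, subr0) oppr_le0.
Qed.

End LowerTools.

(** * The supersolution assembled from wells, a gauge and a slow part *)

Section LowerBound.
Context {R : realType}.
Variables (T : R) (m V : R -> R -> R) (lambda : R -> R).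
Hypotheses (T0 : 0 < T) (cb : continuous_rect T (dx m)) (cV : continuous_rect T V).
Hypothesis Hlam : forall D, 0 < D -> principal_eigenvalue T D m V (lambda D).

Variables (s : seq nat) (xx rho : nat -> R) (a a' : nat -> R -> R) (A de : R).
Hypothesis us : uniq s.
Hypothesis ca : forall i, i \in s -> {within `[0, T], continuous (a i)}.
Hypothesis ca' : forall i, i \in s -> {within `[0, T], continuous (a' i)}.
Hypothesis da : forall i t, i \in s -> 0 < t < T -> is_derive t 1 (a i) (a' i t).
Hypothesis aper : forall i, i \in s -> a i 0 = a i T.
Hypothesis a0 : forall i t, i \in s -> 0 <= t <= T -> 0 < a i t <= A.
Hypothesis rho0 : forall i, i \in s -> 0 < rho i.
Hypothesis A0 : 0 < A.
Hypothesis de0 : 0 < de.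
(** The right side is [D] times [g_t - D * g_x ^+ 2 - b * g_x] for the untruncated well
    [g = - a * y ^+ 2 / (2 * D)]; its surplus is spent on the cross term. *)
Hypothesis margin : forall i x t, i \in s -> rect T (x, t) ->
  a i t * (x - xx i) ^+ 2 < rho i ->
  de * a i t * (x - xx i) ^+ 2 <= - (a' i t * (x - xx i) ^+ 2) / 2
     - a i t ^+ 2 * (x - xx i) ^+ 2 + a i t * dx m x t * (x - xx i).
(** A well is either centred at the end or switched off there; both give it slope zero at the
    end. *)
Hypothesis bd0 : forall i t, i \in s -> 0 <= t <= T ->
  xx i = 0 \/ rho i <= a i t * (0 - xx i) ^+ 2.
Hypothesis bd1 : forall i t, i \in s -> 0 <= t <= T ->
  xx i = 1 \/ rho i <= a i t * (1 - xx i) ^+ 2.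
Hypothesis disj : forall i j x t, i \in s -> j \in s -> i != j -> rect T (x, t) ->
  rho i <= a i t * (x - xx i) ^+ 2 \/ rho j <= a j t * (x - xx j) ^+ 2.

(* The value of - D g_xx for g = - prof (rho i) (a i t (x - xx i)^2) / (2 D). *)
Definition wellV i x t := (prof2 (rho i) (a i t * (x - xx i) ^+ 2) * (a i t * (2 * (x - xx i))) ^+ 2
  + prof1 (rho i) (a i t * (x - xx i) ^+ 2) * (a i t * 2)) / 2.

Lemma wellV_cont i : i \in s -> continuous_rect T (wellV i).
Proof.
move=> is_.
have S := smooth_comp_quad (xx i) (ca is_) (ca' is_) (fun t tT => da is_ tT)
  (fun z => der_prof z (lt0r_neq0 (rho0 is_))) (der_prof1 (rho i)) (@continuous_prof2 R (rho i)).
have h := smooth_cxx S.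
by apply: crectM h _; exact: crect_cst.
Qed.

Lemma sum_cont (f : nat -> R -> R -> R) : (forall i, i \in s -> continuous_rect T (f i)) ->
  continuous_rect T (fun x t => \sum_(i <- s) f i x t).
Proof.
elim: s => [_|i r IH H].
  have -> : (fun x t => \sum_(i <- [::]) f i x t) = (fun _ _ => 0).
    by apply/funext => x; apply/funext => t; rewrite big_nil.
  exact: crect_cst.
have -> : (fun x t => \sum_(j <- i :: r) f j x t) = (fun x t => f i x t + \sum_(j <- r) f j x t).
  by apply/funext => x; apply/funext => t; rewrite big_cons.
apply: crectD; first by apply: H; rewrite mem_head.
by apply: IH => j jr; apply: H; rewrite in_cons jr orbT.
Qed.

(** The logarithm of the supersolution is the sum of the wells, [g] and a slow part. The order-one
    effects of the first two, [wellV] and [- dx m * g1], enter the potential before averaging, so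
    [L] is compared with means at the zeros of [dx m * h1] only. *)
Lemma lower_bound (g g1 g2 h h1 h2 : R -> R) (L : R) :
  (forall x : R, is_derive x 1 g (g1 x)) -> (forall x : R, is_derive x 1 g1 (g2 x)) -> continuous g2 ->
  g1 0 <= 0 -> 0 <= g1 1 ->
  (forall x : R, is_derive x 1 h (h1 x)) -> (forall x : R, is_derive x 1 h1 (h2 x)) -> continuous h2 ->
  h1 0 <= 0 -> 0 <= h1 1 ->
  (forall x t, rect T (x, t) -> dx m x t * h1 x <= 0) ->
  (forall x t, rect T (x, t) -> dx m x t * h1 x = 0 ->
     [\/ dx m x t = 0, x = 0 | x = 1] /\
     L <= T^-1 * pint (fun t => V x t + \sum_(i <- s) wellV i x t - dx m x t * g1 x) 0 T) ->
  forall e : R, 0 < e -> exists2 D0 : R, 0 < D0 & forall D, 0 < D -> D < D0 -> L - e <= lambda D.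
Proof.
move=> dg dg1 cg2 g10 g11 dh dh1 ch2 h10 h11 hsign hz e e0.
have cg1r : continuous_rect T (fun x _ => g1 x).
  by apply: crect_space; apply: continuous_subspaceT => x; exact: der_cont (dg1 x).
have cV1 : continuous_rect T (fun x t => V x t + \sum_(i <- s) wellV i x t - dx m x t * g1 x).
  apply: crectB; last exact: crectM.
  by apply: crectD => //; apply: sum_cont => i; exact: wellV_cont.
have e20 : 0 < e / 2 by rewrite divr_gt0.
have [v [vt [vx [vxx [Sv vper vbd vineq]]]]] :=
  slow_supersolution T0 cb cV1 dh dh1 ch2 h10 h11 hsign hz e20.
have [C C0 hC] := rect_bounded (crectD cg1r (smooth_cx Sv)).
have cg2r : continuous_rect T (fun x _ => g2 x).
  by apply: crect_space; exact: continuous_subspaceT.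
have [C2 C20 hC2] := rect_bounded (crectD cg2r (smooth_cxx Sv)).
(* The errors of order [D]: [K] from the wells, [C ^+ 2] from the squared slope of the bounded part,
   [C2] from its second derivative. *)
pose K := A * C ^+ 2 / de.
have K0 : 0 <= K by rewrite divr_ge0 ?(ltW de0)// mulr_ge0 ?sqr_ge0// ltW.
pose M := K + C2 + C ^+ 2 + 1.
have M0 : 0 < M by rewrite ltr_wpDl// !addr_ge0 ?sqr_ge0// ltW.
exists (e / 2 / M); first by rewrite divr_gt0.
move=> D Dp; rewrite ltr_pdivlMr// => DM.
have [phi [ephi _ _] phi0] := Hlam Dp.
have [sphi _] := ephi.
have SW i : i \in s -> _ := fun is_ => smooth_scale (- (2 * D)^-1)
  (smooth_comp_quad (xx i) (ca is_) (ca' is_) (fun t tT => da is_ tT)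
  (fun z => der_prof z (lt0r_neq0 (rho0 is_))) (der_prof1 (rho i)) (@continuous_prof2 R (rho i))).
have S := smooth_add (smooth_sum SW) (smooth_add (smooth_space T dg dg1 cg2) Sv).
apply: (supersolution_ge T0 Dp cb sphi phi0 S).
- move=> x _; rewrite vper; congr (_ + _).
  by apply: eq_big_seq => i is_; rewrite aper.
- move=> t tT; have [v0 v1] := vbd t; split.
    rewrite big1_seq; first by rewrite add0r; lra.
    move=> i /andP[_ is_].
    case: (bd0 is_ tT) => [->|hh]; first by rewrite subrr !(mulr0, mul0r).
    by rewrite (prof1_ge (rho0 is_) hh).1 !(mulr0, mul0r).
  rewrite big1_seq; first by rewrite add0r; lra.
  move=> i /andP[_ is_].
  case: (bd1 is_ tT) => [->|hh]; first by rewrite subrr !(mulr0, mul0r).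
  by rewrite (prof1_ge (rho0 is_) hh).1 !(mulr0, mul0r).
move=> x t xt; have [x01 tT] := (rectE T x t).1 xt.
set b := dx m x t; set q := g1 x + vx x t.
pose gt i := - (2 * D)^-1 * (prof1 (rho i) (a i t * (x - xx i) ^+ 2) * (a' i t * (x - xx i) ^+ 2)).
pose gx i := - (2 * D)^-1 * (prof1 (rho i) (a i t * (x - xx i) ^+ 2) * (a i t * (2 * (x - xx i)))).
have qC : `|q| <= C by exact: hC.
have hsum : - (K * D) <= \sum_(i <- s) gt i - D * (\sum_(i <- s) gx i) ^+ 2 - b * (\sum_(i <- s) gx i)
     - 2 * D * (\sum_(i <- s) gx i) * q.
  apply: disjoint_sum => //; first by rewrite mulr_ge0// ltW.
    move=> i j is_ js ij; case: (disj is_ js ij xt) => hh; [left|right].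
      by rewrite /gt /gx (prof1_ge (rho0 is_) hh).1 !(mulr0, mul0r).
    by rewrite /gt /gx (prof1_ge (rho0 js) hh).1 !(mulr0, mul0r).
  move=> i is_; have /andP[ai0 aiA] := a0 is_ tT.
  apply: well_pointwise => //.
    by apply: prof1_bounds; [exact: rho0|rewrite mulr_ge0 ?sqr_ge0// ltW].
  move=> P1n; apply: margin => //; rewrite ltNge; apply/negP => hh.
  by move: P1n; rewrite (prof1_ge (rho0 is_) hh).1 eqxx.
pose gxx i := - (2 * D)^-1 * (prof2 (rho i) (a i t * (x - xx i) ^+ 2) *
     (a i t * (2 * (x - xx i))) ^+ 2 + prof1 (rho i) (a i t * (x - xx i) ^+ 2) * (a i t * 2)).
have hW : D * (\sum_(i <- s) gxx i) = - \sum_(i <- s) wellV i x t.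
  rewrite mulr_sumr -sumrN; apply: eq_bigr => i _; rewrite /gxx /wellV.
  by field; rewrite gt_eqF.
have hv := vineq x t xt; have h2C := hC2 x t xt.
have q2 : q ^+ 2 <= C ^+ 2 by rewrite -(real_normK (num_real q)) ler_pXn2r ?nnegrE// ltW.
move: h2C; rewrite ler_norml => /andP[_ h2C].
have Dq2 := ler_wpM2l (ltW Dp) q2; have Dh2 := ler_wpM2l (ltW Dp) h2C.
change (L - e <= \sum_(i <- s) gt i + (0 + vt x t) - D * (\sum_(i <- s) gxx i + (g2 x + vxx x t))
  - D * (\sum_(i <- s) gx i + q) ^+ 2 - b * (\sum_(i <- s) gx i + q) + V x t).
move: hv hsum hW Dq2 Dh2 DM; rewrite -/b /M.
move: (\sum_(i <- s) gt i) (\sum_(i <- s) gx i) (\sum_(i <- s) gxx i) (\sum_(i <- s) wellV i x t).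
move=> G1 G2 G3 G4; have -> : b * (G2 + q) = b * G2 + b * g1 x + b * vx x t by rewrite /q; ring.
clearbody q b; move: (V x t) (vt x t) (vx x t) (vxx x t) (g1 x) (g2 x) => r1 r2 r3 r4 r5 r6.
clear - Dp K0 C20.
move=> *; lra.
Qed.

End LowerBound.

(** * Averages in time *)

Section HatDerivative.
Context {R : realType}.
Implicit Types (T : R) (f : R -> R -> R).

Lemma C10_mvt T f x y t : C10 T f -> 0 <= x <= 1 -> 0 <= y <= 1 -> 0 <= t <= T ->
  exists2 c : R, 0 <= c <= 1 /\ `|c - x| <= `|y - x| & f y t - f x t = dx f c t * (y - x).
Proof.
move=> Cf; have [cf df cdf] := Cf.
have H (p q : R) : p <= q -> 0 <= p -> q <= 1 -> 0 <= t <= T ->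
    exists2 c : R, p <= c <= q & f q t - f p t = dx f c t * (q - p).
  move=> pq p0 q1 tT.
  have ct : {within `[p, q], continuous (f^~ t)}.
    apply: continuous_subspaceW (rect_cont_x tT cf).
    by apply: subset_itv; rewrite bnd_simp.
  have dt z : z \in `]p, q[ -> is_derive z 1 (f^~ t) (dx f z t).
    rewrite in_itv/= => /andP[pz zq]; apply: derivable_in_is_derive; first by apply/andP; split; lra.
    by apply: df; apply/rectE; split => //; apply/andP; split; lra.
  have [c + E] := MVT_segment pq dt ct.
  by rewrite in_itv/= => cpq; exists c.
move=> /andP[x0 x1] /andP[y0 y1] tT; case: (lerP x y) => xy.
  have [c /andP[c1 c2] E] := H x y xy x0 y1 tT.
  exists c => //; split; first by apply/andP; split; lra.
  by rewrite !ger0_norm; lra.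
have [c /andP[c1 c2] E] := H y x (ltW xy) y0 x1 tT.
exists c; last by rewrite -opprB E -mulrN opprB.
split; first by apply/andP; split; lra.
by rewrite !ler0_norm; lra.
Qed.

(** The factor [x - x0] turns the first-order expansion into a comparison of quadratics, valid on
    both sides of [x0] and at the ends of [[0, 1]]. *)
Lemma taylor T f x0 : C10 T f -> 0 <= x0 <= 1 -> (forall t, 0 <= t <= T -> f x0 t = 0) ->
  forall de : R, 0 < de -> exists2 r : R, 0 < r & forall x t, rect T (x, t) -> `|x - x0| <= r ->
    `|f x t * (x - x0) - dx f x0 t * (x - x0) ^+ 2| <= de * (x - x0) ^+ 2.
Proof.
move=> Cf x01 f0 de de0; have [_ _ cdf] := Cf.
have [d d0 hd] := rect_ucont cdf de0.
exists (d / 2); first by rewrite divr_gt0.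
move=> x t /rectE[x01' tT] hx.
have [c [c01 cx] E] := C10_mvt Cf x01 x01' tT.
have -> : f x t = dx f c t * (x - x0) by rewrite -E f0// subr0.
have -> : dx f c t * (x - x0) * (x - x0) - dx f x0 t * (x - x0) ^+ 2 =
  (dx f c t - dx f x0 t) * (x - x0) ^+ 2 by ring.
rewrite normrM [X in _ * X]ger0_norm ?sqr_ge0//.
apply: ler_wpM2r; first exact: sqr_ge0.
apply: ltW; apply: hd => //; last by rewrite subrr normr0.
apply: le_lt_trans cx _; apply: le_lt_trans hx _.
by rewrite ltr_pdivrMr// ltr_pMr// ltr1n.
Qed.

(** Each point of [[0, 1]], ends included, is a limit of other points of it; this makes the limit in
    [deriv_in] unique. *)
Lemma within01_proper (x : R) : 0 <= x <= 1 -> ProperFilter (within `[0, 1] x^').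
Proof.
move=> /andP[x0 x1]; apply: Build_ProperFilter_ex => P.
rewrite /within /= => -[e /= e0 he].
have [y [y01 yx ye]] : exists y : R, [/\ 0 <= y <= 1, y != x & `|x - y| < e].
  pose d := Num.min (e / 2) (1 / 2).
  have d0 : 0 < d by rewrite lt_min !divr_gt0.
  have de : d < e.
    by rewrite gt_min; apply/orP; left; rewrite ltr_pdivrMr// ltr_pMr// ltr1n.
  have d2 : d <= 1 / 2 by rewrite ge_min lexx orbT.
  case: (lerP x (1 / 2)) => h.
    exists (x + d); split; first by apply/andP; split; lra.
      by rewrite gt_eqF// ltrDl.
    by rewrite ltr_norml; apply/andP; split; lra.
  exists (x - d); split; first by apply/andP; split; lra.
    by rewrite lt_eqF// ltrBlDr ltrDl.
  by rewrite ltr_norml; apply/andP; split; lra.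
by exists y; apply: (he y ye yx); rewrite in_itv.
Qed.

Lemma deriv_inP (f : R -> R) (x l : R) : 0 <= x <= 1 ->
  (forall e : R, 0 < e -> exists2 d : R, 0 < d & forall y, 0 <= y <= 1 -> y != x -> `|y - x| < d ->
     `|(f y - f x) / (y - x) - l| <= e) -> deriv_in `[0, 1] f x = l.
Proof.
move=> x01 H; have PF := within01_proper x01.
apply/cvg_lim => //; apply/cvgrPdist_le => e e0.
have [d d0 hd] := H e e0.
rewrite /within /=; exists d => //= y xy yx y01.
by rewrite distrC; apply: hd => //; rewrite distrC.
Qed.

(** Differentiation under the integral: by the mean value theorem the difference quotient is [dx f]
    at a nearby point, so uniform continuity bounds the error for all times at once. Applied twice
    it expresses [dxx_hat] by averages of the drift and of its slope. *)
Lemma deriv_hat T f x : 0 < T -> C10 T f -> 0 <= x <= 1 ->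
  deriv_in `[0, 1] (hat T f) x = hat T (dx f) x.
Proof.
move=> T0 Cf x01; have [cf df cdf] := Cf.
apply: deriv_inP => // e e0.
have [d d0 hd] := rect_ucont cdf e0.
exists d => // y y01 yx yxd.
have yx0 : y - x != 0 by rewrite subr_eq0.
have ifx z : 0 <= z <= 1 -> itg 0 T (f z) by move=> z01; apply: ccont_itg; exact: rect_cont_t.
have idx z : 0 <= z <= 1 -> itg 0 T (dx f z) by move=> z01; apply: ccont_itg; exact: rect_cont_t.
rewrite !hatE.
have -> : (T^-1 * pint (f y) 0 T - T^-1 * pint (f x) 0 T) / (y - x) - T^-1 * pint (dx f x) 0 T
  = T^-1 * pint (fun t => (y - x)^-1 * (f y t - f x t) - dx f x t) 0 T.
  rewrite pintB; [|by apply: itgZ; apply: itgB; exact: ifx|exact: idx].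
  rewrite pintZ; last by apply: itgB; exact: ifx.
  rewrite pintB; [|exact: ifx|exact: ifx].
  by field; rewrite (gt_eqF T0) yx0.
have ii : itg 0 T (fun t => (y - x)^-1 * (f y t - f x t) - dx f x t).
  by apply: itgB; [apply: itgZ; apply: itgB; exact: ifx|exact: idx].
rewrite normrM gtr0_norm ?invr_gt0// mulrC ler_pdivrMr//.
apply: le_trans (pint_norm ii) _.
have -> : e * T = pint (fun=> e) 0 T by rewrite pint_cst ?subr0 ?ltW.
apply: le_pint; [exact: itg_abs|exact: itg_cst|].
move=> t tT; have [c [c01 cx] E] := C10_mvt Cf x01 y01 tT.
rewrite E mulrCA mulVf// mulr1 ltW//; apply: hd => //; last by rewrite subrr normr0.
exact: le_lt_trans cx yxd.
Qed.

Lemma deriv_in_eq (f g : R -> R) (x : R) : 0 <= x <= 1 ->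
  (forall y, 0 <= y <= 1 -> f y = g y) -> deriv_in `[0, 1] f x = deriv_in `[0, 1] g x.
Proof.
move=> x01 fg; rewrite /deriv_in.
have -> // : diff_quot f x y @[y --> within `[0, 1] x^'] = diff_quot g x y @[y --> within `[0, 1] x^'].
have E y : y \in `[0, 1] -> diff_quot f x y = diff_quot g x y.
  by rewrite in_itv/= => y01; rewrite /diff_quot !fg.
by apply/seteqP; split => A; rewrite /fmap /= /within /= => -[e e0 he]; exists e => //= y xy yx y01;
  have := he y xy yx y01; rewrite /= E.
Qed.

Lemma pint_gt0 T (f : R -> R) t0 : {within `[0, T], continuous f} ->
  (forall t, 0 <= t <= T -> 0 <= f t) -> 0 <= t0 <= T -> 0 < T -> 0 < f t0 -> 0 < pint f 0 T.
Proof.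
move=> cf f0 t0T T0 ft0.
have e0 : 0 < f t0 / 2 by rewrite divr_gt0.
have [d d0 hd] := itv_ucont cf e0.
pose t1 := Num.max 0 (t0 - d / 2); pose t2 := Num.min T (t0 + d / 2).
have t12 : t1 < t2 by rewrite /t1 /t2 gt_max !lt_min; apply/andP; split; apply/andP; split; lra.
have t10 : 0 <= t1 by rewrite le_max lexx.
have t2T : t2 <= T by rewrite ge_min lexx.
have fi := ccont_itg cf.
rewrite (pint_split fi t10 (le_trans (ltW t12) t2T)).
have fi1 := itgS fi t10 (lexx T).
rewrite (pint_split fi1 (ltW t12) t2T).
have p1 : 0 <= pint f 0 t1.
  by apply: pint_ge0 => t /andP[a1 a2]; apply: f0; apply/andP; split; lra.
have p3 : 0 <= pint f t2 T.
  by apply: pint_ge0 => t /andP[a1 a2]; apply: f0; apply/andP; split; lra.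
have p2 : f t0 / 2 * (t2 - t1) <= pint f t1 t2.
  rewrite -pint_cst; last exact: ltW.
  apply: le_pint; [exact: itg_cst|exact: itgS fi1 (lexx _) t2T|].
  move=> t /andP[a1 a2].
  have : `|f t0 - f t| < f t0 / 2.
    apply: hd => //; first by apply/andP; split; lra.
    move: a1 a2; rewrite /t1 /t2 ge_max le_min => /andP[_ b1] /andP[_ b2].
    by rewrite ltr_norml; apply/andP; split; lra.
  rewrite ltr_norml => /andP[]; lra.
have : 0 < f t0 / 2 * (t2 - t1) by rewrite mulr_gt0// subr_gt0.
lra.
Qed.

Lemma bigmin_leq (I : eqType) (s : seq I) (P : pred I) (F : I -> \bar R) i : i \in s -> P i ->
  (\big[mine/+oo%E]_(j <- s | P j) F j <= F i)%E.
Proof.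
elim: s => // j s IH; rewrite in_cons big_cons => /orP[/eqP <- ->|is_ Pi].
  by rewrite ge_min lexx.
by case: ifP => _; rewrite ?ge_min IH ?orbT.
Qed.

Lemma bigmin_attained (I : eqType) (s : seq I) (P : pred I) (F : I -> \bar R) :
  \big[mine/+oo%E]_(j <- s | P j) F j = +oo%E \/
  exists i, [/\ i \in s, P i & \big[mine/+oo%E]_(j <- s | P j) F j = F i].
Proof.
elim: s => [|j s IH]; first by left; rewrite big_nil.
rewrite big_cons; case: ifP => Pj; last first.
  case: IH => [->|[i [is_ Pi ->]]]; [by left|right].
  by exists i; rewrite in_cons is_ orbT.
case: (leP (F j) (\big[mine/+oo%E]_(j <- s | P j) F j)) => h.
  by right; exists j; rewrite mem_head; split.
case: IH => [E|[i [is_ Pi E]]]; rewrite E; [by left|right].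
by exists i; rewrite in_cons is_ orbT.
Qed.

Lemma finite_pos_min (s : seq nat) (f : nat -> R) : (forall i, i \in s -> 0 < f i) ->
  exists2 d : R, 0 < d & forall i, i \in s -> d <= f i.
Proof.
elim: s => [_|i s IH H]; first by exists 1.
have [d d0 hd] := IH (fun j js => H j (mem_behead (s := i :: s) js)).
exists (Num.min d (f i)); first by rewrite lt_min d0 H// mem_head.
move=> j; rewrite in_cons => /orP[/eqP ->|/hd h]; rewrite ge_min ?lexx ?orbT//.
by rewrite h.
Qed.

End HatDerivative.

(** * The limit *)

Section Assembly.
Context {R : realType}.
Variables (T : R) (hT : 0 < T) (m V : R -> R -> R).
Hypotheses (hm : C21 T m) (hV : continuous_rect T V).
Variables (N : nat) (kappa : nat -> R).
Hypotheses (hN : (1 <= N)%N) (hk0 : kappa 0%N = 0) (hk1 : kappa N.+1 = 1).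
Hypothesis hkS : forall i, (i <= N)%N -> kappa i < kappa i.+1.
Hypothesis hcrit : forall i, (1 <= i <= N)%N -> forall t, t \in `[0, T] -> dx m (kappa i) t = 0.
Hypothesis hAB : [set i | (i <= N)%N] = setA T m N kappa `|` setB T m N kappa.
Variable lambda : R -> R.
Hypothesis hlambda : forall D, 0 < D -> principal_eigenvalue T D m V (lambda D).

Let Cm : C10 T m. Proof. by case: hm. Qed.
Let Cb : C10 T (dx m). Proof. by case: hm. Qed.
Let cb : continuous_rect T (dx m). Proof. by case: Cb. Qed.
Let cbx : continuous_rect T (dx (dx m)). Proof. by case: Cb. Qed.

(** * The nodes, and the sign of the drift between them *)

Lemma kappa_lt i j : (i < j)%N -> (j <= N.+1)%N -> kappa i < kappa j.
Proof.
elim: j => // j IH; rewrite ltnS leq_eqVlt => /orP[/eqP -> jN|ij jN]; first exact: hkS.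
exact: lt_trans (IH ij (ltnW jN)) (hkS jN).
Qed.

Lemma kappa_le i j : (i <= j)%N -> (j <= N.+1)%N -> kappa i <= kappa j.
Proof. by rewrite leq_eqVlt => /orP[/eqP -> //|ij jN]; rewrite ltW// kappa_lt. Qed.

Lemma kappa01 i : (i <= N.+1)%N -> 0 <= kappa i <= 1.
Proof. by move=> iN; apply/andP; split; [rewrite -hk0|rewrite -hk1]; apply: kappa_le. Qed.

Lemma kappa_cover x : 0 <= x <= 1 -> exists2 i, (i <= N)%N & kappa i <= x <= kappa i.+1.
Proof.
move=> /andP[x0 x1].
have H n : (n <= N.+1)%N -> x <= kappa n -> (0 < n)%N ->
    exists2 i, (i < n)%N & kappa i <= x <= kappa i.+1.
  elim: n => // n IH nN xn _; case: (lerP (kappa n) x) => h; first by exists n; rewrite ?h.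
  case: n IH nN xn h => [|n] IH nN xn h; first by move: h; rewrite hk0 ltNge x0.
  have [i in_ hi] := IH (ltnW nN) (ltW h) isT.
  by exists i => //; exact: ltnW.
have := H N.+1 (leqnn _); rewrite hk1 => /(_ x1 isT)[i iN hi].
by exists i.
Qed.

Lemma kappa_gap : exists2 l : R, 0 < l & forall i j, (i < j)%N -> (j <= N.+1)%N -> l <= kappa j - kappa i.
Proof.
have [l l0 hl] := @finite_pos_min R (iota 0 N.+1) (fun i => kappa i.+1 - kappa i)
  (fun i h => ltac:(by move: h; rewrite mem_iota add0n ltnS subr_gt0 => /andP[_ /hkS])).
exists l => // i j ij jN.
have iN : (i <= N)%N by rewrite -ltnS (leq_trans ij).
apply: le_trans (hl i _) _; first by rewrite mem_iota add0n ltnS.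
by rewrite lerD2r kappa_le.
Qed.

Lemma closed_ge0 (f : R -> R) (p q : R) : p < q -> {within `[p, q], continuous f} ->
  (forall x, p < x < q -> 0 < f x) -> forall x, p <= x <= q -> 0 <= f x.
Proof.
move=> pq cf f0 x xpq; rewrite leNgt; apply/negP => fx.
have e0 : 0 < - f x by rewrite oppr_gt0.
have [d d0 hd] := itv_ucont cf e0.
pose eta := Num.min (1 / 2) (d / (2 * (q - p))).
have qp : 0 < q - p by rewrite subr_gt0.
have eta0 : 0 < eta by rewrite lt_min !divr_gt0// mulr_gt0.
have eta1 : eta <= 1 / 2 by rewrite ge_min lexx.
have eta2 : eta * (q - p) < d.
  rewrite -ltr_pdivlMr// gt_min; apply/orP; right.
  by rewrite ltr_pM2l// ltf_pV2 ?posrE ?mulr_gt0// ltr_pMl// ltr1n.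
have [xp xq] := andP xpq.
(* A small move towards the midpoint reaches the open interval while staying within [d] of [x]. *)
pose y := x + eta * ((p + q) / 2 - x).
have y1 : p < y by rewrite /y; nra.
have y2 : y < q by rewrite /y; nra.
have hy : `|x - y| < d.
  rewrite /y opprD addrA subrr add0r normrN normrM gtr0_norm//.
  apply: le_lt_trans eta2; rewrite ler_pM2l// ler_norml; apply/andP; split; lra.
have := hd x y xpq _ hy; rewrite (ltW y1) (ltW y2) => /(_ isT).
have := f0 y; rewrite y1 y2 => /(_ isT) fy.
rewrite ltr_norml => /andP[]; lra.
Qed.

(** Two points are joined by a segment in time followed by one in space, with the intermediate value
    theorem on each; the sign is then read at the midpoint at time 0. *)
Lemma constant_sign (p q : R) : 0 <= p -> p < q -> q <= 1 ->
  (forall x t, p < x < q -> 0 <= t <= T -> dx m x t != 0) ->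
  exists2 sg : R, sg = 1 \/ sg = -1 & forall x t, p < x < q -> 0 <= t <= T -> 0 < sg * dx m x t.
Proof.
move=> p0 pq q1 nz.
have key x1 t1 x2 t2 : p < x1 < q -> p < x2 < q -> 0 <= t1 <= T -> 0 <= t2 <= T ->
    0 < dx m x1 t1 -> 0 < dx m x2 t2.
  move=> hx1 hx2 ht1 ht2 pos1.
  have x101 : 0 <= x1 <= 1 by case/andP: hx1 => *; apply/andP; split; lra.
  have pos2 : 0 < dx m x1 t2.
    rewrite lt_neqAle eq_sym nz//= leNgt; apply/negP => neg.
    have sub u v : 0 <= u -> u <= v -> v <= T -> {within `[u, v], continuous (dx m x1)}.
      move=> u0 uv vT; apply: continuous_subspaceW (rect_cont_t x101 cb).
      by apply: subset_itv; rewrite bnd_simp.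
    have [/andP[t10 t1T] /andP[t20 t2T]] := (ht1, ht2).
    case: (lerP t1 t2) => h.
      have [|c] := @IVT _ _ _ _ 0 h (sub _ _ t10 h t2T).
        by rewrite ge_min (ltW neg) orbT le_max (ltW pos1).
      rewrite in_itv/= => /andP[c1 c2] /eqP; apply/negP; apply: nz => //.
      by apply/andP; split; lra.
    have [|c] := @IVT _ _ _ _ 0 (ltW h) (sub _ _ t20 (ltW h) t1T).
      by rewrite ge_min (ltW neg) le_max (ltW pos1) orbT.
    rewrite in_itv/= => /andP[c1 c2] /eqP; apply/negP; apply: nz => //.
    by apply/andP; split; lra.
  rewrite lt_neqAle eq_sym nz//= leNgt; apply/negP => neg.
  have sub u v : 0 <= u -> u <= v -> v <= 1 -> {within `[u, v], continuous (dx m ^~ t2)}.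
    move=> u0 uv v1; apply: continuous_subspaceW (rect_cont_x ht2 cb).
    by apply: subset_itv; rewrite bnd_simp.
  have [/andP[a1 a2] /andP[a3 a4]] := (hx1, hx2).
  have [p10 p20] : 0 <= x1 /\ 0 <= x2 by split; lra.
  have [p11 p21] : x1 <= 1 /\ x2 <= 1 by split; lra.
  case: (lerP x1 x2) => h.
    have [|c] := @IVT _ _ _ _ 0 h (sub _ _ p10 h p21).
      by rewrite ge_min (ltW neg) orbT le_max (ltW pos2).
    rewrite in_itv/= => /andP[c1 c2] /eqP; apply/negP; apply: nz => //.
    by apply/andP; split; lra.
  have [|c] := @IVT _ _ _ _ 0 (ltW h) (sub _ _ p20 (ltW h) p11).
    by rewrite ge_min (ltW neg) le_max (ltW pos2) orbT.
  rewrite in_itv/= => /andP[c1 c2] /eqP; apply/negP; apply: nz => //.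
  by apply/andP; split; lra.
pose mid := (p + q) / 2.
have hmid : p < mid < q by apply/andP; split; rewrite /mid; lra.
have h0T : (0:R) <= 0 <= T by apply/andP; split => //; exact: ltW.
case: (ltrgt0P (dx m mid 0)) => h.
- exists 1; first by left.
  by move=> x t hx ht; rewrite mul1r; exact: key h.
- exists (-1); first by right.
  move=> x t hx ht; rewrite mulN1r oppr_gt0 lt_neqAle nz//= leNgt; apply/negP => h'.
  by have := key x t mid 0 hx hmid ht h0T h'; rewrite ltNge (ltW h).
- by have := nz mid 0 hmid h0T; rewrite h eqxx.
Qed.

(* tau i is the sign of the drift on the i-th interval, 0 encoding membership
   in B. *)
Definition drift_sign (tau : nat -> R) := forall i, (i <= N)%N ->
  [/\ forall x t, kappa i <= x <= kappa i.+1 -> 0 <= t <= T -> 0 <= tau i * dx m x t,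
      tau i != 0 -> (tau i = 1 \/ tau i = -1) /\
        forall x t, kappa i < x < kappa i.+1 -> 0 <= t <= T -> dx m x t != 0 &
      tau i = 0 -> setB T m N kappa i].

Lemma drift_sign_exists : exists tau, drift_sign tau.
Proof.
have H i : exists ti : R, (i <= N)%N -> [/\ forall x t, kappa i <= x <= kappa i.+1 -> 0 <= t <= T -> 0 <= ti * dx m x t,
      ti != 0 -> (ti = 1 \/ ti = -1) /\
        forall x t, kappa i < x < kappa i.+1 -> 0 <= t <= T -> dx m x t != 0 &
      ti = 0 -> setB T m N kappa i].
  case: (leqP i N) => iN; last by exists 0.
  have : [set i | (i <= N)%N] i by [].
  rewrite hAB => -[[_ iA]|iB]; last first.
    exists 0 => _; split => //; last by rewrite eqxx.
    by move=> x t _ _; rewrite mul0r.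
  have nz x t : kappa i < x < kappa i.+1 -> 0 <= t <= T -> dx m x t != 0.
    by move=> hx ht; apply: iA; rewrite in_itv.
  have ki := kappa01 (leqW iN); have kiS := kappa01 (iN : (i.+1 <= N.+1)%N).
  have [ki0 _] := andP ki; have [_ kiS1] := andP kiS.
  have [sg hsg pos_] := constant_sign ki0 (hkS iN) kiS1 nz.
  exists sg => _; split => //.
    move=> x t hx ht; apply: (@closed_ge0 (fun y => sg * dx m y t) _ _ (hkS iN) _ _ _ hx).
      apply: wcontZ; apply: continuous_subspaceW (rect_cont_x ht cb).
      by apply: subset_itv; rewrite bnd_simp.
    by move=> y hy; exact: pos_.
  by case: hsg => -> /eqP; rewrite ?oppr_eq0 oner_eq0.
by have [tau htau] := choice H; exists tau.
Qed.

(** With the wrong sign, the first-order expansion at [x0] would give [sg * dx m] the wrong sign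
    slightly towards [q]. *)
Lemma dxx_sign (x0 q sg : R) : 0 <= x0 <= 1 -> 0 <= q <= 1 -> x0 != q ->
  (forall t, 0 <= t <= T -> dx m x0 t = 0) ->
  (forall x t, Num.min x0 q <= x <= Num.max x0 q -> 0 <= t <= T -> 0 <= sg * dx m x t) ->
  forall t, 0 <= t <= T -> 0 <= sg * (q - x0) * dx (dx m) x0 t.
Proof.
move=> x01 q01 xq bz hs t tT; rewrite leNgt; apply/negP.
set k := q - x0; set bx := dx (dx m) x0 t; set z := sg * k * bx => z0.
have k0 : 0 < `|k| by rewrite normr_gt0 subr_eq0 eq_sym.
have sg0 : 0 < `|sg| by rewrite normr_gt0; apply/eqP => s0; move: z0; rewrite /z s0 !mul0r ltxx.
(* The accuracy is such that the Taylor error at [x0 + th * k], times [|sg|], is at most half of the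
   main term [- z * th]. *)
have de0 : 0 < - z / (2 * `|sg| * `|k|) by rewrite divr_gt0 ?oppr_gt0 ?mulr_gt0.
have [r r0 hr] := taylor Cb x01 bz de0.
pose th := Num.min 1 (r / `|k|).
have th0 : 0 < th by rewrite lt_min ltr01 divr_gt0.
have th1 : th <= 1 by rewrite ge_min lexx.
have thr : th * `|k| <= r by rewrite -ler_pdivlMr// ge_min lexx orbT.
pose x := x0 + th * k.
have xk : x - x0 = th * k by rewrite /x addrC addKr.
have hx : Num.min x0 q <= x <= Num.max x0 q.
  rewrite ge_min le_max /x /k; case: (lerP x0 q) => h.
    by apply/andP; split; apply/orP; [left|right]; nra.
  by apply/andP; split; apply/orP; [right|left]; nra.
have x01' : 0 <= x <= 1.
  have [[/andP[a1 a2] /andP[a3 a4]] /andP[b1 b2]] := (conj x01 q01, hx).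
  apply/andP; split.
    by apply: le_trans b1; rewrite le_min a1.
  by apply: le_trans b2 _; rewrite ge_max a2.
have rx : rect T (x, t) by apply/rectE.
have := hr x t rx; rewrite xk normrM (gtr0_norm th0) => /(_ thr) h.
have {}h : `|sg| * `|dx m x t - th * k * bx| <= - z / 2 * th.
  have thk : 0 < th * `|k| by rewrite mulr_gt0.
  rewrite -(ler_pM2r thk).
  have -> : - z / 2 * th * (th * `|k|) = `|sg| * (- z / (2 * `|sg| * `|k|) * (th * k) ^+ 2).
    rewrite exprMn -(real_normK (num_real k)); field; by rewrite !gt_eqF.
  rewrite -[leLHS]mulrA ler_pM2l//; apply: le_trans h; rewrite le_eqVlt; apply/orP; left; apply/eqP.
  have -> : th * `|k| = `|th * k| by rewrite normrM gtr0_norm.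
  by rewrite -normrM; congr (`|_|); rewrite /bx; ring.
have := hs x t hx tT => h1.
have := ler_norm (sg * (dx m x t - th * k * bx)); rewrite normrM => /le_trans/(_ h).
have -> : sg * (dx m x t - th * k * bx) = sg * dx m x t - th * z by rewrite /z; ring.
have : th * z < 0 by rewrite pmulr_rlt0.
lra.
Qed.

Variable tau : nat -> R.
Hypothesis htau : drift_sign tau.

Definition critical x := forall t, 0 <= t <= T -> dx m x t = 0.

Lemma kappa_itv01 i x : (i <= N)%N -> kappa i <= x <= kappa i.+1 -> 0 <= x <= 1.
Proof.
move=> iN /andP[x1 x2]; have /andP[p0 _] := kappa01 (leqW iN).
have /andP[_ q1] := kappa01 (iN : (i.+1 <= N.+1)%N).
by rewrite (le_trans p0 x1) (le_trans x2 q1).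
Qed.

(** At a node ending an interval of [B] the derivative involves both sides, but its value can be
    read on the side where the drift vanishes: [dxx_sign] applies with both signs. *)
Lemma dxx_eq0_B i : setB T m N kappa i -> forall x t, kappa i <= x <= kappa i.+1 -> 0 <= t <= T ->
  dx (dx m) x t = 0.
Proof.
move=> [iN iB] x t hx tT.
have bz y s : kappa i <= y <= kappa i.+1 -> 0 <= s <= T -> dx m y s = 0 by move=> *; apply: iB.
have [q hq xq] : exists2 q, kappa i <= q <= kappa i.+1 & x != q.
  have ii := hkS iN; case: (eqVneq x (kappa i)) => [->|xi].
    by exists (kappa i.+1); rewrite ?lexx ?lt_eqF ?(ltW ii).
  by exists (kappa i); rewrite // lexx ltW.
have hs (sg : R) y s : Num.min x q <= y <= Num.max x q -> 0 <= s <= T -> 0 <= sg * dx m y s.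
  rewrite ge_min le_max => hy sT; rewrite bz ?mulr0//.
  have [/andP[a1 a2] /andP[a3 a4]] := (hx, hq).
  by case/andP: hy => /orP[] c1 /orP[] c2; apply/andP; split; lra.
have H sg := dxx_sign (kappa_itv01 iN hx) (kappa_itv01 iN hq) xq (fun s => bz x s hx) (hs sg) tT.
have h : (q - x) * dx (dx m) x t = 0 by have := H 1; have := H (-1); lra.
by move/eqP: h; rewrite mulf_eq0 subr_eq0 eq_sym (negbTE xq) => /eqP.
Qed.

(** An adjacent interval has one drift sign for all times, which fixes the sign of the slope at the
    node for all times. Averaging then commutes with taking the positive part, and [beta] can be the
    slope itself or 0. *)
Lemma dxx_dichotomy i : (i <= N.+1)%N -> critical (kappa i) ->
  (forall t, 0 <= t <= T -> 0 <= dx (dx m) (kappa i) t) \/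
  (forall t, 0 <= t <= T -> dx (dx m) (kappa i) t <= 0).
Proof.
move=> iN ci.
have [j [q [jN hx hq xq]]] : exists j q, [/\ (j <= N)%N, kappa j <= kappa i <= kappa j.+1,
    kappa j <= q <= kappa j.+1 & kappa i != q].
  move: iN; rewrite leq_eqVlt => /orP[/eqP ->|]; last rewrite ltnS => iN.
    by have h := hkS (leqnn N); exists N, (kappa N); rewrite !lexx !(ltW h) gt_eqF.
  by have h := hkS iN; exists i, (kappa i.+1); rewrite !lexx !(ltW h) lt_eqF.
have [t1 t2 t3] := htau jN.
case: (eqVneq (tau j) 0) => [/t3 jB|/t2[tauE _]].
  by left => t tT; rewrite (dxx_eq0_B jB hx tT).
have H t : 0 <= t <= T -> 0 <= tau j * (q - kappa i) * dx (dx m) (kappa i) t.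
  apply: (dxx_sign (kappa_itv01 jN hx) (kappa_itv01 jN hq) xq ci) => y s hy sT; apply: t1 => //.
  move: hy; rewrite ge_min le_max => hy.
  have [/andP[a1 a2] /andP[a3 a4]] := (hx, hq).
  by case/andP: hy => /orP[] c1 /orP[] c2; apply/andP; split; lra.
case: (ltrgt0P (tau j * (q - kappa i))) => hk.
- by left => t /H; rewrite pmulr_rge0.
- by right => t /H; rewrite nmulr_rge0.
move/eqP: hk; rewrite mulf_eq0 subr_eq0 [q == _]eq_sym (negbTE xq) orbF => /eqP z.
by case: tauE; rewrite z => /eqP; rewrite eq_sym ?oppr_eq0 oner_eq0.
Qed.

(** At an end of [[0, 1]] the drift may vanish at some times only. As it keeps the weak sign
    [tau j], one time of nonvanishing makes the average nonzero; so the cases of the boundary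
    convention are exactly the noncritical ends. *)
Lemma hat_dx_noncritical j x : (j <= N)%N -> kappa j <= x <= kappa j.+1 -> ~ critical x ->
  (tau j = 1 \/ tau j = -1) /\ 0 < tau j * hat T (dx m) x.
Proof.
move=> jN hx nc; have x01 := kappa_itv01 jN hx.
have [t1 t2 t3] := htau jN.
have tz : tau j != 0.
  apply/eqP => z; apply: nc => t tT; have [_ jB] := t3 z.
  by apply: jB; rewrite in_itv.
split; first by have [] := t2 tz.
rewrite ltNge; apply/negP => h; apply: nc => t tT.
case: (eqVneq (dx m x t) 0) => // bn; exfalso.
move: h; apply/negP; rewrite -ltNge hatE mulrCA mulr_gt0 ?invr_gt0//.
have cx := rect_cont_t x01 cb.
rewrite -pintZ; last exact: ccont_itg.
apply: (pint_gt0 (t0 := t)) => //; first exact: wcontZ.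
  by move=> s sT; apply: t1.
by rewrite lt_neqAle eq_sym mulf_neq0//= t1.
Qed.

Lemma dxx_hatE x : 0 <= x <= 1 -> dxx_hat T m x =
  if (x == 0) && (hat T (dx m) x < 0) then -oo%E
  else if (x == 0) && (0 < hat T (dx m) x) then +oo%E
  else if (x == 1) && (hat T (dx m) x < 0) then +oo%E
  else if (x == 1) && (0 < hat T (dx m) x) then -oo%E
  else (hat T (dx (dx m)) x)%:E.
Proof.
move=> x01; rewrite /dxx_hat (deriv_hat hT Cm x01) -(deriv_hat hT Cb x01).
by rewrite (deriv_in_eq x01 (fun y => deriv_hat hT Cm (x := y))).
Qed.

(** * The terms of the minimum, node by node *)

Definition kterm i := ((hat T V (kappa i))%:E + pospart (dxx_hat T m (kappa i)))%E.

(** Only 0 and 1 can fail to be critical, and there the drift on the adjacent interval decides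
    between [+oo] and no positive part. A slope vanishing at all times fits both of the first two
    cases. *)
Variant kterm_spec i : \bar R -> Prop :=
 | KRepelling of critical (kappa i) & (forall t, 0 <= t <= T -> 0 <= dx (dx m) (kappa i) t) :
     kterm_spec i (hat T V (kappa i) + hat T (dx (dx m)) (kappa i))%:E
 | KAttracting of critical (kappa i) & (forall t, 0 <= t <= T -> dx (dx m) (kappa i) t <= 0) :
     kterm_spec i (hat T V (kappa i))%:E
 | KInward0 of i = 0%N & tau 0%N = 1 & 0 < hat T (dx m) 0 : kterm_spec i +oo%E
 | KOutward0 of i = 0%N & tau 0%N = -1 & hat T (dx m) 0 < 0 : kterm_spec i (hat T V (kappa i))%:E
 | KInward1 of i = N.+1 & tau N = -1 & hat T (dx m) 1 < 0 : kterm_spec i +oo%E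
 | KOutward1 of i = N.+1 & tau N = 1 & 0 < hat T (dx m) 1 : kterm_spec i (hat T V (kappa i))%:E.

Lemma ktermP i : (i <= N.+1)%N -> kterm_spec i (kterm i).
Proof.
move=> iN; have x01 := kappa01 iN; rewrite /kterm dxx_hatE//.
have cx := ccont_itg (rect_cont_t x01 cbx).
case: (pselect (critical (kappa i))) => [ci|nc].
  have -> : hat T (dx m) (kappa i) = 0.
    rewrite hatE (@eq_pint _ _ _ _ (fun=> 0)); last exact: ci.
    by rewrite pint_cst ?mul0r ?mulr0// ltW.
  rewrite !ltxx !andbF.
  have [h|h] := dxx_dichotomy iN ci; rewrite /pospart /maxe.
    have hh : 0 <= hat T (dx (dx m)) (kappa i).
      by rewrite hatE mulr_ge0 ?invr_ge0 ?(ltW hT)//; exact: pint_ge0.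
    by rewrite lte_fin ltNge hh /= -EFinD; exact: KRepelling.
  have hh : hat T (dx (dx m)) (kappa i) <= 0.
    rewrite hatE mulr_ge0_le0 ?invr_ge0 ?(ltW hT)//.
    have := le_pint cx (itg_cst 0 T (0 : R)) h.
    by rewrite pint_cst ?mul0r// ltW.
  case: ifPn => [_|]; rewrite ?adde0; first exact: KAttracting.
  rewrite lte_fin -leNgt => h0; have -> : hat T (dx (dx m)) (kappa i) = 0 by apply/eqP; rewrite eq_le hh.
  by rewrite adde0; exact: KAttracting.
have : i = 0%N \/ i = N.+1.
  case: (eqVneq i 0%N) => [->|i0]; first by left.
  move: iN; rewrite leq_eqVlt => /orP[/eqP ->|iN]; first by right.
  exfalso; apply: nc => t tT; apply: hcrit; last by rewrite in_itv.
  by rewrite lt0n i0 -ltnS.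
case=> Ei; rewrite Ei.
  have h0 := ltW (hkS (leq0n N)).
  have [||hs] := @hat_dx_noncritical 0%N (kappa 0%N) (leq0n N); rewrite ?lexx ?h0//; first by rewrite -Ei.
  rewrite hk0 eqxx /=; case: hs => hs; rewrite hs ?mul1r ?mulN1r ?oppr_gt0 => hb.
    rewrite ltNge (ltW hb) /= hb.
    have -> : ((hat T V 0)%:E + pospart +oo = +oo)%E by rewrite /pospart /maxe /=.
    exact: KInward0.
  rewrite hb; have -> : ((hat T V 0)%:E + pospart -oo = (hat T V (kappa 0))%:E)%E.
    by rewrite /pospart (max_idPr (leNye _)) adde0 hk0.
  exact: KOutward0.
have h0 := ltW (hkS (leqnn N)).
have [||hs] := @hat_dx_noncritical N (kappa N.+1) (leqnn N); rewrite ?lexx ?h0//; first by rewrite -Ei.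
rewrite hk1 oner_eq0 eqxx /=; case: hs => hs; rewrite hs ?mul1r ?mulN1r ?oppr_gt0 => hb.
  rewrite ltNge (ltW hb) /= hb; have -> : ((hat T V 1)%:E + pospart -oo = (hat T V (kappa N.+1))%:E)%E.
    by rewrite /pospart (max_idPr (leNye _)) adde0 hk1.
  exact: KOutward1.
rewrite hb; have -> : ((hat T V 1)%:E + pospart +oo = +oo)%E by rewrite /pospart /maxe /=.
exact: KInward1.
Qed.

(** * Upper bounds at the nodes and on the intervals of B *)

Let upper_hat x be e : (forall t, 0 <= t <= T -> be t = 0) ->
  T^-1 * (pint (V x) 0 T + pint be 0 T) + e = hat T V x + e.
Proof.
by move=> h; rewrite hatE (@eq_pint _ _ _ be (fun=> 0))// pint_cst ?mul0r ?addr0// ltW.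
Qed.

Lemma limsup_le_kterm i l : (i <= N.+1)%N -> kterm i = l%:E -> forall e : R, 0 < e ->
  exists2 D0 : R, 0 < D0 & forall D, 0 < D -> D < D0 -> lambda D <= l + e.
Proof.
move=> iN; have x01 := kappa01 iN.
have near_crit : critical (kappa i) -> forall (be : R -> R),
    (forall t, 0 <= t <= T -> dx (dx m) (kappa i) t <= be t) ->
    forall de : R, 0 < de -> exists2 r : R, 0 < r & forall x t, rect T (x, t) -> `|x - kappa i| <= r ->
    dx m x t * (x - kappa i) <= (be t + de) * (x - kappa i) ^+ 2.
  move=> ci be hbe de de0; have [r r0 hr] := taylor Cb x01 ci de0.
  exists r => // x t xt hx; have [_ tT] := (rectE T x t).1 xt.
  have := ler_norm (dx m x t * (x - kappa i) - dx (dx m) (kappa i) t * (x - kappa i) ^+ 2).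
  move=> /le_trans/(_ (hr x t xt hx)).
  have := ler_wpM2r (sqr_ge0 (x - kappa i)) (hbe t tT).
  lra.
have cz : {within `[0, T], continuous (fun=> 0 : R)} by exact: wcont_cst.
case: (ktermP iN) => //.
- move=> ci h [<-] e e0; have := upper_bound hT cb hV hlambda x01 (rect_cont_t x01 cbx) h
    (near_crit ci _ (fun t _ => lexx _)) e0.
  by rewrite mulrDr -!hatE.
- move=> ci h [<-] e e0; have := upper_bound hT cb hV hlambda x01 cz (fun t _ => lexx _)
    (near_crit ci _ h) e0.
  by rewrite upper_hat.
- move=> Ei t0 _ [<-] e e0.
  have [|D0 D00 hD0] := upper_bound hT cb hV hlambda x01 cz (fun t _ => lexx _) _ e0; last first.
  + by exists D0 => // D h1 h2; have := hD0 D h1 h2; rewrite upper_hat.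
  (* The drift is nonpositive on the whole first interval, so [dx m x t * x <= 0] there and every
     [de] is allowed. *)
  move=> de de0; exists (kappa 1%N); first by rewrite -hk0; exact: hkS.
  move=> x t /rectE[/andP[x0 x1] tT]; rewrite Ei hk0 subr0 ger0_norm// => xk.
  have [h _ _] := htau (leq0n N).
  have := h x t; rewrite hk0 x0 xk => /(_ isT tT); rewrite t0 mulN1r => bn.
  have := sqr_ge0 x; nra.
- move=> Ei t0 _ [<-] e e0.
  have [|D0 D00 hD0] := upper_bound hT cb hV hlambda x01 cz (fun t _ => lexx _) _ e0; last first.
  + by exists D0 => // D h1 h2; have := hD0 D h1 h2; rewrite upper_hat.
  move=> de de0; exists (1 - kappa N); first by rewrite -hk1 subr_gt0; exact: hkS.
  move=> x t /rectE[/andP[x0 x1] tT]; rewrite Ei hk1 ler0_norm ?subr_le0// opprB => xk.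
  have [h _ _] := htau (leqnn N).
  have := h x t; rewrite hk1 x1 andbT => /(_ _ tT); rewrite t0 mul1r => bn.
  have {}bn : 0 <= dx m x t by apply: bn; lra.
  have := sqr_ge0 (x - 1); nra.
Qed.

Lemma limsup_le_hatV i x : setB T m N kappa i -> kappa i <= x <= kappa i.+1 -> forall e : R, 0 < e ->
  exists2 D0 : R, 0 < D0 & forall D, 0 < D -> D < D0 -> lambda D <= hat T V x + e.
Proof.
move=> iB hx e e0; have [iN bz] := iB; have x01 := kappa_itv01 iN hx.
have bz' t : 0 <= t <= T -> dx m x t = 0 by move=> tT; apply: bz.
have := upper_bound hT cb hV hlambda x01 (@wcont_cst _ _ 0) (fun t _ => lexx _) _ e0.
rewrite upper_hat//; apply => de de0.
have [r r0 hr] := taylor Cb x01 bz' de0.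
exists r => // y t yt hy; have [_ tT] := (rectE T y t).1 yt.
have := le_trans (ler_norm _) (hr y t yt hy).
by rewrite (dxx_eq0_B iB hx tT) mul0r subr0 add0r.
Qed.

(** [h] is a staircase running against the drift: one [step] per interval with coefficient
    [- tau i], hence flat on the intervals of [B]. All terms of [dx m * h1] have one sign, so it
    vanishes only where each term does. *)
Lemma monotone_potential : exists h h1 h2 : R -> R,
  [/\ forall x : R, is_derive x 1 h (h1 x), forall x : R, is_derive x 1 h1 (h2 x), continuous h2,
      h1 0 = 0 /\ h1 1 = 0 &
      forall x t, rect T (x, t) -> dx m x t * h1 x <= 0 /\ (dx m x t * h1 x = 0 ->
        (exists2 j, (j <= N.+1)%N & x = kappa j) \/
        (exists2 j, setB T m N kappa j & kappa j < x < kappa j.+1))].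
Proof.
pose r := iota 0 N.+1.
have rN i : i \in r -> (i <= N)%N by rewrite mem_iota add0n ltnS.
(* Stretches the support [[0, 3]] of [step1] onto the interval between two nodes. *)
pose w i := 3 / (kappa i.+1 - kappa i).
have w0 i : (i <= N)%N -> 0 < w i by move=> /hkS ?; rewrite divr_gt0// subr_gt0.
have wk i : (i <= N)%N -> w i * (kappa i.+1 - kappa i) = 3.
  by move=> /hkS ?; rewrite /w divfK// gt_eqF// subr_gt0.
exists (fun x => \sum_(i <- r) - tau i * step (w i * (x - kappa i))).
exists (fun x => \sum_(i <- r) - tau i * (step1 (w i * (x - kappa i)) * w i)).
exists (fun x => \sum_(i <- r) - tau i * (w i * (step2 (w i * (x - kappa i)) * w i))).
have dl i (x : R) : is_derive x 1 (fun y => w i * (y - kappa i)) (w i).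
  by apply: der_eq (derZ _ (derB (der_id x) (der_cst x _))) _; rewrite subr0 mulr1.
have lo i x : (i <= N)%N -> x <= kappa i -> step1 (w i * (x - kappa i)) = 0.
  by move=> iN hx; rewrite step1_le0// mulr_ge0_le0 ?subr_le0// ltW// w0.
have hi i x : (i <= N)%N -> kappa i.+1 <= x -> step1 (w i * (x - kappa i)) = 0.
  by move=> iN hx; rewrite step1_ge3// -(wk i iN) ler_pM2l ?w0// lerD2r.
split.
- move=> x; apply: (@der_sum _ _ r (fun i x => - tau i * step (w i * (x - kappa i)))
    (fun i x => - tau i * (step1 (w i * (x - kappa i)) * w i))) => i.
  by apply: derZ; exact: der_comp (der_step _) (dl i x).
- move=> x; apply: (@der_sum _ _ r (fun i x => - tau i * (step1 (w i * (x - kappa i)) * w i))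
    (fun i x => - tau i * (w i * (step2 (w i * (x - kappa i)) * w i)))) => i.
  apply: derZ; have -> : (fun y => step1 (w i * (y - kappa i)) * w i) = (fun y => w i * step1 (w i * (y - kappa i))).
    by apply/funext => y; rewrite mulrC.
  by apply: derZ; exact: der_comp (der_step1 _) (dl i x).
- have C1 i : continuous (fun x => - tau i * (w i * (step2 (w i * (x - kappa i)) * w i))).
    move=> x; apply: cvgM; first exact: cvg_cst.
    apply: cvgM; first exact: cvg_cst.
    apply: cvgM; last exact: cvg_cst.
    by apply: (cvg_comp _ step2 (der_cont (dl i x))); exact: continuous_step2.
  elim: r {rN} => [|i r IH].
    by under eq_fun do rewrite big_nil; move=> x; exact: cvg_cst.
  under eq_fun do rewrite big_cons.
  by move=> x; apply: cvgD; [exact: C1|exact: IH].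
- split; rewrite big1_seq// => i /andP[_ /rN iN].
    by rewrite lo ?mul0r ?mulr0//; have /andP[] := kappa01 (leqW iN).
  by rewrite hi ?mul0r ?mulr0//; have /andP[] := kappa01 (iN : (i.+1 <= N.+1)%N).
move=> x t /rectE[x01 tT].
have E : dx m x t * (\sum_(i <- r) - tau i * (step1 (w i * (x - kappa i)) * w i)) =
   - \sum_(i <- r | i \in r) (tau i * dx m x t) * (step1 (w i * (x - kappa i)) * w i).
  rewrite mulr_sumr -sumrN big_seq; apply: eq_bigr => i _; ring.
have nn i : i \in r -> 0 <= (tau i * dx m x t) * (step1 (w i * (x - kappa i)) * w i).
  move=> /rN iN; case: (lerP x (kappa i)) => h1; first by rewrite lo// mul0r mulr0.
  case: (lerP (kappa i.+1) x) => h2; first by rewrite hi// mul0r mulr0.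
  have [t1 _ _] := htau iN.
  apply: mulr_ge0; first by apply: t1 => //; rewrite (ltW h1) (ltW h2).
  by apply: mulr_ge0; [exact: step1_ge0|rewrite ltW// w0].
rewrite E; split; first by rewrite oppr_le0; exact: sumr_ge0.
move/eqP; rewrite oppr_eq0 psumr_eq0// => /allP hz.
have [i iN /andP[]] := kappa_cover x01; rewrite le_eqVlt => /orP[/eqP <-|h1].
  by left; exists i => //; exact: leqW.
rewrite le_eqVlt => /orP[/eqP ->|h2]; first by left; exists i.+1.
right; exists i; last by rewrite h1.
have ir : i \in r by rewrite mem_iota add0n ltnS.
have := hz i ir; rewrite ir implyTb.
have s0 : 0 < step1 (w i * (x - kappa i)) * w i.
  rewrite mulr_gt0 ?w0// step1_gt0// mulr_gt0 ?w0 ?subr_gt0//=.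
  by rewrite -(wk i iN) ltr_pM2l ?w0// ltrD2r.
rewrite mulf_eq0 [X in _ || X]gt_eqF// orbF.
have [_ t2 t3] := htau iN.
case: (eqVneq (tau i) 0) => [/t3 //|/[dup] tz /t2[_ bn]].
by rewrite mulf_eq0 (negbTE tz) (negbTE (bn x t _ tT)) ?h1.
Qed.

(** Only the slopes at the ends are prescribed: at interior nodes and on [B] the drift vanishes, so
    [g1] does not enter the averaged potential there. *)
Lemma linear_gauge (p q : R) : exists g g1 g2 : R -> R,
  [/\ forall x : R, is_derive x 1 g (g1 x), forall x : R, is_derive x 1 g1 (g2 x), continuous g2,
      g1 0 = p & g1 1 = q].
Proof.
exists (fun x => p * x + (q - p) / 2 * x ^+ 2), (fun x => p + (q - p) * x), (fun=> q - p); split.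
- move=> x; have e : is_derive x 1 (fun y => p * y + (q - p) / 2 * (y * y)) (p + (q - p) * x).
    apply: der_eq (derD (derZ p (der_id x)) (derZ _ (derM (der_id x) (der_id x)))) _; by field.
  have -> // : (fun y => p * y + (q - p) / 2 * y ^+ 2) =
    (fun y => p * y + (q - p) / 2 * (y * y)) by apply/funext => y; rewrite expr2.
- by move=> x; apply: der_eq (derD (der_cst x p) (derZ _ (der_id x))) _; rewrite mulr1 add0r.
- by move=> x; exact: cvg_cst.
- by rewrite mulr0 addr0.
- ring.
Qed.

Lemma wellV_center (xx rho : nat -> R) (a : nat -> R -> R) i t :
  wellV xx rho a i (xx i) t = a i t.
Proof.
rewrite /wellV subrr expr0n /= !mulr0 expr0n /= mulr0 add0r /prof1 mulr0 subr0 pos_id//.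
by rewrite expr1n mul1r mulfK.
Qed.

Lemma wellV_far (xx rho : nat -> R) (a : nat -> R -> R) i x t : 0 < rho i ->
  rho i <= a i t * (x - xx i) ^+ 2 -> wellV xx rho a i x t = 0.
Proof. by move=> r0 /(prof1_ge r0)[h1 h2]; rewrite /wellV h1 h2 !mul0r addr0 mul0r. Qed.

Lemma hat_dx_critical x : critical x -> hat T (dx m) x = 0.
Proof.
move=> cx; rewrite hatE (@eq_pint _ _ _ _ (fun=> 0)); last exact: cx.
by rewrite pint_cst ?mul0r ?mulr0// ltW.
Qed.

Lemma liminf_ge (l : R) : (forall i, (i <= N.+1)%N -> (l%:E <= kterm i)%E) ->
  (forall i x, setB T m N kappa i -> kappa i <= x <= kappa i.+1 -> l <= hat T V x) ->
  forall e : R, 0 < e -> exists2 D0 : R, 0 < D0 & forall D, 0 < D -> D < D0 -> l - e <= lambda D.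
Proof.
move=> hK hB e e0; have e20 : 0 < e / 2 by rewrite divr_gt0.
pose bx := dx (dx m).
(* Wells sit only where the averaged slope is positive: the Riccati equation needs a positive mean,
   and at the other critical nodes the term has no positive part to recover. *)
pose s := [seq i <- iota 0 N.+2 | `[< critical (kappa i) /\ 0 < hat T bx (kappa i) >]].
have sP i : reflect [/\ (i <= N.+1)%N, critical (kappa i) & 0 < hat T bx (kappa i)] (i \in s).
  apply: (iffP idP); rewrite mem_filter mem_iota add0n ltnS.
    by move=> /andP[/asboolP[? ?] ?].
  by move=> [? ? ?]; apply/andP; split => //; apply/asboolP.
have us : uniq s by rewrite filter_uniq// iota_uniq.
have sN i : i \in s -> (i <= N.+1)%N by move=> /sP[].
have sc i t : i \in s -> 0 <= t <= T -> dx m (kappa i) t = 0 by move=> /sP[_ h _]; exact: h.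
have [d1 d10 hd1] := @finite_pos_min R s (fun i => hat T bx (kappa i) / 2)
  (fun i is_ => ltac:(by have /sP[_ _ h] := is_; rewrite divr_gt0)).
(* At most half of each positive average, so that [bx - de2] keeps a positive mean, and at most
   [e / 2], the loss allowed at the centres. *)
pose de2 := Num.min (e / 2) d1.
have de20 : 0 < de2 by rewrite lt_min e20.
have de2e : de2 <= e / 2 by rewrite ge_min lexx.
have de2h i : i \in s -> de2 < hat T bx (kappa i).
  move=> is_; have := hd1 i is_; have : de2 <= d1 by rewrite ge_min lexx orbT.
  have /sP[_ _ h] := is_; lra.
have cbxi i : i \in s -> {within `[0, T], continuous (bx (kappa i))}.
  by move=> /sN/kappa01 h; exact: rect_cont_t h cbx.
have hric i : exists p : (R -> R) * (R -> R), i \in s ->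
    [/\ {within `[0, T], continuous p.1} /\ {within `[0, T], continuous p.2},
        forall t, 0 <= t <= T -> 0 < p.1 t, p.1 0 = p.1 T,
        forall t, 0 < t < T -> is_derive t 1 p.1 (p.2 t) &
        (forall t, 0 <= t <= T -> p.2 t = 2 * (bx (kappa i) t - de2) * p.1 t - 2 * p.1 t ^+ 2) /\
        T^-1 * pint p.1 0 T = hat T bx (kappa i) - de2].
  case: (boolP (i \in s)) => is_; last by exists (fun=> 0, fun=> 0).
  have cg : {within `[0, T], continuous (fun t => bx (kappa i) t - de2)}.
    by apply: wcontD; [exact: cbxi|exact: wcont_cst].
  have E : T^-1 * pint (fun t => bx (kappa i) t - de2) 0 T = hat T bx (kappa i) - de2.
    rewrite pintB; [|exact: ccont_itg (cbxi i is_)|exact: itg_cst].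
    rewrite pint_cst; last exact: ltW.
    by rewrite hatE; field; rewrite gt_eqF.
  have [|a [a' [h1 h2 h3 h4 [h5 h6]]]] := riccati hT cg.
    have : 0 < hat T bx (kappa i) - de2 by rewrite subr_gt0 de2h.
    by rewrite -E pmulr_rgt0// invr_gt0.
  by exists (a, a') => _; split => //; rewrite h6.
have [p hp] := choice hric.
pose a i := (p i).1; pose a' i := (p i).2.
(* Half of [de2] covers the Taylor error, the other half is the margin of the wells. *)
have de40 : 0 < de2 / 2 by rewrite divr_gt0.
have htay i : exists r, i \in s -> 0 < r /\ forall x t, rect T (x, t) -> `|x - kappa i| <= r ->
    (bx (kappa i) t - de2 / 2) * (x - kappa i) ^+ 2 <= dx m x t * (x - kappa i).
  case: (boolP (i \in s)) => is_; last by exists 0.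
  have [r r0 hr] := taylor Cb (kappa01 (sN _ is_)) (fun t => sc i t is_) de40.
  exists r => _; split => // x t xt hx; have := hr x t xt hx.
  by rewrite ler_norml /bx => /andP[h _]; lra.
have [rr hrr] := choice htay.
have [r1 r10 hr1] := @finite_pos_min R s rr (fun i is_ => (hrr i is_).1).
have [l0 l00 hl0] := kappa_gap.
(* Half of the smallest gap, so that no point is closer than [r] to two nodes. *)
pose r := Num.min r1 (l0 / 2).
have r0 : 0 < r by rewrite lt_min r10 divr_gt0.
have rl : r <= l0 / 2 by rewrite ge_min lexx orbT.
have rr1 i : i \in s -> r <= rr i by move=> is_; rewrite ge_min hr1.
have hcC i : exists q : R * R, i \in s -> 0 < q.1 /\ forall t, 0 <= t <= T -> q.1 <= a i t <= q.2.
  case: (boolP (i \in s)) => is_; last by exists (0, 0).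
  have [[ca _] pa _ _ _] := hp i is_.
  have [c [C h]] := wcont_minmax hT ca pa.
  by exists (c, C).
have [q hq] := choice hcC.
(* [(q i).1] bounds [a i] from below, so the well is off from distance [r] on, at every time. *)
pose rho i := (q i).1 * r ^+ 2.
have r20 : 0 < r ^+ 2 by rewrite exprn_gt0.
have rho0 i : i \in s -> 0 < rho i by move=> /hq[h _]; exact: mulr_gt0.
have t00 : (0 : R) <= 0 <= T by rewrite lexx ltW.
have q20 i : i \in s -> 0 < (q i).2.
  by move=> /hq[h1 /(_ 0 t00)/andP[h2 h3]]; exact: lt_le_trans h1 (le_trans h2 h3).
have [d d0 hd] := @finite_pos_min R s (fun i => ((q i).2)^-1) (fun i is_ => ltac:(by rewrite invr_gt0 q20)).
have far i x t : i \in s -> 0 <= t <= T -> r <= `|x - kappa i| -> rho i <= a i t * (x - kappa i) ^+ 2.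
  move=> is_ tT hx; have [c0 /(_ t tT)/andP[h1 _]] := hq i is_.
  apply: ler_pM => //; [exact: ltW|exact: sqr_ge0|].
  by rewrite -[leRHS](real_normK (num_real _)) ler_pXn2r// ?nnegrE// ltW.
have apart i j : (i <= N.+1)%N -> (j <= N.+1)%N -> i != j -> l0 <= `|kappa i - kappa j|.
  move=> iN jN; rewrite neq_ltn => /orP[ij|ji].
    by rewrite distrC; apply: le_trans (hl0 i j ij jN) (ler_norm _).
  exact: le_trans (hl0 j i ji iN) (ler_norm _).
have lr : r <= l0 by lra.
have [h [h1 [h2 [dh dh1 ch2 [h10 h11] hz]]]] := monotone_potential.
(* This slope lifts [hat T V 0 - hat T (dx m) 0 * v0] to at least [l]; the minimum with 0 gives the
   sign required at the boundary. [v1] is its mirror image. *)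
pose v0 := if 0 < hat T (dx m) 0 then Num.min 0 ((hat T V 0 - l) / hat T (dx m) 0) else 0.
pose v1 := if hat T (dx m) 1 < 0 then Num.max 0 ((hat T V 1 - l) / hat T (dx m) 1) else 0.
have [g [g1 [g2 [dg dg1 cg2 g10 g11]]]] := linear_gauge v0 v1.
have aa i t : i \in s -> 0 <= t <= T -> 0 < a i t by move=> is_; have [_ H _ _ _] := hp i is_; exact: H.
have val0 x : 0 <= x <= 1 -> (forall i, i \in s -> r <= `|x - kappa i|) ->
    T^-1 * pint (fun t => V x t + \sum_(i <- s) wellV kappa rho a i x t - dx m x t * g1 x) 0 T =
    hat T V x - hat T (dx m) x * g1 x.
  move=> x01 hx; rewrite (@eq_pint _ _ _ _ (fun t => V x t - g1 x * dx m x t)).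
    have ib := ccont_itg (rect_cont_t x01 cb).
    rewrite pintB; [|exact: ccont_itg (rect_cont_t x01 hV)|exact: itgZ].
    by rewrite pintZ// !hatE; ring.
  move=> t tT; rewrite big1_seq ?addr0 1?mulrC// => i /andP[_ is_].
  by apply: wellV_far; [exact: rho0|exact: far (hx i is_)].
(* At a centre the drift and the other wells vanish, and the well itself adds the Riccati solution,
   whose mean is the averaged slope less [de2]. *)
have valk j : j \in s ->
    T^-1 * pint (fun t => V (kappa j) t + \sum_(i <- s) wellV kappa rho a i (kappa j) t
       - dx m (kappa j) t * g1 (kappa j)) 0 T =
    hat T V (kappa j) + (hat T bx (kappa j) - de2).
  move=> js; have [[ca _] _ _ _ [_ Ea]] := hp j js.
  rewrite (@eq_pint _ _ _ _ (fun t => V (kappa j) t + a j t)).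
    rewrite pintD; [|exact: ccont_itg (rect_cont_t (kappa01 (sN _ js)) hV)|exact: ccont_itg].
    by rewrite mulrDr hatE -Ea.
  move=> t tT; rewrite (sc j t js tT) mul0r subr0 (bigD1_seq j)//= wellV_center.
  rewrite big1_seq ?addr0// => i /andP[ij is_].
  apply: wellV_far; [exact: rho0|apply: far => //].
  by apply: le_trans lr (apart _ _ _ _ _); rewrite ?sN// eq_sym.
(* One [e / 2] pays for [de2], the other is the loss in [lower_bound]. *)
have -> : l - e = l - e / 2 - e / 2 by lra.
apply: (lower_bound (s := s) (xx := kappa) (rho := rho) (a := a) (a' := a') (A := d^-1) (de := de2 / 2)
  hT cb hV hlambda us _ _ _ _ _ rho0 _ de40 _ _ _ _ dg dg1 cg2 _ _ dh dh1 ch2 _ _ _ _ e20) => //.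
- by move=> i is_; have [[]] := hp i is_.
- by move=> i is_; have [[]] := hp i is_.
- by move=> i t is_; have [_ _ _ H _] := hp i is_; exact: H.
- by move=> i is_; have [_ _ H _ _] := hp i is_.
- move=> i t is_ tT; rewrite aa//=; have [_ /(_ t tT)/andP[_ H]] := hq i is_.
  apply: le_trans H _; rewrite -[leLHS]invrK lef_pV2 ?posrE ?invr_gt0 ?q20//; exact: hd.
- by rewrite invr_gt0.
- move=> i x t is_ xt hx; have [x01 tT] := (rectE T x t).1 xt.
  have xr : `|x - kappa i| <= rr i.
    rewrite leNgt; apply/negP => H; move: hx; apply/negP; rewrite -leNgt.
    by apply: far => //; exact: le_trans (rr1 i is_) (ltW H).
  have := (hrr i is_).2 x t xt xr => H.
  have [_ _ _ _ [Ea _]] := hp i is_.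
  have := ler_wpM2l (ltW (aa i t is_ tT)) H.
  rewrite /a' /= Ea//= -/(a i t).
  move: (dx m x t) (a i t) (bx (kappa i) t) (x - kappa i) => b1 a1 b2 y; nra.
- move=> i t is_ tT; case: (eqVneq i 0%N) => [->|i0]; [by left|right].
  apply: far => //; rewrite -[X in `|X - _|]hk0; apply: le_trans lr (apart _ _ _ _ _) => //; first exact: sN.
  by rewrite eq_sym.
- move=> i t is_ tT; case: (eqVneq i N.+1) => [->|i0]; [by left|right].
  apply: far => //; rewrite -[X in `|X - _|]hk1; apply: le_trans lr (apart _ _ _ _ _) => //; first exact: sN.
  by rewrite eq_sym.
- move=> i j x t is_ js ij /rectE[_ tT].
  case: (lerP r `|x - kappa i|) => H1; first by left; exact: far.
  right; apply: far => //; have := apart i j (sN _ is_) (sN _ js) ij.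
  have := ler_distD x (kappa i) (kappa j); rewrite [`|kappa i - x|]distrC; lra.
- by rewrite g10 /v0; case: ifP => // _; rewrite ge_min lexx.
- by rewrite g11 /v1; case: ifP => // _; rewrite le_max lexx.
- by rewrite h10.
- by rewrite h11.
- by move=> x t /hz[].
move=> x t xt /(hz x t xt).2 [[j jN ->]|[j jB xj]].
  have [x01 tT] := (rectE T x t).1 xt.
  split.
    case: (eqVneq j 0%N) => [->|j0]; first by apply: Or32.
    move: jN; rewrite leq_eqVlt => /orP[/eqP ->|jN]; first by apply: Or33.
    by apply: Or31; apply: hcrit; rewrite ?in_itv//= lt0n j0 -ltnS.
  case: (boolP (j \in s)) => js.
    rewrite valk//; have dj := de2h j js; have /sP[_ cj hj] := js.
    have := hK j jN; have hb := hat_dx_critical cj.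
    case: (ktermP jN) => [_ _|_ _|j0 _|j0 _ _|j1 _|j1 _ _]; rewrite ?lee_fin.
    + lra.
    + lra.
    + by move: hb; rewrite j0 hk0 => ->; rewrite ltxx.
    + lra.
    + by move: hb; rewrite j1 hk1 => ->; rewrite ltxx.
    + lra.
  rewrite val0; last 2 first.
  - exact: kappa01.
  - move=> i is_; apply: le_trans lr (apart j i jN (sN i is_) _).
    by apply: contraNneq js => ->.
  have := hK j jN.
  case: (ktermP jN) => [cj _|cj _|j0 _ hb _|j0 _ hb|j1 _ hb _|j1 _ hb]; rewrite ?lee_fin.
  + have : hat T bx (kappa j) <= 0.
      by rewrite leNgt; apply: contraNN js => H; apply/sP; split.
    rewrite hat_dx_critical// mul0r /bx; lra.
  + rewrite hat_dx_critical// mul0r; lra.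
  + rewrite j0 hk0 g10 /v0 hb.
    have : Num.min 0 ((hat T V 0 - l) / hat T (dx m) 0) <= (hat T V 0 - l) / hat T (dx m) 0.
      by rewrite ge_min lexx orbT.
    rewrite ler_pdivlMr//; lra.
  + rewrite j0 hk0 g10 /v0 ltNge (ltW hb) /= mulr0; lra.
  + rewrite j1 hk1 g11 /v1 hb.
    have : (hat T V 1 - l) / hat T (dx m) 1 <= Num.max 0 ((hat T V 1 - l) / hat T (dx m) 1).
      by rewrite le_max lexx orbT.
    rewrite ler_ndivrMr//; lra.
  + rewrite j1 hk1 g11 /v1 ltNge (ltW hb) /= mulr0; lra.
have [jN bz] := jB; have [x01 tT] := (rectE T x t).1 xt; have [xj1 xj2] := andP xj.
have xj' : kappa j <= x <= kappa j.+1 by rewrite !ltW.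
have cx : critical x by move=> t' tT'; apply: bz.
split; first by apply: Or31; exact: cx.
rewrite val0//; first by rewrite hat_dx_critical// mul0r; have := hB j x jB xj'; lra.
(* No well reaches the interior of an interval of [B]: its two ends have zero averaged slope and
   carry none, and every other node is at distance at least [l0]. *)
move=> i is_; have bxz i' : kappa j <= kappa i' <= kappa j.+1 -> hat T bx (kappa i') = 0.
  move=> hi'; rewrite hatE (@eq_pint _ _ _ _ (fun=> 0)); last first.
    by move=> t' tT'; exact: dxx_eq0_B jB _ _ hi' tT'.
  by rewrite pint_cst ?mul0r ?mulr0// ltW.
have /sP[iN _ hi] := is_.
have kj := ltW (hkS jN).
case: (ltngtP i j) => [ij|ji|ij].
- have := hl0 i j ij (leqW jN); have := ler_norm (x - kappa i); lra.
- move: ji; rewrite leq_eqVlt => /orP[/eqP ij|ji].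
    by move: hi; rewrite bxz ?ltxx// -ij lexx kj.
  have := hl0 j.+1 i ji iN; have := ler_norm (kappa i - x); rewrite distrC; lra.
- by move: hi; rewrite bxz ?ltxx// ij lexx kj.
Qed.

(** The terms are bounded below because [hat T V] is, and [N >= 1] supplies the interior node
    [kappa 1], whose term is finite. *)
Lemma limit_value_real : exists l : R, limit_value T m V N kappa = l%:E.
Proof.
have [M M0 hM] := rect_bounded hV.
have hatM x : 0 <= x <= 1 -> - M <= hat T V x.
  move=> x01; rewrite hatE -[leLHS]mul1r -(mulVf (lt0r_neq0 hT)) -mulrA ler_pM2l ?invr_gt0//.
  have -> : T * - M = pint (fun=> - M) 0 T by rewrite pint_cst ?subr0 1?mulrC// ltW.
  apply: le_pint; [exact: itg_cst|exact: ccont_itg (rect_cont_t x01 hV)|].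
  move=> t tT; have := hM x t; rewrite ler_norml => h.
  by have /andP[] : - M <= V x t <= M by apply: h; apply/rectE.
have lo : ((- M)%:E <= limit_value T m V N kappa)%E.
  rewrite /limit_value le_min; apply/andP; split.
    have [->|[i [ir _ ->]]] := bigmin_attained (index_iota 0 N.+2) xpredT kterm; first exact: leey.
    have iN : (i <= N.+1)%N by move: ir; rewrite mem_index_iota.
    apply: (@le_trans _ _ (hat T V (kappa i))%:E); first by rewrite lee_fin hatM// kappa01.
    by rewrite leeDl// /pospart le_max lexx orbT.
  have [->|[i [_ /set_mem[iN _] ->]]] := bigmin_attained (index_iota 0 N.+1)
    (fun i => i \in setB T m N kappa)
    (fun i => ereal_inf [set (hat T V x)%:E | x in `[kappa i, kappa i.+1]]); first exact: leey.
  apply/ereal_infP => _ [x /= hx <-]; rewrite lee_fin hatM//.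
  by apply: (kappa_itv01 iN); move: hx; rewrite in_itv.
have hi : (limit_value T m V N kappa < +oo)%E.
  have i1 : (1 <= N.+1)%N by [].
  have le1 : (limit_value T m V N kappa <= kterm 1%N)%E.
    rewrite /limit_value ge_min; apply/orP; left.
    by apply: (@bigmin_leq R _ _ xpredT kterm 1%N) => //; rewrite mem_index_iota /= ltnS.
  apply: le_lt_trans le1 _.
  case: (ktermP i1) => [*|*|//|*|E1 *|*]; rewrite ?ltry//.
  by move: hN; case: E1 => <-.
exists (fine (limit_value T m V N kappa)); rewrite fineK//.
rewrite fin_numElt hi andbT; exact: lt_le_trans (ltNyr _) lo.
Qed.

Lemma limit_principal_eigenvalue : (lambda D)%:E @[D --> 0^'+] --> limit_value T m V N kappa.
Proof.
have [l E] := limit_value_real.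
have hK i : (i <= N.+1)%N -> (l%:E <= kterm i)%E.
  move=> iN; rewrite -E /limit_value ge_min; apply/orP; left.
  by apply: (@bigmin_leq R _ _ xpredT kterm i) => //; rewrite mem_index_iota.
have hB i x : setB T m N kappa i -> kappa i <= x <= kappa i.+1 -> l <= hat T V x.
  move=> iB hx; rewrite -lee_fin -E /limit_value ge_min; apply/orP; right.
  have [iN _] := iB.
  apply: (@le_trans _ _ (ereal_inf [set (hat T V x)%:E | x in `[kappa i, kappa i.+1]])).
    apply: (@bigmin_leq R _ _ (fun i => i \in setB T m N kappa)
      (fun i => ereal_inf [set (hat T V x)%:E | x in `[kappa i, kappa i.+1]]) i).
      by rewrite mem_index_iota.
    exact: mem_set.
  by apply: ereal_inf_lbound; exists x => //=; rewrite in_itv.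
(* The value is finite, so it is attained at an index, whose upper bound applies; on [B] a point
   within [e / 2] of the infimum of [hat T V] is used. *)
have up e : 0 < e -> exists2 D0 : R, 0 < D0 & forall D, 0 < D -> D < D0 -> lambda D <= l + e.
  move=> e0; have : limit_value T m V N kappa = \big[mine/+oo%E]_(0 <= i < N.+2) kterm i \/
    limit_value T m V N kappa = \big[mine/+oo%E]_(0 <= i < N.+1 | i \in setB T m N kappa)
       ereal_inf [set (hat T V x)%:E | x in `[kappa i, kappa i.+1]].
    rewrite /limit_value; set p := (X in mine X _); set q := (X in mine _ X).
    by rewrite /mine; case: ifP => _; [left|right].
  rewrite E => -[E1|E1].
    have [E2|[i [ir _ E2]]] := bigmin_attained (index_iota 0 N.+2) xpredT kterm.
      by move: E1; rewrite E2.
    apply: (@limsup_le_kterm i) => //; last by rewrite -E2 -E1.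
    by move: ir; rewrite mem_index_iota.
  have [E2|[i [_ /set_mem iB E2]]] := bigmin_attained (index_iota 0 N.+1)
    (fun i => i \in setB T m N kappa)
    (fun i => ereal_inf [set (hat T V x)%:E | x in `[kappa i, kappa i.+1]]).
    by move: E1; rewrite E2.
  have e20 : 0 < e / 2 by rewrite divr_gt0.
  rewrite E2 in E1.
  have [|_ [x /= hx <-]] := @ereal_inf_lt _ [set (hat T V x)%:E | x in `[kappa i, kappa i.+1]] (l + e / 2)%:E.
    by rewrite -E1 lte_fin ltrDl.
  rewrite lte_fin => hl; rewrite in_itv/= in hx.
  have [D0 D00 hD0] := limsup_le_hatV iB hx e20.
  by exists D0 => // D d1 d2; have := hD0 D d1 d2; lra.
rewrite E; apply: cvg_EFin; first exact: nearW.
apply/cvgrPdist_le => e e0.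
have [D1 D10 hD1] := up e e0; have [D2 D20 hD2] := liminf_ge hK hB e0.
near=> D.
have d0 : 0 < D by near: D; exact: nbhs_right_gt.
have d1 : D < D1 by near: D; exact: nbhs_right_lt.
have d2 : D < D2 by near: D; exact: nbhs_right_lt.
have := hD1 D d0 d1; have := hD2 D d0 d2.
by rewrite ler_norml /= => h1 h2; apply/andP; split; lra.
Unshelve. all: by end_near. Qed.

End Assembly.

Theorem theorem1p3 (R : realType) (T : R) (hT : 0 < T)
  (m V : R -> R -> R)
  (hm : C21 T m) (hmper : time_periodic T m)
  (hV : continuous_rect T V) (hVper : time_periodic T V)
  (N : nat) (hN : (1 <= N)%N) (kappa : nat -> R)
  (hk0 : kappa 0%N = 0) (hk1 : kappa N.+1 = 1)
  (hkS : forall i, (i <= N)%N -> kappa i < kappa i.+1)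
  (hcrit : forall i, (1 <= i <= N)%N ->
     forall t, t \in `[0, T] -> dx m (kappa i) t = 0)
  (hAB : [set i | (i <= N)%N] = setA T m N kappa `|` setB T m N kappa)
  (lambda : R -> R)
  (hlambda : forall D, 0 < D -> principal_eigenvalue T D m V (lambda D)) :
  (lambda D)%:E @[D --> 0^'+] --> limit_value T m V N kappa.
Proof.
have [tau htau] := drift_sign_exists hT hm hk0 hk1 hkS hAB.
exact: (limit_principal_eigenvalue hT hm hV hN hk0 hk1 hkS hcrit hlambda htau).
Qed.
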